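(* Let $L$ be an even lattice in the non-degenerate rational quadratic space $V$, let $U\subseteq V$ be an isotropic subspace, and let $I=U\cap L$. The map $\mathcal{P}_U\to\mathrm{GL}(U)\times\mathrm{O}(W)$, taking $A$ to its action on $U$ and on $W=U^\perp/U$, restricts to a short exact sequence $$1\to\Gamma_{L,I}\cap\mathcal{W}_{U}=H\big(\mathrm{Hom}(\Lambda^{*},I),\mathrm{Hom}^{as}(I^{*},I)\big)\to\Gamma_{L,I}\to\mathrm{SL}(I_{L^{*}},I)\times\Gamma_{\Lambda}\to1.$$ The image $\overline{\Gamma}_{L,I}$ of $\Gamma_{L,I}$ in $\overline{\mathcal{P}}_U$ sits in a similar short exact sequence $$1\to\mathrm{Hom}(\Lambda^{*},I)\to\overline{\Gamma}_{L,I}\to\mathrm{SL}(I_{L^{*}},I)\times\Gamma_{\Lambda}\to1,$$ and after choosing a complement $\tilde{U}=\tilde{I}_{\mathbb{Q}}$, where $\tilde I\subseteq L^*$ has unimodular pairing with $I$, with the associated map $\iota:\tilde I_L\to\Delta_\Lambda$, the restriction of this last short exact sequence to pre-images of $\mathrm{SL}(I_{\iota},I)\times\Gamma_{\Lambda}$ splits as a semi-direct product in the corresponding coordinates.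
   Context: **Lattices.** $V$ is a finite-dimensional $\mathbb{Q}$-vector space with a non-degenerate symmetric bilinear form $(\cdot,\cdot)$; $v^2:=(v,v)$. $L\subseteq V$ is an even lattice: a finitely generated subgroup of full rank with $(\lambda,\lambda)\in2\mathbb{Z}$ for all $\lambda\in L$. $L^*=\{\nu\in V:(\nu,L)\subseteq\mathbb{Z}\}\supseteq L$. $U$ isotropic means $U\subseteq U^\perp$; $W=U^\perp/U$ with its induced non-degenerate form. Put $I=U\cap L$, $I_{L^*}=U\cap L^*$, $I^\perp_L=U^\perp\cap L$, $I^\perp_{L^*}=U^\perp\cap L^*$. Then $\Lambda=I^\perp_L/I\subseteq W$ is an even lattice, with dual $\Lambda^*=I^\perp_{L^*}/I_{L^*}\subseteq W$; $\Delta_\Lambda=\Lambda^*/\Lambda$ with its $\mathbb{Q}/\mathbb{Z}$-valued bilinear form. For vector spaces $X^*$ denotes the dual vector space; for lattices it denotes the $\mathbb{Z}$-dual. $\mathrm{Hom}$ groups between lattices are viewed inside the $\mathrm{Hom}_{\mathbb{Q}}$ of their $\mathbb{Q}$-spans. **Groups.** $\mathcal{P}_U$ is the stabilizer of $U$ in $\mathrm{O}(V)$; $\mathcal{W}_U$ is the kernel of $\mathcal{P}_U\to\mathrm{GL}(U)\times\mathrm{O}(W)$. $\mathrm{SO}^+(V_{\mathbb{R}})$ is the identity component of $\mathrm{O}(V_{\mathbb{R}})$; $\Gamma_L$ is the group of automorphisms of $L$ lying in $\mathrm{SO}^+(V_{\mathbb{R}})$ and acting trivially on $L^*/L$; $\Gamma_\Lambda$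 is defined similarly for $\Lambda\subseteq W$. $\mathcal{P}^0_{U_{\mathbb{R}}}$ is the identity component of $\mathcal{P}_{U_{\mathbb{R}}}$ and $\Gamma_{L,I}=\mathcal{P}^0_{U_{\mathbb{R}}}\cap\Gamma_L$. For a lattice $I\subseteq J\subseteq U$, $\mathrm{SL}(J,I)=\{M\in\mathrm{SL}(I):u-Mu\in I\ \forall u\in J\}$, where $\mathrm{SL}(I)$ is the group of determinant 1 automorphisms of $I$. **Complement and coordinates.** A sublattice $\tilde I\subseteq L^*$ has unimodular pairing with $I$ if the map $\tilde I\to I^*=\mathrm{Hom}(I,\mathbb{Z})$ induced by the (integral) pairing is an isomorphism (such $\tilde I$ exist). Put $\tilde U=\tilde I_{\mathbb{Q}}$, a complement of $U^\perp$ in $V$. The pairing identifies $\tilde U\cong V/U^\perp\cong U^*$, and $\tilde W:=(U\oplus\tilde U)^\perp\cong W$, so $V=U\oplus\tilde W\oplus\tilde U$. A tilde denotes transport of maps through $W\cong\tilde W$, $U^*\cong\tilde U$, and $\tilde\Lambda\subseteq\tilde\Lambda^*\subseteq\tilde W$ are the images of $\Lambda\subseteq\Lambda^*$. For $\psi\in\mathrm{Hom}_{\mathbb{Q}}(W,U)$, $\psi^*:U^*\to W$ is its dual (using $W^*\cong W$), and $M^{-*}=(M^* )^{-1}$. $\mathrm{Hom}^{as}$ denotes maps $\eta:U^*\to U$ that are anti-symmetric, i.e. $(u^*,v^* )\mapsto(u^*,\eta v^* )$ is anti-symmetric. Let $\alpha:\tilde U\to U$ be the unique symmetric map such that $\{\tilde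 u-\alpha\tilde u:\tilde u\in\tilde U\}$ is isotropic. Every $A\in\mathcal{P}_U$ corresponds bijectively to $(M,\gamma,\psi,\eta)\in\mathrm{GL}(U)\times\mathrm{O}(W)\times\mathrm{Hom}_{\mathbb{Q}}(W,U)\times\mathrm{Hom}^{as}_{\mathbb{Q}}(U^*,U)$ via $Au=Mu$ ($u\in U$), $Aw=\tilde\gamma w-\tilde\psi\tilde\gamma w$ ($w\in\tilde W$), and, for $\tilde u\in\tilde U$, $$A\tilde u=\widetilde{M^{-*}}\tilde u+\widetilde{\psi^*}\widetilde{M^{-*}}\tilde u+\Big(M\alpha\tilde u-\alpha\widetilde{M^{-*}}\tilde u-\tfrac12\tilde\psi\widetilde{\psi^*}\widetilde{M^{-*}}\tilde u-\tilde\eta\widetilde{M^{-*}}\tilde u\Big).$$ $\mathcal{W}_U$ consists of the elements with $M=\mathrm{Id}$, $\gamma=\mathrm{Id}$, written $(\psi,\eta)$, with product $(\psi,\eta)(\varphi,\rho)=\big(\psi+\varphi,\eta+\rho+\frac{\psi\varphi^*-\varphi\psi^*}{2}\big)$. $H\big(\mathrm{Hom}(\Lambda^{*},I),\mathrm{Hom}^{as}(I^{*},I)\big)$ denotes the subgroup of $\mathcal{W}_U$ consisting of the pairs $(\psi,\eta)\in\mathrm{Hom}(\Lambda^{*},I)\times\mathrm{Hom}^{as}(I^{*},\tfrac{1}{2}I)$ with $\frac{\psi\psi^{*}}{2}+\eta\in\mathrm{Hom}(I^{*},I)$. The group $\overline{\mathcal{P}}_U=\mathcal{P}_U/\mathrm{Hom}^{as}_{\mathbb{Q}}(U^*,U)$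 has coordinates $(M,\gamma,\psi)$ with product $(M,\gamma,\psi)(N,\delta,\varphi)=(MN,\gamma\delta,\psi+M\varphi\gamma^{-1})$, so it is the semi-direct product in which $\mathrm{GL}(U)\times\mathrm{O}(W)$ acts on $\mathrm{Hom}_{\mathbb{Q}}(W,U)$ via $(M,\gamma):\psi\mapsto M\psi\gamma^{-1}$. **The map $\iota$.** Put $\tilde I_L=\{\mu\in\tilde I:\exists\nu\in L\ \forall\lambda\in I,\ (\mu,\lambda)=(\nu,\lambda)\}$. It pairs unimodularly with $I_{L^*}$, so $\mathrm{Hom}(\tilde I_L,\mathbb{Q}/\mathbb{Z})\cong U/I_{L^*}$. There is a unique homomorphism $\iota:\tilde I_L\to\Delta_\Lambda$ such that whenever $u+w+\tilde u\in L$ with $u\in U$, $w\in\tilde W$, $\tilde u\in\tilde U$, one has $\tilde u\in\tilde I_L$, $w\in\tilde\Lambda^*$ and $w+\tilde\Lambda=\iota\tilde u$ (using $\tilde\Lambda^*/\tilde\Lambda\cong\Delta_\Lambda$). Its $\mathbb{Q}/\mathbb{Z}$-dual is $\iota^*:\Delta_\Lambda\to U/I_{L^*}$, $(\iota^*\delta,\tilde u)=(\delta,\iota\tilde u)\in\mathbb{Q}/\mathbb{Z}$. $I_\iota$ is the lattice with $I_{L^*}\subseteq I_\iota\subseteq U$ and $I_\iota/I_{L^*}=\iota^*(\Delta_\Lambda)$; hence $\mathrm{SL}(I_\iota,I)\subseteq\mathrm{SL}(I_{L^*},I)$. *)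

(* Defs.v *)
From HB Require Import structures.
From mathcomp Require Import all_boot all_order all_algebra.
From mathcomp Require Import all_classical reals topology normedtype.

Set Implicit Arguments.
Unset Strict Implicit.
Unset Printing Implicit Defensive.

Import Order.TTheory GRing.Theory Num.Theory.
Import numFieldNormedType.Exports.
Import passmx.

Local Open Scope classical_set_scope.
Local Open Scope ring_scope.

Record setGroup (T : Type) := SetGroup {
  carrier : set T;
  gmul : T -> T -> T;
  gone : T }.

Definition is_group T (G : setGroup T) : Prop :=
  let A := carrier G in let m := gmul G in let e := gone G in
  [/\ A e,
      forall x y, A x -> A y -> A (m x y),
      forall x y z, A x -> A y -> A z -> m x (m y z) = m (m x y) z,
      forall x, A x -> m e x = x &
      forall x, A x -> exists y, [/\ A y, m y x = e & m x y = e]].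

Definition is_morphism S T (G : setGroup S) (H : setGroup T) (f : S -> T) :=
  set_fun (carrier G) (carrier H) f /\
  forall x y, carrier G x -> carrier G y ->
    f (gmul G x y) = gmul H (f x) (f y).

Definition short_exact S T Q (K : setGroup S) (G : setGroup T)
    (H : setGroup Q) (i : S -> T) (q : T -> Q) : Prop :=
  [/\ is_group K, is_group G & is_group H] /\
  [/\ is_morphism K G i, is_morphism G H q, set_inj (carrier K) i,
      i @` carrier K = [set x | carrier G x /\ q x = gone H] &
      q @` carrier G = carrier H].

Definition prod_group S T (G : setGroup S) (H : setGroup T) :
    setGroup (S * T) :=
  SetGroup (carrier G `*` carrier H)
    (fun x y => (gmul G x.1 y.1, gmul H x.2 y.2)) (gone G, gone H).

Definition lfun_group (V : vectType rat) (A : set 'End(V)) :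
    setGroup 'End(V) :=
  SetGroup A (fun f g => (f \o g)%VF) \1%VF.

Definition zspan (V : vectType rat) (s : seq V) : set V :=
  [set v | inIntSpan (in_tuple s) v].

Definition lattice_in (V : vectType rat) (X : {vspace V}) (A : set V) :=
  exists s : seq V, <<s>>%VS = X /\ A = zspan s.

Definition Zset : set rat^o := [set x | (x : rat) \is a Num.int].

(* Hom(A, B), inside the linear maps between the rational spans. *)
Definition latHom (X Y : vectType rat) (A : set X) (B : set Y) :
    set 'Hom(X, Y) := [set f | forall x, A x -> B (f x)].

Definition det_lfun (X : vectType rat) (f : 'End(X)) : rat :=
  \det (mxof (vbasis {:X}) (vbasis {:X}) f).

Definition SLlat (X : vectType rat) (I : set X) : set 'End(X) :=
  [set M : 'End(X) | M @` I = I /\ det_lfun M = 1].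

Definition SLpair (X : vectType rat) (J I : set X) : set 'End(X) :=
  [set M | SLlat I M /\ forall u, J u -> I (u - M u)].

Section Lattice.
Variables (V : vectType rat) (b : {symmetric V}).

Definition even_lattice (L : set V) : Prop :=
  lattice_in {:V} L /\
  forall v, L v -> exists m : int, b v v = (2 * m)%:~R.

Definition dual_lattice (L : set V) : set V :=
  [set v | forall x, L x -> b v x \is a Num.int].

Definition isometries : set 'End(V) :=
  [set A | forall x y, b (A x) (A y) = b x y].

(* Real points are written in the basis [vbasis {:V}]: vectors are rows and
   matrices act on the right. The topology on the groups does not depend on the
   basis. *)
Variable R : realType.

Definition real_mx (A : 'End(V)) : 'M[R]_(\dim {:V}) :=
  map_mx (ratr : rat -> R) (mxof (vbasis {:V}) (vbasis {:V}) A).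

Definition real_gram : 'M[R]_(\dim {:V}) :=
  \matrix_(i, j) ratr (b (vbasis {:V})`_i (vbasis {:V})`_j).

Definition real_space (U : {vspace V}) : 'M[R]_(\dim {:V}) :=
  map_mx (ratr : rat -> R) (msof (vbasis {:V}) U).

Definition OR : set 'M[R]_(\dim {:V}) :=
  [set A | A *m real_gram *m A^T = real_gram].

Definition SOR : set 'M[R]_(\dim {:V}) := connected_component OR 1%:M.

Definition PR (U : {vspace V}) : set 'M[R]_(\dim {:V}) :=
  [set A | OR A /\ stablemx (real_space U) A].

Definition PR0 (U : {vspace V}) : set 'M[R]_(\dim {:V}) :=
  connected_component (PR U) 1%:M.

Definition Gamma (L : set V) : set 'End(V) :=
  [set A | [/\ isometries A, A @` L = L, SOR (real_mx A) &
               forall v, dual_lattice L v -> L (A v - v)]].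

End Lattice.

Section Dual.
Variables (V : vectType rat) (b : {symmetric V}).

Definition vdual (X : vectType rat) : vectType rat := 'Hom(X, rat^o).

Definition dual_map (X Y : vectType rat) (f : 'Hom(X, Y)) :
    'Hom(vdual Y, vdual X) :=
  linfun (fun g : vdual Y => (g \o f)%VF : vdual X).

(* The identification of V with its dual given by the form. *)
Definition self_dual : 'Hom(V, vdual V) :=
  linfun (fun v => linfun (fun x => b v x : rat^o) : vdual V).

Variable U : {vspace V}.

Definition incl : 'Hom(subvs_of U, V) := linfun vsval.

Definition retr : 'Hom(V, subvs_of U) := linfun (vsproj U).

(* v |-> (v, .) restricted to U; this induces V / U^perp = U^*. *)
Definition pairing : 'Hom(V, vdual (subvs_of U)) :=
  (dual_map incl \o self_dual)%VF.

End Dual.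

(* [W] with [p : U^perp -> W] stands for any model of U^perp / U. *)
Section Parabolic.
Variables (V : vectType rat) (b : {symmetric V}) (U : {vspace V}).

Local Notation Up := (orthov b U).
Local Notation sU := (subvs_of U).
Local Notation dU := (vdual (subvs_of U)).

Variables (W : vectType rat) (p : 'Hom(subvs_of Up, W)).

Definition is_quotient : Prop :=
  limg p = fullv /\ forall x, (p x == 0) = (vsval x \in U).

(* The form induced on W; when U is isotropic it does not depend on the linear
   section [p^-1] of [p]. *)
Definition induced_form (x y : W) : rat :=
  b (vsval ((p^-1)%VF x)) (vsval ((p^-1)%VF y)).

Fact induced_form_additivel y : zmod_morphism (induced_form ^~ y).
Proof. by move=> x x'; rewrite /induced_form !linearB linearBl. Qed.

Fact induced_form_additiver x : zmod_morphism (induced_form x).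
Proof. by move=> y y'; rewrite /induced_form !linearB. Qed.

Fact induced_form_scalablel y : scalable_for *%R (induced_form ^~ y).
Proof. by move=> a x; rewrite /induced_form !linearZ linearZl_LR. Qed.

Fact induced_form_scalabler x : scalable_for (idfun \; *%R) (induced_form x).
Proof. by move=> a y; rewrite /induced_form !linearZ. Qed.

HB.instance Definition _ := isBilinear.Build rat W W rat *%R (idfun \; *%R)
  induced_form induced_form_additivel induced_form_additiver
  induced_form_scalablel induced_form_scalabler.

Fact induced_form_sym x y :
  induced_form x y = (-1) ^+ false * idfun (induced_form y x).
Proof. exact: hermC. Qed.

HB.instance Definition _ := isHermitianSesquilinear.Build rat W false idfun
  induced_form induced_form_sym.

Lemma induced_formE : is_quotient ->
  forall x y, induced_form (p x) (p y) = b (vsval x) (vsval y).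
Proof.
move=> [p_surj p_ker] x y; pose s z := (p^-1)%VF (p z).
have sK z : vsval (s z - z) \in U.
  by rewrite -p_ker linearB /= limg_lfunVK ?memv_img ?memvf ?subrr.
have U0 (z u : subvs_of Up) : vsval u \in U -> b (vsval z) (vsval u) = 0.
  by move=> uU; have /mem_orthovP := subvsP z; apply.
have H1 (z t : subvs_of Up) : b (vsval z) (vsval (s t)) = b (vsval z) (vsval t).
  apply/eqP; rewrite -subr_eq0 -(linearBr b) -(linearB (@vsval _ _ Up)).
  exact/eqP/U0/sK.
by rewrite /induced_form -/(s x) -/(s y) H1 hermC H1 [RHS]hermC.
Qed.

Local Notation bW := (induced_form : {symmetric W}).

Definition PU : set 'End(V) :=
  [set A | isometries b A /\ (A @: U)%VS = U].

Definition act_U (A : 'End(V)) : 'End(sU) := (retr U \o A \o incl U)%VF.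

Definition act_W (A : 'End(V)) : 'End(W) :=
  (p \o retr Up \o A \o incl Up \o p^-1)%VF.

Definition act (A : 'End(V)) : 'End(sU) * 'End(W) := (act_U A, act_W A).

Definition WU : set 'End(V) := [set A | PU A /\ act A = (\1%VF, \1%VF)].

(* (f, g) |-> f (eta g) is anti-symmetric on the dual of U. *)
Definition antisym : set 'Hom(dU, sU) :=
  [set eta | forall f g : dU, f (eta g) = - g (eta f)].

(* The embedding of Hom^as(U^*, U) in [PU]. It is the identity on U^perp, so it
   involves no complement. *)
Definition central (eta : 'Hom(dU, sU)) : 'End(V) :=
  (\1 - (incl U \o eta \o pairing b U))%VF.

Definition as_coset (A : 'End(V)) : set 'End(V) :=
  [set (A \o central eta)%VF | eta in antisym].

Definition coset_group (X : set (set 'End(V))) : setGroup (set 'End(V)) :=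
  SetGroup X (fun C D => [set (A \o B)%VF | A in C & B in D]) (as_coset \1%VF).

(* [act] is constant on cosets. *)
Definition act_bar (C : set 'End(V)) : 'End(sU) * 'End(W) :=
  act (xget \1%VF C).

(* Hom(W, U) -> PU / Hom^as(U^*, U): the class of (psi, eta) for any eta,
   i.e. the elements of WU sending w in U^perp to w - psi(w mod U). *)
Definition hom_coset (psi : 'Hom(W, sU)) : set 'End(V) :=
  [set A | WU A /\
           forall x : subvs_of Up, A (vsval x) = vsval x - vsval (psi (p x))].

Variable L : set V.

Definition lat_I : set sU := [set u | L (vsval u)].
Definition lat_Idual : set sU := [set u | dual_lattice b L (vsval u)].
Definition Lambda : set W := p @` [set x | L (vsval x)].
Definition Lambda_dual : set W := dual_lattice bW Lambda.

Definition GammaLI (R : realType) : set 'End(V) :=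
  [set A | [/\ PU A, PR0 b U (real_mx R A) & Gamma b R L A]].

Definition GammaLambda (R : realType) : set 'End(W) := Gamma bW R Lambda.

Definition GammaLI_bar (R : realType) : set (set 'End(V)) :=
  as_coset @` GammaLI R.

Definition SL_Gamma (J : set sU) (R : realType) : setGroup ('End(sU) * 'End(W)) :=
  prod_group (lfun_group (SLpair J lat_I)) (lfun_group (GammaLambda R)).

Definition hom_group : setGroup 'Hom(W, sU) :=
  SetGroup (latHom Lambda_dual lat_I) (fun f g => f + g) 0.

Variables (Ut : {vspace V}) (It : set V).

Definition lat_Istar : set dU := latHom lat_I Zset.

Definition unimodular_complement : Prop :=
  [/\ lattice_in Ut It, It `<=` dual_lattice b L &
      set_bij It lat_Istar (pairing b U)].

Local Notation Wt := (orthov b (U + Ut)).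

Definition is_alpha (alpha : 'Hom(subvs_of Ut, sU)) : Prop :=
  (forall u v : subvs_of Ut,
      b (vsval u) (vsval (alpha v)) = b (vsval v) (vsval (alpha u))) /\
  (forall u v : subvs_of Ut,
      b (vsval u - vsval (alpha u)) (vsval v - vsval (alpha v)) = 0).

Definition toW : 'Hom(subvs_of Wt, W) := (p \o retr Up \o incl Wt)%VF.

Definition toUdual : 'Hom(subvs_of Ut, dU) := (pairing b U \o incl Ut)%VF.

Definition tilde_W (g : 'End(W)) : 'End(subvs_of Wt) :=
  (toW^-1 \o g \o toW)%VF.
Definition tilde_Udual (m : 'End(dU)) : 'End(subvs_of Ut) :=
  (toUdual^-1 \o m \o toUdual)%VF.
Definition tilde_psi (psi : 'Hom(W, sU)) : 'Hom(subvs_of Wt, sU) :=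
  (psi \o toW)%VF.
Definition tilde_psistar (f : 'Hom(dU, W)) : 'Hom(subvs_of Ut, subvs_of Wt) :=
  (toW^-1 \o f \o toUdual)%VF.
Definition tilde_eta (eta : 'Hom(dU, sU)) : 'Hom(subvs_of Ut, sU) :=
  (eta \o toUdual)%VF.

(* The dual U^* -> W^* = W of a map W -> U. *)
Definition adjoint (psi : 'Hom(W, sU)) : 'Hom(dU, W) :=
  ((self_dual bW)^-1 \o dual_map psi)%VF.

(* M^{-*} *)
Definition contragredient (M : 'End(sU)) : 'End(dU) := ((dual_map M)^-1)%VF.

Definition GLU : set 'End(sU) := [set M | lker M = 0%VS].

Definition has_coords (alpha : 'Hom(subvs_of Ut, sU)) (A : 'End(V))
    (M : 'End(sU)) (g : 'End(W)) (psi : 'Hom(W, sU)) (eta : 'Hom(dU, sU)) :=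
  [/\ [/\ PU A, GLU M, isometries bW g & antisym eta],
      forall u : sU, A (vsval u) = vsval (M u),
      forall w : subvs_of Wt,
        A (vsval w) = vsval (tilde_W g w) - vsval (tilde_psi psi (tilde_W g w)) &
      forall u : subvs_of Ut,
        let u' := tilde_Udual (contragredient M) u in
        let w' := tilde_psistar (adjoint psi) u' in
        A (vsval u) = vsval u' + vsval w'
          + vsval (M (alpha u) - alpha u' - 2^-1 *: tilde_psi psi w'
                   - tilde_eta eta u')].

(* I/2 *)
Definition lat_Ihalf : set sU := [set u | lat_I (2 *: u)].

Definition H_group (alpha : 'Hom(subvs_of Ut, sU)) : set 'End(V) :=
  [set A | exists psi eta,
     [/\ has_coords alpha A \1%VF \1%VF psi eta,
         latHom Lambda_dual lat_I psi,
         antisym eta /\ latHom lat_Istar lat_Ihalf eta &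
         latHom lat_Istar lat_I (2^-1 *: (psi \o adjoint psi)%VF + eta)]].

Definition It_L : set V :=
  [set m | It m /\ exists2 n, L n & forall u, lat_I u ->
                     b m (vsval u) = b n (vsval u)].

(* iota : It_L -> Lambda^* / Lambda is given by representatives in Lambda^*. *)
Definition is_iota (iota : V -> W) : Prop :=
  [/\ forall m, It_L m -> Lambda_dual (iota m),
      forall m n, It_L m -> It_L n ->
        Lambda (iota (m + n) - (iota m + iota n)) &
      forall (u : sU) (w : subvs_of Wt) (m : subvs_of Ut),
        L (vsval u + vsval w + vsval m) ->
        [/\ It_L (vsval m), Lambda_dual (toW w) &
            Lambda (toW w - iota (vsval m))]].

(* The elements of U in a class iota^* delta. *)
Definition lat_Iiota (iota : V -> W) : set sU :=
  [set u | exists2 d, Lambda_dual d & forall m, It_L m ->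
             b (vsval u) m - bW d (iota m) \is a Num.int].

(* The element of PU / Hom^as(U^*, U) with given coordinates (M, g, psi). *)
Definition coords_coset (alpha : 'Hom(subvs_of Ut, sU))
    (t : 'End(sU) * 'End(W) * 'Hom(W, sU)) : set 'End(V) :=
  [set A | exists eta, has_coords alpha A t.1.1 t.1.2 t.2 eta].

Definition semidirect (S : setGroup ('End(sU) * 'End(W)))
    (H : setGroup 'Hom(W, sU)) : setGroup ('End(sU) * 'End(W) * 'Hom(W, sU)) :=
  SetGroup (carrier S `*` carrier H)
    (fun s t => (gmul S s.1 t.1,
                 gmul H s.2 (s.1.1 \o t.2 \o s.1.2^-1)%VF))
    (gone S, gone H).

(* The exact sequence 1 -> H -> G -> S -> 1 given by hom_coset and act_bar is
   the one of the semi-direct product of S and H, in coordinates. *)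
Definition splits_in_coords (alpha : 'Hom(subvs_of Ut, sU))
    (H : setGroup 'Hom(W, sU)) (G : setGroup (set 'End(V)))
    (S : setGroup ('End(sU) * 'End(W))) : Prop :=
  [/\ is_group (semidirect S H),
      is_morphism (semidirect S H) G (coords_coset alpha),
      set_bij (carrier (semidirect S H)) (carrier G) (coords_coset alpha),
      forall psi, carrier H psi ->
        coords_coset alpha (\1%VF, \1%VF, psi) = hom_coset psi &
      forall t, carrier (semidirect S H) t ->
        act_bar (coords_coset alpha t) = t.1].

End Parabolic.

(* Main.v *)
From HB Require Import structures.
Require Import Defs.
From mathcomp Require Import all_boot all_order all_algebra.
From mathcomp Require Import all_classical reals topology normedtype.
From mathcomp Require Import ssrAC ring lra zify.

Set Implicit Arguments.
Unset Strict Implicit.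
Unset Printing Implicit Defensive.

Import Order.TTheory GRing.Theory Num.Theory.
Import passmx.
Import numFieldNormedType.Exports.
Local Open Scope classical_set_scope.
Local Open Scope ring_scope.

(* Choose a section [sigma] of V -> U^* taking I^* into L^*, an isotropic
   section [j] congruent to [sigma] modulo U, and [k : W -> V] orthogonal to U
   and [j]. An element A of P_U is then determined by coordinates
   (M, gamma, psi, eta). It lies in Gamma_{L,I} iff det M = 1, gamma is in
   SO^+(W), and A v - v is in L for v in L^*: a path exp(tN) joins a unipotent
   element to 1, and the unipotent elements generate SL(U).

   For v = u + k w in U^perp and L^*, A v - v is in L iff M u - u - psi (gamma w)
   is in I. When M is in SL(I_{L^*}, I), the map 1 - M takes the primitive
   sublattice of such v with w = 0 into I; it extends to U^perp, and the
   restriction of the extension to W gives psi. What remains is the integrality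
   of (A sigma f - sigma f, sigma g) for f, g in I^*; on the diagonal it holds
   because L is even, so it can be achieved by changing eta. For M = 1 and
   gamma = 1 this form is - g (psi psi^* f / 2 + eta f).

   The U-components of the v above lie in I_iota, so for M in SL(I_iota, I) one
   can take psi = 0, and any psi in Hom(Lambda^*, I) is allowed: this is the
   splitting. *)

(** * Lattices and extension of linear maps *)

(** Most constructions rest on one fact: if a linear map carries the part of a lattice N in a
    subspace S into J, it can be changed off S so as to carry all of N into J, because that part is
    a direct summand of N. This yields the retraction L -> I, the lifts of Lambda^* to L^* and the
    map psi. Lattices are described by the denominators of functionals on them rather than by
    generators, so that duals and intersections require no basis. Connectedness only gives det M >
    0, since real elements of P_U act invertibly on U_R; the value 1 comes from integrality of the
    determinants of M and of its inverse. An antisymmetric eta cannot alter the diagonal of a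
    bilinear form, so the diagonal has to be integral beforehand; this is where evenness of L,
    beyond integrality, is used. Modulo the maps eta, an element of P_U is its restriction to
    U^perp. Statements on the quotient group are therefore checked there, with eta = 0 as
    representative. Everything is proved for arbitrary sections sigma, j, k; a complement then
    supplies a particular choice of them. *)

Definition zsubgroup (V : zmodType) (A : set V) :=
  A 0 /\ forall x y, A x -> A y -> A (x - y).

Lemma zsubgroupN (V : zmodType) (A : set V) x : zsubgroup A -> A x -> A (- x).
Proof. by move=> [A0 AB] Ax; rewrite -sub0r; apply: AB. Qed.

Lemma zsubgroupB (V : zmodType) (A : set V) x y :
  zsubgroup A -> A x -> A y -> A (x - y).
Proof. by move=> [A0 AB]; apply: AB. Qed.

Lemma zsubgroupD (V : zmodType) (A : set V) x y :
  zsubgroup A -> A x -> A y -> A (x + y).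
Proof.
by move=> sA Ax Ay; rewrite -[y]opprK; apply: zsubgroupB => //; apply: zsubgroupN.
Qed.

Lemma zsubgroupMn (V : zmodType) (A : set V) x n :
  zsubgroup A -> A x -> A (x *+ n).
Proof.
move=> sA Ax; elim: n => [|n IHn]; first by rewrite mulr0n; case: sA.
by rewrite mulrS; apply: zsubgroupD.
Qed.

Lemma zsubgroupMz (V : zmodType) (A : set V) x n :
  zsubgroup A -> A x -> A (x *~ n).
Proof.
move=> sA Ax; case: n => n; first exact: (zsubgroupMn n sA Ax).
by rewrite NegzE mulrNz; apply: zsubgroupN => //; exact: (zsubgroupMn n.+1 sA Ax).
Qed.

Lemma zsubgroup_sum (V : zmodType) (A : set V) (I : Type) (r : seq I)
    (P : pred I) (F : I -> V) :
  zsubgroup A -> (forall i, P i -> A (F i)) -> A (\sum_(i <- r | P i) F i).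
Proof.
move=> sA AF; elim/big_ind: _ => [|x y|i Pi]; first by case: sA.
- exact: zsubgroupD.
- exact: AF.
Qed.

(** For a subgroup, bounded denominators of every functional amount to finite generation; in this
    form the property passes to subsets at once. *)
Definition bounded_den (V : vectType rat) (A : set V) :=
  forall f : 'Hom(V, rat^o), exists2 D : nat, (0 < D)%N &
    forall x, A x -> D%:R * (f x : rat) \is a Num.int.

Definition full_rank (V : vectType rat) (A : set V) :=
  forall v, exists2 D : nat, (0 < D)%N & A (v *+ D).

Definition is_lattice (V : vectType rat) (A : set V) :=
  [/\ zsubgroup A, bounded_den A & full_rank A].

Lemma bounded_den_sub (V : vectType rat) (A B : set V) :
  A `<=` B -> bounded_den B -> bounded_den A.
Proof. by move=> sAB bB f; have [D D0 fD] := bB f; exists D => // x /sAB/fD. Qed.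

Lemma rat_common_den (I : finType) (f : I -> rat) :
  exists2 D : nat, (0 < D)%N & forall i, D%:R * f i \is a Num.int.
Proof.
exists (\prod_i `|denq (f i)|%N) => [|i].
  by rewrite prodn_gt0 // => i; rewrite absz_gt0 denq_neq0.
rewrite (bigD1 i) //= natrM mulrAC rpredM ?rpred_nat //.
rewrite -[_%:R]/((`|denq (f i)|%N : int)%:~R) absz_denq.
by rewrite mulrC -numqE intr_int.
Qed.

Lemma lattice_in_is_lattice (V : vectType rat) (A : set V) :
  lattice_in {:V} A -> is_lattice A.
Proof.
move=> [s [sV ->]]; split.
- split=> [|x y [a ->] [c ->]].
    exists [ffun=> 0]; rewrite big1 // => i _; by rewrite ffunE mulr0z.
  exists [ffun i => a i - c i]; rewrite -sumrB; apply: eq_bigr => i _.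
  by rewrite ffunE mulrzBr.
- move=> f; have [D D0 DZ] :=
    rat_common_den (fun i : 'I_(size s) => f ((in_tuple s)`_i) : rat).
  exists D => // _ [a ->]; rewrite linear_sum mulr_sumr rpred_sum // => i _.
  by rewrite raddfMz /= mulrzAr; apply/rpredMz/DZ.
- move=> v; have /coord_span vE : v \in <<in_tuple s>>%VS by rewrite sV memvf.
  have [D D0 DZ] := rat_common_den (fun i => coord (in_tuple s) i v).
  exists D => //; have /(_ _)/intrP-/choice[a aE] := DZ.
  exists [ffun i => a i]; rewrite {1}vE -sumrMnl; apply: eq_bigr => i _.
  by rewrite ffunE -scaler_nat scalerA aE scaler_int.
Qed.

Lemma exists_functional (V : vectType rat) (S : {vspace V}) v :
  v \notin S ->
  exists2 phi : 'Hom(V, rat^o), {in S, phi =1 fun=> 0} & phi v = 1.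
Proof.
(* [q] kills S but not v, so some coordinate of q, rescaled, is the functional. *)
move=> vS; pose q : 'End(V) := (\1 - projv S)%VF.
have qv : q v != 0.
  rewrite /q add_lfunE opp_lfunE id_lfunE subr_eq0; apply: contraNneq vS => ->; exact: memv_proj.
have [i ci] : exists i, coord (vbasis {:V}) i (q v) != 0.
  apply/existsP; apply: contraNT qv; rewrite negb_exists => /forallP c0.
  rewrite (coord_vbasis (memvf (q v))) big1 // => i _.
  by move/negbNE/eqP: (c0 i) => ->; rewrite scale0r.
pose c : 'Hom(V, rat^o) := linfun (coord (vbasis {:V}) i : V -> rat^o).
have cE x : c x = coord (vbasis {:V}) i x by exact: lfunE.
exists ((coord (vbasis {:V}) i (q v))^-1 *: (c \o q)%VF) => [x xS|].
  rewrite scale_lfunE comp_lfunE.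
  have -> : q x = 0.
    by rewrite /q add_lfunE opp_lfunE id_lfunE projv_id // subrr.
  by rewrite linear0 scaler0.
by rewrite scale_lfunE comp_lfunE cE; apply: (mulVf ci).
Qed.

(** The image of A lies in Z/D and is therefore cyclic: x0 realizes the least positive value, or is
    0 if phi vanishes on A. *)
Lemma functional_image_cyclic (V : vectType rat) (A : set V)
    (phi : 'Hom(V, rat^o)) :
  zsubgroup A -> bounded_den A ->
  exists2 x0, A x0 &
    forall x, A x -> exists q : int, (phi x : rat) = q%:~R * (phi x0 : rat).
Proof.
move=> sA bA; have [D D0 DZ] := bA phi.
have DN0 : D%:R != 0 :> rat by rewrite pnatr_eq0 -lt0n.
pose P n := `[< exists x, [/\ A x, (0 < n)%N & D%:R * (phi x : rat) = n%:R] >].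
have [Pn|nP] := pselect (exists n, P n); last first.
  exists 0 => [|x Ax]; first by case: sA.
  exists 0; rewrite mul0r.
  have [//|phix0] := eqVneq (phi x : rat) 0; exfalso; apply: nP.
  have /intrP[m mE] := DZ x Ax.
  have m0 : m != 0 by rewrite -(intr_eq0 rat) -mE mulf_neq0.
  exists `|m|%N; apply/asboolP; exists (x *~ sgz m); split.
  - exact: zsubgroupMz.
  - by rewrite absz_gt0.
  - rewrite raddfMz /= -mulrzr mulrA mE -intrM -[RHS]/((`|m|%N : int)%:~R).
    by rewrite mulrC -abszEsg.
case: (ex_minnP Pn) => n /asboolP[x0 [Ax0 n0 x0E]] nmin.
exists x0 => // x Ax; have /intrP[m mE] := DZ x Ax.
pose q := (m %/ n)%Z; exists q.
have yA : A (x - x0 *~ q) by apply: zsubgroupB => //; apply: zsubgroupMz.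
have yE : D%:R * (phi (x - x0 *~ q) : rat) = ((m %% n)%Z)%:~R.
  rewrite linearB raddfMz /= mulrBr -[X in _ - _ * X]mulrzr [X in _ - X]mulrA.
  rewrite mE x0E -[n%:R]/((n : int)%:~R) -intrM -intrB; congr _%:~R.
  by rewrite {1}(divz_eq m n) -/q; ring.
have r0 : (m %% n)%Z = 0.
  have [//|rn0] := eqVneq (m %% n)%Z 0; exfalso.
  have rge : 0 <= (m %% n)%Z by apply: modz_ge0; lia.
  have rlt : (m %% n)%Z < n by apply: ltz_pmod; lia.
  have : P `|(m %% n)%Z|%N.
    apply/asboolP; exists (x - x0 *~ q); split=> //; first by rewrite absz_gt0.
    by rewrite yE -[RHS]/((`|(m %% n)%Z|%N : int)%:~R) gez0_abs.
  by move/nmin; lia.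
have : (phi (x - x0 *~ q) : rat) = 0.
  by apply: (mulfI DN0); rewrite yE r0 mulr0.
by rewrite linearB raddfMz /= mulrzl => /subr0_eq.
Qed.

Lemma linfunE (aT rT : vectType rat) (f : aT -> rT) : linear f -> linfun f =1 f.
Proof.
move=> f_lin; exact: (lfunE (HB.pack_for {linear aT -> rT} f
  (GRing.isSemilinear.Build _ _ _ _ _ (GRing.semilinear_linear f_lin)))).
Qed.

Section Extend.
Variables (V Y : vectType rat) (N : set V) (J : set Y).
Hypotheses (sN : zsubgroup N) (bN : bounded_den N).

(** The part of N in S + <[v]> is the sum of its part in S and Z x0. If phi x0 is nonzero,
    subtracting a multiple of phi makes the map vanish at x0 without changing it on S; its values on
    N are then values of f on elements of N in S. *)
Lemma lattice_extend_step (S : {vspace V}) (f : 'Hom(V, Y)) v :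
  v \notin S -> (forall x, N x -> x \in S -> J (f x)) ->
  exists2 g : 'Hom(V, Y), {in S, g =1 f} &
    forall x, N x -> x \in (S + <[v]>)%VS -> J (g x).
Proof.
move=> vS fJ; have [phi phiS phiv] := exists_functional vS.
have xS x : x \in (S + <[v]>)%VS -> (phi x : rat) = 0 -> x \in S.
  move=> /memv_addP[y yS [_ /vlineP[k ->] ->]].
  have -> : phi (y + k *: v) = phi y + k *: phi v by rewrite linearD linearZ.
  rewrite (phiS y yS) add0r phiv => k0.
  have -> : k = 0 by rewrite -k0 -[k in LHS]mulr1.
  by rewrite scale0r addr0.
pose A := N `&` [set x | x \in (S + <[v]>)%VS].
have sA : zsubgroup A.
  split=> [|x y [Nx xSv] [Ny ySv]]; first by split; [case: sN | apply: mem0v].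
  by split; [apply: zsubgroupB | apply: rpredB].
have bA : bounded_den A by apply: bounded_den_sub bN => x [].
have [x0 [Nx0 x0S] phiA] := functional_image_cyclic phi sA bA.
pose h := linfun (fun x => (phi x / phi x0 : rat) *: f x0).
have hE x : h x = (phi x / phi x0 : rat) *: f x0.
  apply: linfunE => a y z; rewrite linearP /= scalerA -scalerDl.
  by congr (_ *: _); rewrite -[_ *: _]/(_ * _) mulrDl mulrA.
exists (f - h) => [x xSm|x Nx xSv].
  by rewrite add_lfunE opp_lfunE hE (phiS x xSm) mul0r scale0r subr0.
have [q qE] := phiA x (conj Nx xSv); rewrite add_lfunE opp_lfunE hE.
(* If phi x0 = 0, the quotient in [h] is 0 by convention, so nothing is corrected, and x already
   lies in S. *)
have [px0|px0] := eqVneq (phi x0 : rat) 0.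
  have phix : (phi x : rat) = 0 by rewrite qE px0 mulr0.
  by rewrite phix mul0r scale0r subr0; apply/fJ/xS.
rewrite qE mulfK // scaler_int -raddfMz -linearB; apply: fJ.
  by apply: zsubgroupB => //; apply: zsubgroupMz.
apply: xS; first by rewrite rpredB ?rpredMz.
by rewrite linearB raddfMz /= qE mulrzl subrr.
Qed.

Lemma lattice_extend (S : {vspace V}) (f : 'Hom(V, Y)) :
  (forall x, N x -> x \in S -> J (f x)) ->
  exists2 g : 'Hom(V, Y), {in S, g =1 f} & forall x, N x -> J (g x).
Proof.
have [n] := ubnP (\dim {:V} - \dim S); elim: n S f => // n IHn S f ltn fJ.
have [SV|/subvPn[v _ vS]] := boolP (fullv <= S)%VS.
  by exists f => // x Nx; apply: fJ => //; apply: (subvP SV); rewrite memvf.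
have [g gf gJ] := lattice_extend_step vS fJ.
case: (IHn _ _ _ gJ) => [|h hg hJ].
  have vline : (\dim (S :&: <[v]>) = 0)%N.
    apply/eqP; rewrite dimv_eq0 -subv0; apply/subvP => x.
    rewrite memv_cap memv0 => /andP[xS /vlineP[k xE]]; subst x.
    apply: contraNT vS => kv0; have k0 : k != 0.
      by apply: contraNneq kv0 => ->; rewrite scale0r.
    by rewrite -[v]scale1r -(mulVf k0) -scalerA rpredZ.
  have := dimv_sum_cap S <[v]>; rewrite vline addn0 dim_vline.
  have -> : v != 0 by apply: contraNneq vS => ->; rewrite mem0v.
  have := dimvS (subvf (S + <[v]>)%VS); lia.
exists h => // x xS; rewrite hg ?gf //.
by rewrite (subvP (addvSl S <[v]>)).
Qed.

End Extend.

(** On the line of v the lattice is Z x0. The functional with value 1 at x0, extended integrally to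
    V, takes an integral value at v exactly when v is an integral multiple of x0. *)
Lemma lattice_bidual (V : vectType rat) (A : set V) v : is_lattice A ->
  (forall f : 'Hom(V, rat^o), (forall x, A x -> (f x : rat) \is a Num.int) ->
     (f v : rat) \is a Num.int) -> A v.
Proof.
move=> [sA bA fA] Av; have [-> |v0] := eqVneq v 0; first by case: sA.
have [|phi _ phiv] := @exists_functional V 0%VS v; first by rewrite memv0.
pose B := A `&` [set x | x \in <[v]>%VS].
have sB : zsubgroup B.
  split=> [|x y [Ax xv] [Ay yv]]; first by split; [case: sA | apply: mem0v].
  by split; [apply: zsubgroupB | apply: rpredB].
have bB : bounded_den B by apply: bounded_den_sub bA => x [].
have phivE x : x \in <[v]>%VS -> x = (phi x : rat) *: v.
  by move=> /vlineP[k ->]; rewrite linearZ /= phiv -[_ *: 1]/(k * 1) mulr1.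
have [x0 [Ax0 x0v] phiB] := functional_image_cyclic phi sB bB.
have px0 : (phi x0 : rat) != 0.
  have [D D0 AvD] := fA v.
  have [|q] := phiB (v *+ D); first by split=> //=; rewrite rpredMn ?memv_line.
  rewrite raddfMn /= phiv => qE; apply/eqP => p0; move: qE.
  by rewrite p0 mulr0 => /eqP; rewrite pnatr_eq0 -leqn0 leqNgt D0.
pose f : 'Hom(V, rat^o) := (phi x0 : rat)^-1 *: phi.
have [x Ax xv|g gf gZ] :=
    @lattice_extend V rat^o A Zset sA bA <[v]>%VS f.
  have [q qE] := phiB x (conj Ax xv).
  rewrite /Zset /= scale_lfunE -[_ *: _]/(_ * _) qE mulrCA mulVf // mulr1.
  exact: intr_int.
have /intrP[m mE] := Av g gZ.
have : m%:~R = (phi x0 : rat)^-1.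
  rewrite -mE gf ?memv_line // scale_lfunE phiv -[_ *: _]/(_ * _) mulr1 //.
move=> mV; suff -> : v = x0 *~ m by apply: zsubgroupMz.
by rewrite (phivE x0 x0v) -scaler_int scalerA mV mulVf // scale1r.
Qed.

(** * Determinants of lattice automorphisms *)

Section DetLfun.
Variable X : vectType rat.
Implicit Types f g : 'End(X).
Local Notation e := (vbasis {:X}).

Lemma det_lfun_comp f g : det_lfun (f \o g)%VF = det_lfun f * det_lfun g.
Proof.
by rewrite /det_lfun (mxof_comp _ _ (vbasisP _)) det_mulmx mulrC.
Qed.

Lemma det_lfun1 : det_lfun (\1%VF : 'End(X)) = 1.
Proof. by rewrite /det_lfun mxof1 ?det1 // (basis_free (vbasisP _)). Qed.

Lemma det_lfun_lker0 f : det_lfun f != 0 -> lker f == 0%VS.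
Proof.
move=> df; rewrite -subv0; apply/subvP => x; rewrite memv_ker memv0.
rewrite -!(rVof_eq0 (vbasisP {:X})) (rVof_app _ (vbasisP _)) => /eqP fx.
have mU : mxof e e f \in unitmx by rewrite unitmxE unitfE.
by rewrite -[rVof _ _](mulmxK mU) fx mul0mx.
Qed.

(* The entries of the powers of [M] have bounded denominators; so the x such
   that x det(M)^k is an integer for all k form a nonzero cyclic group, which is
   stable under det(M). *)
Lemma lattice_det_int (A : set X) f :
  is_lattice A -> (forall x, A x -> A (f x)) -> det_lfun f \is a Num.int.
Proof.
move=> [sA bA fA] Af; set d := det_lfun f.
have [D1 D1n0 D1A] : exists2 D : nat, (0 < D)%N & forall i : 'I_(\dim {:X}), A (e`_i *+ D).
  have /choice[D DP] : forall i : 'I_(\dim {:X}), exists D : nat, (0 < D)%N /\ A (e`_i *+ D).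
    by move=> i; have [D] := fA e`_i; exists D.
  exists (\prod_i D i)%N => [|i]; first by rewrite prodn_gt0 // => i; case: (DP i).
  by rewrite (bigD1 i) //= mulrnA; apply: zsubgroupMn => //; case: (DP i).
have [D2 D2n0 D2A] : exists2 D : nat, (0 < D)%N &
    forall x, A x -> forall i : 'I_(\dim {:X}), D%:R * coord e i x \is a Num.int.
  have /choice[D DP] : forall i : 'I_(\dim {:X}), exists D : nat, (0 < D)%N /\
      forall x, A x -> D%:R * coord e i x \is a Num.int.
    move=> i; have [D D0 DZ] := bA (linfun (coord e i : X -> rat^o)).
    by exists D; split=> // x /DZ; rewrite lfunE.
  exists (\prod_i D i)%N => [|x Ax i]; first by rewrite prodn_gt0 // => i; case: (DP i).
  rewrite (bigD1 i) //= natrM mulrAC rpredM ?rpred_nat //.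
  by case: (DP i) => _; apply.
(* [D1] brings the basis into A and [D2] clears the coordinates of A, so D1 D2 times the matrix of
   any power of f is integral; the determinant takes one such factor per row. *)
pose E := (D1 * D2)%N%:R ^+ \dim {:X} : rat.
have E0 : E != 0 by rewrite expf_neq0 // pnatr_eq0 -lt0n muln_gt0 D1n0.
have EZ k : E * d ^+ k \is a Num.int.
  have -> : d ^+ k = \det (mxof e e (iter k (fun g => f \o g)%VF \1%VF)).
    elim: k => [|k IHk]; first by rewrite -/(det_lfun _) det_lfun1.
    by rewrite exprS IHk -!/(det_lfun _) /= det_lfun_comp.
  set g := iter _ _ _.
  have Ag x : A x -> A (g x).
    rewrite {}/g; elim: k => [|k IHk] /=; first by rewrite id_lfunE.
    by move=> Ax; rewrite comp_lfunE; apply/Af/IHk.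
  have gZ i j : ((D1 * D2)%:R *: mxof e e g) i j \is a Num.int.
    have := D2A _ (Ag _ (D1A i)) j.
    rewrite !mxE /= vecof_delta natrM -scaler_nat !linearZ /=.
    by rewrite [D1%:R * _]mulrC -mulrA.
  rewrite -detZ rpred_sum // => s _; rewrite rpredM ?rpredX ?rpredN ?rpred1 //.
  by rewrite rpred_prod.
pose B : set rat^o := [set x | forall k, (x : rat) * d ^+ k \is a Num.int].
have sB : zsubgroup B.
  split=> [k|x y Bx By k]; first by rewrite mul0r rpred0.
  by rewrite mulrBl rpredB.
have bB : bounded_den B.
  move=> phi; have [D D0 DZ] := rat_common_den (fun i : 'I_1 => phi (1 : rat) : rat).
  exists D => // x /(_ 0%N); rewrite expr0 mulr1 => xZ.
  have -> : phi x = (x : rat) * (phi (1 : rat) : rat) :> rat.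
    have h : phi ((x : rat) *: (1 : rat^o)) = (x : rat) *: phi (1 : rat).
      by rewrite linearZ.
    by rewrite -[RHS]h; congr (phi _); rewrite -[RHS]/((x : rat) * 1) mulr1.
  by rewrite mulrCA; apply: rpredM => //; apply: DZ ord0.
have [x0 Bx0 xB] := functional_image_cyclic \1%VF sB bB.
have x00 : x0 != 0.
  have /xB[q] : B E by move=> k; apply: EZ.
  by rewrite !id_lfunE => Eq; apply: contraNneq E0 => x0E; rewrite Eq x0E mulr0.
have /xB[q] : B ((x0 : rat) * d) by move=> k; rewrite -mulrA -exprS; apply: Bx0.
by rewrite !id_lfunE mulrC => /(mulIf x00) ->; apply: intr_int.
Qed.

(** The determinants of f and of its inverse are integers with product 1, and positivity singles out
    1. *)
Lemma lattice_det1 (A : set X) f : is_lattice A ->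
  [set f x | x in A] = A -> 0 < det_lfun f -> det_lfun f = 1.
Proof.
move=> lA fA df; have f0 := det_lfun_lker0 (lt0r_neq0 df).
have fVE : det_lfun f * det_lfun (f^-1)%VF = 1.
  by rewrite -det_lfun_comp lker0_compfV // det_lfun1.
have /intrP[a aE] : det_lfun f \is a Num.int.
  by apply: lattice_det_int lA _ => x Ax; rewrite -fA; exists x.
have /intrP[c cE] : det_lfun (f^-1)%VF \is a Num.int.
  apply: lattice_det_int lA _ => x.
  by rewrite -{1}fA => -[y Ay <-]; rewrite lker0_lfunK.
move: fVE df; rewrite aE cE -intrM ltr0z -[1]/(1%:~R) => /intr_inj ac a0.
have c0 : (0 < c)%R by nia.
by rewrite (_ : a = 1) //; nia.
Qed.
End DetLfun.

(** * Symmetric bilinear forms *)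

Section SymmetricForm.
Variables (V : vectType rat) (b : {symmetric V}).

Lemma symfC x y : b x y = b y x.
Proof. by rewrite hermC expr0 mul1r. Qed.

Lemma symfBl x y z : b (x - y) z = b x z - b y z.
Proof. by rewrite linearBl. Qed.

Lemma symfDl x y z : b (x + y) z = b x z + b y z.
Proof. by rewrite linearDl. Qed.

Lemma symfZl a x z : b (a *: x) z = a * b x z.
Proof. by rewrite linearZl_LR. Qed.

Lemma symfBr x y z : b z (x - y) = b z x - b z y.
Proof. by rewrite linearBr. Qed.

Lemma symfDr x y z : b z (x + y) = b z x + b z y.
Proof. by rewrite linearDr. Qed.

Lemma symfZr a x z : b z (a *: x) = a * b z x.
Proof. by rewrite linearZr. Qed.

Lemma symf0l x : b 0 x = 0. Proof. by rewrite linear0l. Qed.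

Lemma symf0r x : b x 0 = 0. Proof. by rewrite linear0r. Qed.

Lemma symfNl x y : b (- x) y = - b x y. Proof. by rewrite linearNl. Qed.

Lemma symfNr x y : b y (- x) = - b y x. Proof. by rewrite linearNr. Qed.

Lemma symf_suml (I : Type) (r : seq I) (P : pred I) (F : I -> V) y :
  b (\sum_(i <- r | P i) F i) y = \sum_(i <- r | P i) b (F i) y.
Proof.
by apply: (big_morph (fun x => b x y)) => [u v|]; rewrite ?symfDl ?symf0l.
Qed.

Definition symfE := (symfBl, symfDl, symfZl, symfBr, symfDr, symfZr, symfNl,
  symfNr, symf0l, symf0r).

Lemma self_dualE v x : self_dual b v x = b v x.
Proof.
have inner w t : (linfun (fun x => b w x : rat^o) : vdual V) t = b w t.
  by apply: linfunE => a y z; rewrite symfDr symfZr.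
rewrite /self_dual linfunE ?inner // => a y z; apply/lfunP => t.
by rewrite add_lfunE scale_lfunE !inner symfDl symfZl.
Qed.

Hypothesis b_nondeg : nondegenerate b.

Lemma nondeg_eq0 v : (forall x, b v x = 0) -> v = 0.
Proof.
move=> v0; apply/eqP; rewrite -memv0 -(eqP b_nondeg); apply/mem_orthovP => x _.
exact: v0.
Qed.

Lemma nondeg_inj v w : (forall x, b v x = b w x) -> v = w.
Proof.
move=> vw; apply/eqP; rewrite -subr_eq0; apply/eqP/nondeg_eq0 => x.
by rewrite symfBl vw subrr.
Qed.

Lemma self_dual_lker0 : lker (self_dual b) == 0%VS.
Proof.
rewrite -subv0; apply/subvP => v; rewrite memv_ker memv0 => /eqP v0.
by apply/eqP/nondeg_eq0 => x; rewrite -self_dualE v0 lfunE.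
Qed.

Lemma self_dual_limg : limg (self_dual b) = fullv.
Proof.
apply/eqP; rewrite eqEdim subvf /= limg_dim_eq; last first.
  by apply/eqP; rewrite (eqP self_dual_lker0) capv0.
by rewrite !dimvf -[dim (vdual V)]/(dim V * 1)%N muln1.
Qed.

Lemma self_dualK f x : b ((self_dual b)^-1%VF f) x = f x.
Proof. by rewrite -self_dualE limg_lfunVK // self_dual_limg memvf. Qed.

Lemma orthovK (U : {vspace V}) : orthov b (orthov b U) = U.
Proof.
apply/eqP; rewrite eqEsubv; apply/andP; split; apply/subvP => v; last first.
  move=> vU; apply/mem_orthovP => w /mem_orthovP wU; rewrite symfC; exact: wU.
apply: contraLR => /exists_functional[phi phiU phiv].
apply/mem_orthovPn; exists ((self_dual b)^-1%VF phi).
  by apply/mem_orthovP => u uU; rewrite self_dualK phiU.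
by rewrite symfC self_dualK phiv.
Qed.

Section DualLattice.
Variable L : set V.
Hypothesis latL : is_lattice L.

Lemma dual_lattice_zsubgroup : zsubgroup (dual_lattice b L).
Proof.
split=> [x _|x y Lx Ly z Lz]; first by rewrite symf0l rpred0.
by rewrite symfBl rpredB ?Lx ?Ly.
Qed.

(** A functional is the pairing with a vector of V, a positive multiple of which lies in L. *)
Lemma dual_lattice_bounded : bounded_den (dual_lattice b L).
Proof.
move=> f; have [_ _ /(_ ((self_dual b)^-1%VF f))[D D0 LD]] := latL.
exists D => // x /(_ _ LD).
by rewrite symfC -scaler_nat symfZl self_dualK.
Qed.

Lemma dual_latticeK v : (forall x, dual_lattice b L x -> b v x \is a Num.int) -> L v.
Proof.
move=> Lv; apply: lattice_bidual latL _ => f fL.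
rewrite -self_dualK symfC; apply: Lv => x Lx.
by rewrite self_dualK; apply: fL.
Qed.

End DualLattice.

Lemma even_lattice_is_lattice L : even_lattice b L -> is_lattice L.
Proof. by move=> [/lattice_in_is_lattice]. Qed.

Lemma even_latticeE L v : even_lattice b L -> L v -> b v v / 2 \is a Num.int.
Proof.
move=> [_ /(_ v) Lv] /Lv[m ->].
by rewrite intrM mulrAC divff // mul1r intr_int.
Qed.

Lemma even_lattice_integral L x y : even_lattice b L -> L x -> L y ->
  b x y \is a Num.int.
Proof.
move=> eL Lx Ly.
have -> : b x y = b (x + y) (x + y) / 2 - b x x / 2 - b y y / 2.
  by rewrite !symfE (symfC y x); field.
have [sL _ _] := even_lattice_is_lattice eL.
by rewrite !rpredB ?(even_latticeE eL) //; apply: zsubgroupD.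
Qed.

Lemma even_lattice_dual L : even_lattice b L -> L `<=` dual_lattice b L.
Proof. by move=> eL x Lx y Ly; apply: even_lattice_integral eL _ _. Qed.

Lemma isometry_lker0 A : isometries b A -> lker A == 0%VS.
Proof.
move=> isoA; rewrite -subv0; apply/subvP => v; rewrite memv_ker memv0 => /eqP v0.
by apply/eqP/nondeg_eq0 => x; rewrite -isoA v0 symf0l.
Qed.

Lemma isometryV A : isometries b A -> isometries b (A^-1)%VF.
Proof.
move=> isoA x y; have A0 := isometry_lker0 isoA.
by rewrite -isoA !lker0_lfunVK.
Qed.

Lemma isometry_adj A x y : isometries b A -> b (A x) y = b x ((A^-1)%VF y).
Proof. by move=> isoA; rewrite -[RHS]isoA lker0_lfunVK // isometry_lker0. Qed.

(** Surjectivity: for x in L, the vector A^{-1} x lies in L^* because (A^{-1} x, y) = (x, A y). Then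
    x - A^{-1} x is in L, and so is A^{-1} x. *)
Lemma isometry_lattice_img L A : is_lattice L -> L `<=` dual_lattice b L ->
  isometries b A -> (forall v, dual_lattice b L v -> L (A v - v)) ->
  [set A x | x in L] = L.
Proof.
move=> latL LL isoA AL; have A0 := isometry_lker0 isoA; have [sL _ _] := latL.
have LA x : L x -> L (A x).
  by move=> Lx; rewrite -[A x](subrK x); apply: zsubgroupD => //; apply/AL/LL.
apply/seteqP; split=> [_ [x Lx <-]|x Lx]; first exact: LA.
exists (A^-1%VF x); last by rewrite lker0_lfunVK.
have dA : dual_lattice b L (A^-1%VF x).
  move=> y Ly; rewrite -isoA lker0_lfunVK //.
  by apply: LL => //; apply: LA.
have := AL _ dA; rewrite lker0_lfunVK // => AxL.
by rewrite -[(A^-1)%VF x](subKr x); apply: zsubgroupB.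
Qed.

End SymmetricForm.

(** * The parabolic group *)

Section DualSpace.
Variables X Y : vectType rat.

Lemma vdual_sep (u v : X) : (forall f : vdual X, f u = f v) -> u = v.
Proof.
move=> uv; apply/eqP; rewrite -subr_eq0; apply/contraT; rewrite -memv0.
move=> /exists_functional[phi _]; rewrite linearB /= uv subrr => /eqP.
by rewrite eq_sym oner_eq0.
Qed.

Lemma dual_mapE (f : 'Hom(X, Y)) (g : vdual Y) x : dual_map f g x = g (f x).
Proof.
rewrite /dual_map linfunE ?comp_lfunE // => a h k.
by rewrite comp_lfunDl comp_lfunZl.
Qed.

Lemma inclE (U : {vspace X}) u : Defs.incl U u = vsval u.
Proof. by rewrite lfunE. Qed.

Lemma retrE (U : {vspace X}) x : retr U x = vsproj U x.
Proof. by rewrite lfunE. Qed.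

End DualSpace.

Lemma contragredientE (X : vectType rat) (U : {vspace X}) (M : 'End(subvs_of U)) f u :
  GLU M -> (contragredient M f) (M u) = f u.
Proof.
move=> M0; have dM0 : lker (dual_map M) == 0%VS.
  rewrite -subv0; apply/subvP => g; rewrite memv_ker memv0 => /eqP g0.
  apply/eqP/lfunP => x; rewrite -[x](lker0_lfunVK (f := M)) ?M0 //.
  by rewrite -dual_mapE g0 !lfunE.
by rewrite -dual_mapE /contragredient lker0_lfunVK.
Qed.

Section Transpose.
Variables (X V : vectType rat) (b : {symmetric V}).

(** The transpose of [c] under the form, with values in X instead of its bidual; the basis serves to
    avoid inverting the bidual map. *)
Definition transp (c : 'Hom(vdual X, V)) : 'Hom(V, X) :=
  linfun (fun v => \sum_i
    b (c (linfun (coord (vbasis {:X}) i : X -> rat^o) : vdual X)) v *: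
      (vbasis {:X})`_i).

Lemma transpE c (f : vdual X) v : f (transp c v) = b (c f) v.
Proof.
rewrite linfunE => [|a y z]; last first.
  rewrite scaler_sumr -big_split; apply: eq_bigr => i _.
  by rewrite symfDr symfZr scalerDl scalerA.
rewrite linear_sum /=.
have {2}-> : f = \sum_(i < \dim {:X}) f (vbasis {:X})`_i *:
    (linfun (coord (vbasis {:X}) i : X -> rat^o) : vdual X).
  apply/lfunP => x; rewrite sum_lfunE {1}(coord_vbasis (memvf x)) linear_sum.
  by apply: eq_bigr => i _; rewrite linearZ scale_lfunE lfunE /= [LHS]mulrC.
rewrite linear_sum symf_suml; apply: eq_bigr => i _.
by rewrite !linearZ symfZl [LHS]mulrC.
Qed.
End Transpose.

Section ParabolicGroup.
Variables (V : vectType rat) (b : {symmetric V}) (U : {vspace V}).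
Variables (W : vectType rat) (p : 'Hom(subvs_of (orthov b U), W)).
Hypotheses (b_nondeg : nondegenerate b) (Uiso : (U <= orthov b U)%VS).
Hypothesis Wq : is_quotient p.

Local Notation Up := (orthov b U).
Local Notation sU := (subvs_of U).
Local Notation bW := (induced_form p : {symmetric W}).

Lemma pairingE v u : pairing b U v u = b v (vsval u).
Proof. by rewrite /pairing comp_lfunE dual_mapE self_dualE inclE. Qed.

Lemma memUp (u : sU) : vsval u \in Up.
Proof. by apply: (subvP Uiso); apply: subvsP. Qed.

Lemma formUUp (u : sU) x : x \in Up -> b (vsval u) x = 0.
Proof. by move=> /mem_orthovP xU; rewrite symfC xU ?subvsP. Qed.

Lemma formUU (u u' : sU) : b (vsval u) (vsval u') = 0.
Proof. exact/formUUp/memUp. Qed.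

(** Defined on all of V, through the projection [vsproj], so that vectors of V need not be coerced;
    its values are meaningful on U^perp. *)
Definition quo (x : V) : W := p (vsproj Up x).

Lemma quo_linear : linear quo. Proof. by move=> a x y; rewrite /quo !linearP. Qed.
HB.instance Definition _ := GRing.isSemilinear.Build rat _ _ _ quo
  (GRing.semilinear_linear quo_linear).

Lemma quo_val (x : subvs_of Up) : quo (vsval x) = p x.
Proof. by rewrite /quo vsvalK. Qed.

Lemma form_quo x y : x \in Up -> y \in Up -> bW (quo x) (quo y) = b x y.
Proof.
move=> xU yU; have := induced_formE Wq (vsproj Up x) (vsproj Up y).
by rewrite !vsprojK.
Qed.

Lemma quo_eq0 x : x \in Up -> (quo x == 0) = (x \in U).
Proof. by move=> xU; rewrite /quo Wq.2 vsprojK. Qed.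

Lemma quoU (u : sU) : quo (vsval u) = 0.
Proof. by apply/eqP; rewrite quo_eq0 ?subvsP ?memUp. Qed.

Lemma quo_surj w : exists2 x, x \in Up & quo x = w.
Proof.
have : w \in limg p by rewrite Wq.1 memvf.
by move=> /memv_imgP[x _ ->]; exists (vsval x); rewrite ?subvsP ?quo_val.
Qed.

(** A vector of the radical lifts to U^perp and is orthogonal to U^perp, so the lift belongs to the
    double orthogonal of U, which is U. *)
Lemma induced_form_nondeg : nondegenerate bW.
Proof.
rewrite /nondegenerate -subv0; apply/subvP => w /mem_orthovP w0.
have [x xU xw] := quo_surj w; rewrite memv0 -xw quo_eq0 // -(orthovK b_nondeg U).
apply/mem_orthovP => y yU; rewrite -form_quo // xw; exact/w0/memvf.
Qed.

Lemma adjointE psi f w : bW (adjoint p psi f) w = f (psi w).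
Proof.
by rewrite /adjoint comp_lfunE self_dualK ?dual_mapE //; apply: induced_form_nondeg.
Qed.

Lemma mem_img (A : 'End(V)) x : (A @: U)%VS = U -> x \in U -> A x \in U.
Proof. by move=> AU xU; rewrite -AU memv_img. Qed.

Lemma PU1 : PU b U \1%VF.
Proof. by split=> [x y|]; rewrite ?lim1g // !id_lfunE. Qed.

Lemma PU_comp A B : PU b U A -> PU b U B -> PU b U (A \o B)%VF.
Proof.
move=> [isoA AU] [isoB BU]; split=> [x y|]; last by rewrite limg_comp BU.
by rewrite !comp_lfunE isoA.
Qed.

Lemma PU_inv A : PU b U A -> PU b U (A^-1)%VF.
Proof.
move=> [isoA AU]; have A0 := isometry_lker0 b_nondeg isoA.
split; first exact: isometryV.
by rewrite -{1}AU -limg_comp lker0_compVf // lim1g.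
Qed.

Lemma PU_lker0 A : PU b U A -> lker A == 0%VS.
Proof. by move=> [isoA _]; apply: isometry_lker0 isoA. Qed.

Lemma PU_Up A x : PU b U A -> x \in Up -> A x \in Up.
Proof.
move=> [isoA AU] /mem_orthovP xU; apply/mem_orthovP => u.
by rewrite -{1}AU => /memv_imgP[v vU ->]; rewrite isoA xU.
Qed.

Lemma act_UE A u : PU b U A -> vsval (act_U U A u) = A (vsval u).
Proof.
move=> [_ AU]; rewrite /act_U !comp_lfunE inclE retrE vsprojK //.
by apply: mem_img; rewrite ?subvsP.
Qed.

(** The lift chosen by [p^-1] differs from x by an element of U, which A keeps in U. *)
Lemma act_WE A x : PU b U A -> x \in Up -> act_W p A (quo x) = quo (A x).
Proof.
move=> PA xU; rewrite /act_W !comp_lfunE retrE inclE -/(quo _).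
apply/eqP; rewrite -subr_eq0 -linearB -linearB.
set y := vsval _ - x.
have yUp : y \in Up by rewrite rpredB ?subvsP.
rewrite quo_eq0; last by apply: PU_Up.
apply: mem_img; first by case: PA.
rewrite -quo_eq0 // /y [quo _]linearB /= quo_val limg_lfunVK ?subrr //.
by rewrite Wq.1 memvf.
Qed.

Lemma act_W_unique A (g : 'End(W)) : PU b U A ->
  (forall x, x \in Up -> quo (A x) = g (quo x)) -> act_W p A = g.
Proof.
move=> PA Ag; apply/lfunP => w; have [x xU <-] := quo_surj w.
by rewrite act_WE // Ag.
Qed.

Lemma act_U_unique A (M : 'End(sU)) : PU b U A ->
  (forall u, A (vsval u) = vsval (M u)) -> act_U U A = M.
Proof. by move=> PA AM; apply/lfunP => u; apply: subvs_inj; rewrite act_UE. Qed.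

Lemma act1 : act p \1%VF = (\1%VF, \1%VF).
Proof.
congr pair; first by apply: act_U_unique PU1 _ => u; rewrite !id_lfunE.
by apply: act_W_unique PU1 _ => x _; rewrite !id_lfunE.
Qed.

Lemma act_comp A B : PU b U A -> PU b U B ->
  act p (A \o B)%VF = ((act_U U A \o act_U U B)%VF, (act_W p A \o act_W p B)%VF).
Proof.
move=> PA PB; have PAB := PU_comp PA PB; rewrite /act; congr (_, _).
  by apply: act_U_unique => // u; rewrite [LHS]comp_lfunE (comp_lfunE (act_U U A)) !act_UE.
apply: act_W_unique => // x xU.
by rewrite (comp_lfunE A) (comp_lfunE (act_W p A)) !act_WE //; apply: PU_Up.
Qed.

Lemma act_U_GLU A : PU b U A -> GLU (act_U U A).
Proof.
move=> PA; apply/eqP; rewrite -subv0; apply/subvP => u.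
rewrite memv_ker memv0 => /eqP u0; apply/eqP/subvs_inj.
apply: (lker0P (PU_lker0 PA)).
by rewrite -act_UE // u0 /= linear0.
Qed.

Lemma act_W_isom A : PU b U A -> isometries bW (act_W p A).
Proof.
move=> PA x y; have [x' xU <-] := quo_surj x; have [y' yU <-] := quo_surj y.
by rewrite !act_WE // !form_quo ?(PU_Up PA) // PA.1.
Qed.

End ParabolicGroup.

(** * Coordinates *)

Section Splitting.
Variables (V : vectType rat) (b : {symmetric V}) (U : {vspace V}).
Variables (W : vectType rat) (p : 'Hom(subvs_of (orthov b U), W)).
Hypotheses (b_nondeg : nondegenerate b) (Uiso : (U <= orthov b U)%VS).
Hypothesis Wq : is_quotient p.

Local Notation Up := (orthov b U).
Local Notation sU := (subvs_of U).
Local Notation dU := (vdual (subvs_of U)).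
Local Notation bW := (induced_form p : {symmetric W}).
Local Notation quo := (quo p).
Local Notation iU := (Defs.incl U).

Variables (j : 'Hom(vdual (subvs_of U), V)) (k : 'Hom(W, V)).

(* [j] embeds the dual of U as an isotropic complement of U^perp, and [k] embeds
   W as the orthogonal of U + im j. *)
Definition splitting :=
  [/\ forall f u, b (j f) (vsval u) = f u,
      forall f g, b (j f) (j g) = 0,
      forall w, k w \in Up /\ quo (k w) = w &
      forall w f, b (k w) (j f) = 0].

Hypothesis sp : splitting.

Let jU f u : b (j f) (vsval u) = f u. Proof. by case: sp. Qed.
Let jj f g : b (j f) (j g) = 0. Proof. by case: sp. Qed.
Let kUp w : k w \in Up. Proof. by case: sp => _ _ /(_ w)[]. Qed.
Let quok w : quo (k w) = w. Proof. by case: sp => _ _ /(_ w)[]. Qed.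
Let kj w f : b (k w) (j f) = 0. Proof. by case: sp. Qed.

Let Uj f u : b (vsval u) (j f) = f u. Proof. by rewrite symfC jU. Qed.
Let jk w f : b (j f) (k w) = 0. Proof. by rewrite symfC kj. Qed.
Let Uk (u : sU) w : b (vsval u) (k w) = 0. Proof. by rewrite (formUUp _ (kUp w)). Qed.
Let kU (u : sU) w : b (k w) (vsval u) = 0. Proof. by rewrite symfC Uk. Qed.
Let UU (u u' : sU) : b (vsval u) (vsval u') = 0. Proof. exact: formUU Uiso u u'. Qed.
Let kk w w' : b (k w) (k w') = bW w w'.
Proof. by rewrite -(form_quo Wq) // !quok. Qed.

(** Since the image of j is isotropic and orthogonal to that of k, pairing with j sees the
    U-component and nothing else. *)
Definition prU : 'Hom(V, sU) := transp b j.
Local Notation prD := (pairing b U).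
Definition prW : 'Hom(V, W) := (p \o retr Up \o (\1 - (j \o prD)))%VF.

Lemma prUE v (f : dU) : f (prU v) = b (j f) v.
Proof. exact: transpE. Qed.

Lemma prWE v : prW v = quo (v - j (prD v)).
Proof. rewrite /prW 2!comp_lfunE add_lfunE opp_lfunE id_lfunE comp_lfunE retrE. by []. Qed.

Lemma prU_U u : prU (vsval u) = u.
Proof. by apply: vdual_sep => f; rewrite prUE jU. Qed.
Lemma prU_W w : prU (k w) = 0.
Proof. by apply: vdual_sep => f; rewrite prUE jk linear0. Qed.
Lemma prU_D f : prU (j f) = 0.
Proof. by apply: vdual_sep => g; rewrite prUE jj linear0. Qed.
Lemma prD_Up x : x \in Up -> prD x = 0.
Proof. by move=> xU; apply/lfunP => u; rewrite pairingE symfC formUUp // lfunE. Qed.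
Lemma prD_U (u : sU) : prD (vsval u) = 0.
Proof. exact/prD_Up/memUp. Qed.
Lemma prD_W w : prD (k w) = 0.
Proof. exact: prD_Up. Qed.
Lemma prD_D f : prD (j f) = f.
Proof. by apply/lfunP => u; rewrite pairingE jU. Qed.
Lemma prW_Up x : x \in Up -> prW x = quo x.
Proof. by move=> xU; rewrite prWE prD_Up // linear0 subr0. Qed.
Lemma prW_U (u : sU) : prW (vsval u) = 0.
Proof. by rewrite prW_Up ?memUp // quoU. Qed.
Lemma prW_W w : prW (k w) = w.
Proof. by rewrite prW_Up ?quok ?kUp. Qed.
Lemma prW_D f : prW (j f) = 0.
Proof. by rewrite prWE prD_D subrr linear0. Qed.

Lemma decomp v : v = vsval (prU v) + k (prW v) + j (prD v).
Proof.
set x := v - j (prD v).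
have xUp : x \in Up.
  apply/mem_orthovP => u uU; rewrite -[u](vsprojK uU) /x symfBl jU pairingE subrr //.
have yU : x - k (prW v) \in U.
  have xk : x - k (prW v) \in Up by apply: rpredB (kUp _).
  by rewrite -(quo_eq0 Wq xk) [quo _]linearB /= quok prWE subrr.
have -> : prU v = vsproj U (x - k (prW v)).
  apply: vdual_sep => f; rewrite prUE -[in RHS]jU vsprojK // /x !symfE jj jk.
  by rewrite !subr0.
by rewrite vsprojK // subrK subrK.
Qed.

Lemma form_coord u w f u' w' f' :
  b (vsval u + k w + j f) (vsval u' + k w' + j f') = f u' + f' u + bW w w'.
Proof.
rewrite !symfE !UU !Uk !kU !Uj !jU !jj !jk !kj kk.
by rewrite !(addr0, add0r) [LHS]addrC addrA.
Qed.

Lemma prU_coord (u : sU) w f : prU (vsval u + k w + j f) = u.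
Proof. by rewrite 2!linearD /= prU_U prU_W prU_D !addr0. Qed.

Lemma prW_coord (u : sU) w f : prW (vsval u + k w + j f) = w.
Proof. by rewrite 2!linearD /= prW_U prW_W prW_D addr0 add0r. Qed.

Lemma prD_coord (u : sU) w f : prD (vsval u + k w + j f) = f.
Proof. by rewrite 2!linearD /= prD_U prD_W prD_D !add0r. Qed.

Lemma Up_coord x : x \in Up -> x = vsval (prU x) + k (quo x).
Proof. by move=> xU; rewrite {1}[x]decomp prD_Up // linear0 addr0 prW_Up. Qed.

Section Make.
Variables (M : 'End(sU)) (g : 'End(W)) (psi : 'Hom(W, sU)) (eta : 'Hom(dU, sU)).

(** The U-component of the element with coordinates (M, g, psi, eta). Relative to the isotropic
    complement j, the map alpha is 0, so the two alpha terms of the general formula are absent. *)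
Definition mkA_U : 'Hom(V, sU) :=
  ((M \o prU) - (psi \o g \o prW) -
   ((2^-1 *: (psi \o adjoint p psi) + eta) \o contragredient M \o prD))%VF.
Definition mkA_W : 'Hom(V, W) :=
  ((g \o prW) + (adjoint p psi \o contragredient M \o prD))%VF.
Definition mkA : 'End(V) :=
  ((iU \o mkA_U) + (k \o mkA_W) + (j \o contragredient M \o prD))%VF.

Lemma mkAE v (f := contragredient M (prD v)) : mkA v =
  vsval (M (prU v) - psi (g (prW v)) - (2^-1 *: psi (adjoint p psi f) + eta f))
  + k (g (prW v) + adjoint p psi f) + j f.
Proof.
rewrite /mkA 2!add_lfunE (comp_lfunE iU) (comp_lfunE k) inclE.
rewrite (comp_lfunE (j \o _)%VF) (comp_lfunE j) -/f; congr (vsval _ + k _ + _).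
  rewrite /mkA_U 2!add_lfunE 2!opp_lfunE (comp_lfunE M).
  rewrite (comp_lfunE (psi \o g)%VF) (comp_lfunE psi g).
  rewrite (comp_lfunE (_ \o contragredient M)%VF) (comp_lfunE _ (contragredient M)).
  by rewrite add_lfunE scale_lfunE (comp_lfunE psi (adjoint p psi)).
rewrite /mkA_W add_lfunE (comp_lfunE g) (comp_lfunE (_ \o contragredient M)%VF).
by rewrite (comp_lfunE _ (contragredient M)).
Qed.

Lemma mkA_onU u : mkA (vsval u) = vsval (M u).
Proof.
by rewrite mkAE prU_U prW_U prD_U !linear0 !(addr0, subr0, scaler0, linear0).
Qed.

Lemma mkA_onW w : mkA (k w) = k (g w) - vsval (psi (g w)).
Proof.
rewrite mkAE prU_W prW_W prD_W !linear0 !(addr0, subr0, scaler0, linear0) sub0r.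
by rewrite linearN addrC.
Qed.

Lemma mkA_onD f (f' := contragredient M f) : mkA (j f) =
  j f' + k (adjoint p psi f')
    - vsval (2^-1 *: psi (adjoint p psi f') + eta f').
Proof.
rewrite mkAE prU_D prW_D prD_D -/f' [M 0]linear0 [g 0]linear0 [psi 0]linear0.
rewrite subr0 sub0r add0r linearN.
by rewrite [LHS]addrC addrA addrAC.
Qed.

Lemma prD_mkA v : prD (mkA v) = contragredient M (prD v).
Proof. by rewrite mkAE prD_coord. Qed.

Hypotheses (M_GL : GLU M) (g_iso : isometries bW g) (eta_as : antisym eta).

(** Between j f and j f', the two halves of psi psi^* add up to minus the product of psi^* f and
    psi^* f' in W and cancel it; the eta terms cancel by antisymmetry. Between W and j f, the term
    psi (g w) cancels the product of g w with psi^* f. *)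
Lemma mkA_isom : isometries b mkA.
Proof.
have cM f u : contragredient M f (M u) = f u by apply: contragredientE.
move=> v w; rewrite !mkAE [in RHS](decomp v) [in RHS](decomp w) !form_coord.
rewrite !linearB !linearD !linearZ /= !cM.
set f := contragredient _ _; set f' := contragredient _ _.
rewrite !symfE g_iso !(adjointE b_nondeg Wq) (symfC _ (g _)).
rewrite (adjointE b_nondeg Wq) (eta_as f f').
have -> : (f' (psi (adjoint p psi f)) : rat) = f (psi (adjoint p psi f')).
  by rewrite -!(adjointE b_nondeg Wq) symfC.
have fld (x c y t d e z : rat) : x - c + (2^-1 * - y - - t) +
    (d - e + (2^-1 * - y - t)) + (z + c + (e + y)) = x + d + z by field.
exact: fld.
Qed.

Lemma mkA_PU : PU b U mkA.
Proof.
split; first exact: mkA_isom.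
apply/eqP; rewrite eqEdim; apply/andP; split.
  apply/subvP => _ /memv_imgP[u uU ->].
  by rewrite -(vsprojK uU) mkA_onU subvsP.
rewrite limg_dim_eq // (eqP (isometry_lker0 b_nondeg mkA_isom)) capv0 //.
Qed.

Lemma act_mkA : act p mkA = (M, g).
Proof.
rewrite /act; congr (_, _).
  by apply: act_U_unique mkA_PU _ => u; rewrite mkA_onU.
apply: (act_W_unique Wq mkA_PU) => x xU.
rewrite (Up_coord xU) !linearD /= mkA_onU mkA_onW linearB /= !quok !(quoU Uiso Wq).
by rewrite subr0 linear0 !add0r.
Qed.
End Make.

Lemma centralE eta v : central b eta v = v - vsval (eta (prD v)).
Proof. by rewrite /central add_lfunE opp_lfunE id_lfunE 2!comp_lfunE inclE. Qed.

Lemma prD_eq0 x : (prD x == 0) = (x \in Up).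
Proof.
apply/eqP/idP => [x0|]; last exact: prD_Up.
by apply/mem_orthovP => u uU; rewrite -(vsprojK uU) -pairingE x0 lfunE.
Qed.

(** As A fixes U^perp, A v - v is orthogonal to U^perp, hence in U, and depends only on the class of
    v in V / U^perp = U^*. Preservation of the form on j says that the resulting map is
    antisymmetric. *)
Lemma PU_id_on_Up A : PU b U A -> (forall x, x \in Up -> A x = x) ->
  exists2 eta : 'Hom(dU, sU), antisym eta & A = central b (U := U) eta.
Proof.
move=> PA AUp; have [isoA _] := PA.
have NU v : A v - v \in U.
  rewrite -(orthovK b_nondeg U); apply/mem_orthovP => x xUp.
  by rewrite symfBl -{1}(AUp x xUp) isoA subrr.
exists (- (retr U \o (A - \1) \o j))%VF => [f f'|].
  rewrite !opp_lfunE !comp_lfunE !add_lfunE !opp_lfunE !id_lfunE !linearN /=.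
  rewrite !retrE -!jU !vsprojK // opprK; apply/eqP.
  have := formUU Uiso (Subvs (NU (j f))) (Subvs (NU (j f'))).
  rewrite /= !symfBr !symfBl isoA !jj !subr0 (symfC b (A (j f))) => h.
  by apply/eqP; move: h; lra.
apply/lfunP => v; rewrite centralE opp_lfunE (comp_lfunE _ j).
rewrite (comp_lfunE (retr U)) add_lfunE opp_lfunE id_lfunE retrE.
rewrite -[vsval (- _)]/(- vsval (vsproj U _)) opprK vsprojK //.
have /AUp : v - j (prD v) \in Up by rewrite -prD_eq0 linearB /= prD_D subrr.
by rewrite linearB addrA addrAC => <-; rewrite /= subrK.
Qed.

Lemma central_Up (eta : 'Hom(dU, sU)) x : x \in Up -> central b eta x = x.
Proof. by move=> xU; rewrite centralE prD_Up // [eta 0]linear0 subr0. Qed.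

Lemma central_PU (eta : 'Hom(dU, sU)) : antisym eta -> PU b U (central b eta).
Proof.
move=> eta_as; split=> [v w|].
  rewrite !centralE !symfE (formUU Uiso) subr0 -[b (vsval _) w]symfC -!pairingE.
  by rewrite eta_as opprK addrAC subrK.
apply/eqP; rewrite eqEsubv; apply/andP; split; apply/subvP => u.
  by move=> /memv_imgP[v vU ->]; rewrite central_Up ?(subvP Uiso).
move=> uU; apply/memv_imgP; exists u => //.
by rewrite central_Up ?(subvP Uiso).
Qed.

Lemma mkA_eta M g psi eta v : mkA M g psi eta v =
  mkA M g psi 0 v - vsval (eta (contragredient M (prD v))).
Proof.
rewrite !mkAE zero_lfunE addr0; set f := contragredient M _.
set x := M _ - _; set y := _ *: _.
rewrite -[vsval (x - (y + _))]/(vsval x - (vsval y + vsval (eta f))).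
rewrite -[vsval (x - y)]/(vsval x - vsval y).
by rewrite opprD !addrA [LHS](ACl (1*2*4*5*3)).
Qed.

Lemma coordsP A M g (psi : 'Hom(W, sU)) : PU b U A -> GLU M -> isometries bW g ->
  (forall u, A (vsval u) = vsval (M u)) ->
  (forall w, A (k w) = k (g w) - vsval (psi (g w))) ->
  exists2 eta : 'Hom(dU, sU), antisym eta & A = mkA M g psi eta.
Proof.
move=> PA M_GL g_iso AU AW.
have as0 : antisym (0 : 'Hom(dU, sU)) by move=> f f'; rewrite !zero_lfunE !linear0.
have P0 := mkA_PU psi M_GL g_iso as0; set A0 := mkA M g psi 0 in P0.
have A0_0 := PU_lker0 b_nondeg P0.
have [|x xU|eta eta_as AE] := @PU_id_on_Up (A0^-1 \o A)%VF.
- exact: PU_comp (PU_inv b_nondeg P0) PA.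
- rewrite comp_lfunE; apply: (lker0P A0_0); rewrite lker0_lfunVK //.
  by rewrite (Up_coord xU) !linearD /= AU AW mkA_onU mkA_onW.
(* A is A0 after a central element, so its correction is M (eta (prD v)); in [mkA] the map eta is
   applied to M^{-*} prD v, which explains the factor M^* on the right. *)
exists (M \o eta \o dual_map M)%VF => [f f'|].
  by rewrite !comp_lfunE -!(dual_mapE M) eta_as.
have -> : A = (A0 \o central b eta)%VF by rewrite -AE lker0_compVKf.
apply/lfunP => v; rewrite mkA_eta comp_lfunE centralE linearB /= mkA_onU.
congr (_ - vsval _); rewrite (comp_lfunE _ (dual_map M)) (comp_lfunE M); congr (M (eta _)).
by apply/lfunP => u; rewrite dual_mapE contragredientE.
Qed.

Lemma PU_coords A : PU b U A ->
  exists psi : 'Hom(W, sU), forall w, A (k w) = k (act_W p A w) - vsval (psi (act_W p A w)).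
Proof.
move=> PA; have g0 := isometry_lker0 (induced_form_nondeg b_nondeg Wq) (act_W_isom Wq PA).
set g := act_W p A in g0 *.
exists (- (prU \o A \o k \o g^-1))%VF => w.
rewrite opp_lfunE (comp_lfunE _ (g^-1)%VF) lker0_lfunK // (comp_lfunE _ k).
rewrite (comp_lfunE prU) -[vsval (- _)]/(- vsval _) opprK addrC.
have AkU : A (k w) \in Up by apply: PU_Up.
by rewrite {1}(Up_coord AkU) -(act_WE Wq PA (kUp w)) quok.
Qed.

End Splitting.

(** A basis of the part of A in a hyperplane T of S is completed by a vector x0 whose value
    generates the image of A in S under a functional with kernel T. *)
Lemma lattice_basis_in (X : vectType rat) (A : set X) (S : {vspace X}) :
  is_lattice A ->
  exists s : seq X, [/\ basis_of S s, forall x, x \in s -> A x &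
                        forall x, A x -> x \in S -> zspan s x].
Proof.
move=> [sA bA fA]; have [n] := ubnP (\dim S); elim: n S => // n IHn S ltn.
have [->|S0] := eqVneq S 0%VS.
  exists [::]; split=> // [|x _]; first exact: nil_basis.
  by rewrite memv0 => /eqP->; exists [ffun=> 0]; rewrite big_ord0.
pose v := vpick S; have v0 : v != 0 by rewrite vpick0.
have vS : v \in S := memv_pick S.
pose T := (S :\: <[v]>)%VS.
have TS : (T <= S)%VS := diffvSl _ _.
have STv : (T + <[v]> = S)%VS.
  by rewrite addv_diff; apply/addv_idPl; rewrite -memvE.
have vT : v \notin T.
  apply: contra v0 => vT; rewrite -memv0 -(capv_diff S <[v]>) memv_cap vT.
  exact: memv_line.
have dimT : (\dim S = (\dim T).+1)%N.
  have /eqP Tv0 : (T :&: <[v]> == 0)%VS by rewrite capv_diff.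
  by rewrite -STv dimv_disjoint_sum // dim_vline v0 addn1.
have [|s [sB sA' sZ]] := IHn T; first by rewrite -dimT -ltnS.
have [phi phiT phiv] := exists_functional vT.
pose B := A `&` [set x | x \in S].
have sB' : zsubgroup B.
  split=> [|x y [Ax xv] [Ay yv]]; first by split; [case: sA | apply: mem0v].
  by split; [apply: zsubgroupB | apply: rpredB].
have bB : bounded_den B by apply: bounded_den_sub bA => x [].
have [x0 [Ax0 x0S] phiB] := functional_image_cyclic phi sB' bB.
have px0 : (phi x0 : rat) != 0.
  have [D D0 AvD] := fA v.
  have [|q] := phiB (v *+ D); first by split=> //=; rewrite rpredMn.
  rewrite raddfMn /= phiv => qE; apply/eqP => p0; move: qE.
  by rewrite p0 mulr0 => /eqP; rewrite pnatr_eq0 -leqn0 leqNgt D0.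
have kerT x : x \in S -> (phi x : rat) = 0 -> x \in T.
  rewrite -STv => /memv_addP[y yT [_ /vlineP[c ->] ->]].
  have -> : phi (y + c *: v) = phi y + c *: phi v by rewrite linearD linearZ.
  rewrite (phiT y yT) add0r phiv => c0.
  have -> : c = 0 by rewrite -c0 -[c in LHS]mulr1.
  by rewrite scale0r addr0.
exists (x0 :: s); split.
- rewrite basisEdim span_cons (span_basis sB) /= dimT.
  rewrite (size_basis (X := in_tuple s) sB) leqnn andbT -STv subv_add addvSr /= -memvE.
  have -> : v = (phi x0 : rat)^-1 *: x0 + (v - (phi x0 : rat)^-1 *: x0).
    by rewrite addrC subrK.
  apply: memv_add; first by rewrite rpredZ ?memv_line.
  apply: kerT; first by rewrite rpredB ?rpredZ.
  rewrite linearB linearZ /= phiv -[_ *: _]/(_ * _) mulVf //; exact: subrr.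
- by move=> x; rewrite inE => /predU1P[->|/sA'].
move=> x Ax xS; have [q qE] := phiB x (conj Ax xS).
have [||a aE] := sZ (x - x0 *~ q).
- by apply: zsubgroupB => //; apply: zsubgroupMz.
- apply: kerT; first by rewrite rpredB ?rpredMz.
  by rewrite linearB raddfMz /= qE mulrzl subrr.
exists [ffun i : 'I_(size s).+1 => if unlift ord0 i is Some i' then a i' else q].
rewrite big_ord_recl ffunE unlift_none /= -[x in LHS](subrK (x0 *~ q)) addrC.
congr (_ + _); rewrite aE; apply: eq_bigr => i _.
by rewrite ffunE liftK.
Qed.

Lemma lattice_basis (X : vectType rat) (A : set X) : is_lattice A ->
  exists2 e : (\dim {:X}).-tuple X, basis_of {:X} e &
    forall x, A x <-> forall i, coord e i x \is a Num.int.
Proof.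
move=> latA; have [sA _ _] := latA.
have [s [sB sA' sZ]] := lattice_basis_in fullv latA.
have /eqP ss := size_basis (X := in_tuple s) sB.
have ss' : size s == \dim {:X} by rewrite eq_sym.
exists (Tuple ss') => // x; split=> [Ax i|xZ].
  have [a aE] := sZ x Ax (memvf x).
  have -> : x = \sum_(i0 < \dim {:X}) (a (cast_ord (esym (eqP ss')) i0))%:~R *: (Tuple ss')`_i0.
    rewrite [LHS]aE (reindex (cast_ord (esym (eqP ss')))) /=.
      by apply: eq_bigr => i0 _; rewrite scaler_int.
    by exists (cast_ord (eqP ss')) => i0 _; apply: val_inj.
  by rewrite coord_sum_free ?intr_int // (basis_free sB).
rewrite (coord_basis (X := Tuple ss') sB (memvf x)); apply: zsubgroup_sum => // i _.
have /intrP[m ->] := xZ i; rewrite scaler_int; apply: zsubgroupMz => //.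
by apply: sA'; rewrite mem_nth // (eqP ss').
Qed.

(* Antisymmetrize above the diagonal of an integral basis. *)
Lemma lattice_antisym (X : vectType rat) (A : set X)
    (E : vdual X -> vdual X -> rat) : is_lattice A ->
  (forall g, linear (fun f => E f g : rat^o)) ->
  (forall f, linear (fun g => E f g : rat^o)) ->
  (forall f, latHom A Zset f -> E f f \is a Num.int) ->
  exists2 eta : 'Hom(vdual X, X),
    forall f g : vdual X, f (eta g) = - g (eta f) &
    forall f g : vdual X, latHom A Zset f -> latHom A Zset g ->
      E f g - (g (eta f) : rat) \is a Num.int.
Proof.
move=> latA linl linr Eff; have [e eB eA] := lattice_basis latA.
pose c i : vdual X := linfun (coord e i : X -> rat^o).
have cE i x : c i x = coord e i x by exact: lfunE.
have cZ i : latHom A Zset (c i) by move=> x /eA; rewrite /Zset /= cE.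
have fE (f : vdual X) : f = \sum_(i < \dim {:X}) (f e`_i : rat) *: c i.
  apply/lfunP => x; rewrite sum_lfunE [in LHS](coord_basis eB (memvf x)) linear_sum.
  by apply: eq_bigr => i _; rewrite linearZ scale_lfunE cE /= [LHS]mulrC.
pose El g : {linear vdual X -> rat^o} :=
  HB.pack_for {linear vdual X -> rat^o} (fun f => E f g : rat^o)
  (GRing.isSemilinear.Build _ _ _ _ _ (GRing.semilinear_linear (linl g))).
pose Er f : {linear vdual X -> rat^o} :=
  HB.pack_for {linear vdual X -> rat^o} (fun g => E f g : rat^o)
  (GRing.isSemilinear.Build _ _ _ _ _ (GRing.semilinear_linear (linr f))).
have EE f g : E f g = \sum_(i < \dim {:X}) \sum_(j < \dim {:X})
    (f e`_i : rat) * (g e`_j : rat) * E (c i) (c j).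
  rewrite {1}[f]fE -[LHS]/(El g _) linear_sum; apply: eq_bigr => i _.
  rewrite linearZ /= [X in E _ X]fE -[E _ _]/(Er (c i) _) linear_sum scaler_sumr.
  by apply: eq_bigr => l _; rewrite linearZ /= -[LHS]/(_ * (_ * _)) mulrA.
(* N copies E above the diagonal; antisymmetry then forces the entries below it, and the diagonal is
   0. *)
pose N (i l : 'I_(\dim {:X})) : rat :=
  if (i < l)%N then E (c i) (c l) else if (l < i)%N then - E (c l) (c i) else 0.
have NN i l : N i l = - N l i.
  by rewrite /N; case: ltngtP => // _; rewrite ?opprK ?oppr0.
pose eta : 'Hom(vdual X, X) := linfun (fun f : vdual X =>
  \sum_(i < \dim {:X}) \sum_(l < \dim {:X}) ((f e`_i : rat) * N i l) *: e`_l).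
have etaE f : eta f = \sum_(i < \dim {:X}) \sum_(l < \dim {:X}) ((f e`_i : rat) * N i l) *: e`_l.
  rewrite /eta linfunE // => a f1 f2; rewrite scaler_sumr -big_split.
  apply: eq_bigr => i _; rewrite scaler_sumr -big_split; apply: eq_bigr => l _.
  rewrite add_lfunE scale_lfunE scalerA /= -scalerDl; congr (_ *: _).
  by rewrite -[_ *: _]/(_ * _) mulrDl mulrA.
have getaE (f g : vdual X) : g (eta f) =
    \sum_(i < \dim {:X}) \sum_(l < \dim {:X}) (f e`_i : rat) * (g e`_l : rat) * N i l.
  rewrite etaE linear_sum; apply: eq_bigr => i _; rewrite linear_sum.
  by apply: eq_bigr => l _; rewrite linearZ /= -[LHS]/(_ * _) mulrAC.
exists eta => [f g|f g fZ gZ].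
  rewrite !getaE exchange_big -sumrN; apply: eq_bigr => i _; rewrite -sumrN.
  by apply: eq_bigr => l _; rewrite NN mulrN [_ * (g _ : rat)]mulrC.
rewrite EE getaE -sumrB rpred_sum // => i _; rewrite -sumrB rpred_sum // => l _.
have eZ (m : 'I_(\dim {:X})) : A e`_m.
  by apply/eA => m'; rewrite coord_free ?(basis_free eB) // rpred_nat.
rewrite -mulrBr rpredM ?rpredM //; try by [apply: fZ | apply: gZ].
rewrite /N; case: ltngtP => [_|_|/val_inj->]; rewrite ?subrr ?rpred0 ?subr0 ?Eff //.
rewrite opprK.
(* Below the diagonal the error is this symmetric sum, and polarization reduces it to diagonal
   values. *)
have -> : E (c i) (c l) + E (c l) (c i) = E (c i + c l) (c i + c l) - E (c i) (c i) - E (c l) (c l).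
  have EDl g f1 f2 : E (f1 + f2) g = E f1 g + E f2 g := linearD (El g) f1 f2.
  have EDr f g1 g2 : E f (g1 + g2) = E f g1 + E f g2 := linearD (Er f) g1 g2.
  by rewrite EDl !EDr; ring.
rewrite !rpredB ?Eff // => x Ax; rewrite /Zset /= add_lfunE rpredD //.
  exact: cZ.
exact: cZ.
Qed.

(** * The action on a lattice *)

Section Arithmetic.
Variables (V : vectType rat) (b : {symmetric V}) (U : {vspace V}).
Variables (W : vectType rat) (p : 'Hom(subvs_of (orthov b U), W)).
Hypotheses (b_nondeg : nondegenerate b) (Uiso : (U <= orthov b U)%VS).
Hypothesis Wq : is_quotient p.
Variable L : set V.
Hypothesis L_even : even_lattice b L.

Local Notation Up := (orthov b U).
Local Notation sU := (subvs_of U).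
Local Notation dU := (vdual (subvs_of U)).
Local Notation bW := (induced_form p : {symmetric W}).
Local Notation quo := (quo p).
Local Notation prD := (pairing b U).
Local Notation Ld := (dual_lattice b L).
Local Notation I := (lat_I L : set sU).
Local Notation Istar := (lat_Istar L : set dU).
Local Notation La := (Lambda p L).
Local Notation Lad := (Lambda_dual p L).

Let latL : is_lattice L. Proof. exact: even_lattice_is_lattice L_even. Qed.
Let sL : zsubgroup L. Proof. by case: latL. Qed.
Let sLd : zsubgroup Ld. Proof. exact: dual_lattice_zsubgroup. Qed.

Lemma L_sub_dual : L `<=` Ld. Proof. exact: even_lattice_dual. Qed.

Lemma lat_I_lattice : is_lattice I.
Proof.
have [_ bL fL] := latL; split.
- split=> [|u v]; rewrite /lat_I /=; first by case: sL.
  by move=> Lu Lv; apply: zsubgroupB.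
- move=> f; have [D D0 DZ] := bL (f \o retr U)%VF.
  by exists D => // u /DZ; rewrite comp_lfunE retrE vsvalK.
- by move=> u; have [D D0 DL] := fL (vsval u); exists D => //; rewrite /lat_I /= raddfMn.
Qed.

Lemma mem_Lambda x : x \in Up -> L x -> La (quo x).
Proof. by move=> xU Lx; exists (vsproj Up x); rewrite //= vsprojK. Qed.

Lemma LambdaP w : La w <-> exists x, [/\ x \in Up, L x & quo x = w].
Proof.
split=> [[x Lx <-]|[x [xU Lx <-]]]; last exact: mem_Lambda.
by exists (vsval x); rewrite subvsP quo_val.
Qed.

Lemma Lambda_lattice : is_lattice La.
Proof.
have [_ bL fL] := latL; split.
- split=> [|_ _ /LambdaP[x [xU Lx <-]] /LambdaP[y [yU Ly <-]]].
    by apply/LambdaP; exists 0; split; rewrite ?mem0v ?linear0 //; case: sL.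
  by apply/LambdaP; exists (x - y); split; rewrite ?rpredB ?linearB //; apply: zsubgroupB.
- move=> f; have [D D0 DZ] := bL (f \o p \o retr Up)%VF.
  exists D => // _ /LambdaP[x [xU Lx <-]].
  by have := DZ x Lx; rewrite (comp_lfunE _ (retr Up)) comp_lfunE retrE.
- move=> w; have [x xU <-] := quo_surj Wq w; have [D D0 DL] := fL x.
  by exists D => //; rewrite -raddfMn; apply: mem_Lambda => //; rewrite rpredMn.
Qed.

Lemma quo_Lambda_dual x : x \in Up -> Ld x -> Lad (quo x).
Proof.
move=> xU Lx _ /LambdaP[y [yU Ly <-]]; rewrite (form_quo Wq) //; exact: Lx.
Qed.

(** Pairing with any lift x0 of w is integral on the part of L in U^perp; extended to a functional
    integral on L, it is pairing with some y in L^*. Then y - x0 is orthogonal to U^perp, so it lies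
    in U. *)
Lemma Lambda_dual_lift w : Lad w -> exists x, [/\ x \in Up, Ld x & quo x = w].
Proof.
have [_ bL _] := latL; have [x0 x0U <-] := quo_surj Wq w => Lw.
have [x Lx xU|g gx gL] := @lattice_extend V rat^o L Zset sL bL Up (self_dual b x0).
  by rewrite /Zset /= self_dualE -(form_quo Wq) //; apply/Lw/mem_Lambda.
pose y := (self_dual b)^-1%VF g.
have yE x : b y x = g x by rewrite self_dualK.
have yU : y - x0 \in U.
  rewrite -(orthovK b_nondeg U); apply/mem_orthovP => x xU.
  by rewrite symfBl yE gx // self_dualE subrr.
have yUp : y \in Up by rewrite -(subrK x0 y) rpredD // (subvP Uiso).
exists y; split=> // [x Lx|]; first by rewrite yE; apply: gL.
by apply/eqP; rewrite -subr_eq0 -linearB /= quo_eq0 // rpredB.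
Qed.

Lemma Lambda_sub_dual : La `<=` Lad.
Proof. by move=> _ /LambdaP[x [xU Lx <-]]; apply: quo_Lambda_dual => //; apply: L_sub_dual. Qed.

Lemma Lambda_dualK w : (forall z, Lad z -> bW w z \is a Num.int) -> La w.
Proof.
exact: (dual_latticeK (induced_form_nondeg b_nondeg Wq) Lambda_lattice).
Qed.

Lemma exists_retraction :
  exists2 pi : 'Hom(V, sU), forall u, pi (vsval u) = u & forall x, L x -> I (pi x).
Proof.
have [_ bL _] := latL.
have [x Lx xU|g gx gL] := @lattice_extend V sU L I sL bL U (retr U).
  by rewrite /lat_I /= retrE vsprojK.
by exists g => // u; rewrite gx ?subvsP // retrE vsvalK.
Qed.

Definition dual_section (sigma : 'Hom(dU, V)) :=
  (forall f u, b (sigma f) (vsval u) = f u) /\ forall f, Istar f -> Ld (sigma f).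

(** The dual of a retraction V -> U taking L to I is a section of V -> U^* taking I^* to L^*. *)
Lemma exists_dual_section : exists sigma, dual_section sigma.
Proof.
have [pi piU piL] := exists_retraction.
exists ((self_dual b)^-1 \o dual_map pi)%VF; split=> [f u|f fI x Lx].
  by rewrite comp_lfunE self_dualK // dual_mapE piU.
by rewrite comp_lfunE self_dualK // dual_mapE; apply/fI/piL.
Qed.

(* j f = sigma f - (half of the symmetric map attached to the Gram form). *)
Lemma exists_splitting sigma : dual_section sigma ->
  exists j k, splitting p j k /\ forall f, j f - sigma f \in U.
Proof.
move=> [sU' _]; pose a : 'Hom(dU, sU) := (2^-1 *: (transp b sigma \o sigma))%VF.
have aE (f g : dU) : (f (a g) : rat) = 2^-1 * b (sigma f) (sigma g).
  by rewrite scale_lfunE comp_lfunE linearZ /= transpE.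
pose j : 'Hom(dU, V) := (sigma - (Defs.incl U \o a))%VF.
have jE f : j f = sigma f - vsval (a f).
  by rewrite add_lfunE opp_lfunE comp_lfunE inclE.
have jU f u : b (j f) (vsval u) = f u by rewrite jE symfBl sU' (formUU Uiso) subr0.
have jj f g : b (j f) (j g) = 0.
  rewrite !jE !symfE (formUU Uiso) sU' (symfC b (vsval _)) sU' !aE.
  by rewrite (symfC b (sigma g)) subr0; field.
pose k : 'Hom(W, V) := ((\1 - (Defs.incl U \o transp b j)) \o Defs.incl Up \o p^-1)%VF.
have kE w : exists2 u : sU, k w = vsval (p^-1%VF w) - vsval u &
    forall f : dU, f u = b (j f) (vsval (p^-1%VF w)).
  exists (transp b j (vsval (p^-1%VF w))) => [|f]; last by rewrite transpE.
  rewrite /k 2!comp_lfunE add_lfunE opp_lfunE id_lfunE (comp_lfunE (Defs.incl U)).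
  by rewrite !inclE.
exists j, k; split; last first.
  by move=> f; rewrite jE addrC addKr -[- _]/(vsval (- a f)) subvsP.
split=> // [w|w f]; have [u -> uE] := kE w; last first.
  by rewrite symfBl [b (vsval u) _]symfC jU uE symfC subrr.
rewrite rpredB ?subvsP ?memUp //; split=> //.
by rewrite linearB /= (quoU Uiso Wq) subr0 quo_val limg_lfunVK ?Wq.1 ?memvf.
Qed.

Section WithSplitting.
Variables (sigma j : 'Hom(vdual (subvs_of U), V)) (k : 'Hom(W, V)).
Hypotheses (sig : dual_section sigma) (sp : splitting p j k).
Hypothesis jsig : forall f, j f - sigma f \in U.

Let sigU f u : b (sigma f) (vsval u) = f u. Proof. by case: sig. Qed.
Let sigL f : Istar f -> Ld (sigma f). Proof. by case: sig => _; apply. Qed.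

Lemma pairing_section f : prD (sigma f) = f.
Proof. by apply/lfunP => u; rewrite pairingE sigU. Qed.

Lemma pairing_Istar v : Ld v -> Istar (prD v).
Proof. by move=> Lv u Iu; rewrite /Zset /= pairingE; apply: Lv. Qed.

Lemma dual_decomp v : Ld v ->
  [/\ Istar (prD v), v - sigma (prD v) \in Up & Ld (v - sigma (prD v))].
Proof.
move=> Lv; have Iv := pairing_Istar Lv; split=> //.
  by rewrite -prD_eq0 linearB /= pairing_section subrr.
exact: zsubgroupB sLd Lv (sigL Iv).
Qed.

(** L is the dual of L^*, and L^* is the sum of sigma I^* and its part in U^perp. *)
Lemma mem_L_crit v : (forall x, x \in Up -> Ld x -> b v x \is a Num.int) ->
  (forall f, Istar f -> b v (sigma f) \is a Num.int) -> L v.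
Proof.
move=> vU vs; apply: (dual_latticeK b_nondeg latL) => x Lx.
have [If xU xL] := dual_decomp Lx.
have -> : b v x = b v (x - sigma (prD x)) + b v (sigma (prD x)).
  by rewrite -symfDr subrK.
by apply: rpredD; [apply: vU | apply: vs].
Qed.

Lemma mem_I u : (forall f, Istar f -> (f u : rat) \is a Num.int) -> I u.
Proof. by move=> uI; apply: lattice_bidual lat_I_lattice _ => f fI; apply: uI. Qed.

(** Since j and sigma agree modulo U, k is orthogonal to sigma too. Hence pairing a lift x in L with
    sigma f, for f in I^*, evaluates f at the U-component of x; this component is in I and can be
    subtracted. *)
Lemma k_Lambda w : La w -> L (k w).
Proof.
move=> /LambdaP[x [xU Lx <-]]; have [jU jj kU kj] := sp.
rewrite {1}(Up_coord Wq sp xU) in Lx.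
suff Iu : I (prU b j x).
  by rewrite -[k _](addKr (vsval (prU b j x))) addrC; apply: zsubgroupB.
apply: mem_I => f If; rewrite -sigU.
have -> : b (sigma f) (vsval (prU b j x)) =
    b (sigma f) (vsval (prU b j x) + k (quo x)).
  have : b (j f - sigma f) (k (quo x)) = 0.
    by rewrite -(vsprojK (jsig f)) (formUUp _ (kU _).1).
  rewrite symfDr symfBl [b (j f) _]symfC kj sub0r => /eqP.
  by rewrite oppr_eq0 => /eqP ->; rewrite addr0.
exact: sigL.
Qed.

Section Stabilizer.
Variable A : 'End(V).
Hypotheses (PA : PU b U A) (AI : [set act_U U A u | u in I] = I).
Hypothesis ALa : [set act_W p A w | w in La] = La.
Hypothesis AUp : forall x, x \in Up -> Ld x -> L (A x - x).

Let A0 : lker A == 0%VS. Proof. exact: PU_lker0 PA. Qed.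

(** A maps the part of L in U^perp onto itself: surjectivity on Lambda provides a preimage up to an
    error in U and L, that is in I, and surjectivity on I absorbs the error. *)
Lemma stab_inv_L x : x \in Up -> L x -> L ((A^-1)%VF x).
Proof.
move=> xU Lx; have := mem_Lambda xU Lx; rewrite -ALa.
move=> [_ /LambdaP[y [yU Ly <-]]]; rewrite (act_WE Wq) // => Axy.
have LAy : L (A y).
  by rewrite -(subrK y (A y)); apply: zsubgroupD => //; apply/AUp/L_sub_dual.
have AyUp := PU_Up PA yU.
have xAy : x - A y \in U.
  by rewrite -(quo_eq0 Wq) ?rpredB // linearB /= Axy subrr.
have : I (vsproj U (x - A y)) by rewrite /lat_I /= vsprojK //; apply: zsubgroupB.
rewrite -AI => -[u Iu /(congr1 vsval)]; rewrite (act_UE _ PA) vsprojK // => /eqP.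
rewrite -subr_eq0 opprB addrA subr_eq0 -linearD /= => /eqP <-.
by rewrite lker0_lfunK //; apply: zsubgroupD.
Qed.

Lemma stab_inv_Ld x : x \in Up -> Ld x -> L ((A^-1)%VF x - x).
Proof.
move=> xU Lx; have -> : (A^-1)%VF x - x = - (A^-1)%VF (A x - x).
  by rewrite linearB /= lker0_lfunK // opprB.
apply: zsubgroupN => //; apply: stab_inv_L; last exact: AUp.
by rewrite rpredB ?(PU_Up PA).
Qed.

(** Moving A to the other side gives (v, A^{-1} x - x), where the second vector is in L. *)
Lemma stab_form x v : x \in Up -> Ld x -> Ld v -> b (A v - v) x \is a Num.int.
Proof.
move=> xU Lx Lv; rewrite symfBl (isometry_adj b_nondeg _ _ PA.1) -symfBr.
by apply/Lv/stab_inv_Ld.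
Qed.

(** Knowledge of A on U^perp already makes the pairings with vectors of U^perp integral, by
    [stab_form]; what is left is the block of pairings between values of sigma. *)
Lemma stab_crit :
  (forall f g, Istar f -> Istar g ->
     b (A (sigma f) - sigma f) (sigma g) \is a Num.int) ->
  forall v, Ld v -> L (A v - v).
Proof.
move=> Afg v Lv; have [If xU xL] := dual_decomp Lv.
set x := v - _ in xU xL; have -> : v = x + sigma (prD v) by rewrite subrK.
have -> : A (x + sigma (prD v)) - (x + sigma (prD v)) =
    (A x - x) + (A (sigma (prD v)) - sigma (prD v)).
  by rewrite linearD opprD /= addrACA.
apply: zsubgroupD => //; first exact: AUp.
apply: mem_L_crit => [y yU Ly|f If']; first by apply: stab_form => //; apply: sigL.
exact: Afg.
Qed.

(* Evenness of L: with l in L, the value is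
   (sigma f - sigma h, l) - (l, l) / 2. *)
Lemma stab_form_diag h f : Istar h -> Istar f -> prD (A (sigma h)) = f ->
  b (A (sigma h) - sigma h) (sigma f) \is a Num.int.
Proof.
move=> Ih If Ahf; set y := A _ - _.
(* u is chosen to make l orthogonal to the image of sigma. Pairings of l with vectors of U^perp in
   L^* are those of y, so [mem_L_crit] puts l in L. *)
pose u := transp b sigma y; pose l := y - vsval u.
have Ll : L l.
  apply: mem_L_crit => [x xU Lx|g Ig].
    by rewrite symfBl (formUUp _ xU) subr0; apply: stab_form => //; apply: sigL.
  by rewrite symfBl (symfC b (vsval u)) sigU /u transpE symfC subrr.
pose e := sigma f - sigma h.
have Le : Ld e by exact: zsubgroupB sLd (sigL If) (sigL Ih).
have yu : b y (vsval u) = b e (vsval u).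
  by rewrite !symfBl !sigU -pairingE Ahf.
have yy : b y y = - 2 * b y (sigma h).
  have := PA.1 (sigma h) (sigma h); have : A (sigma h) = y + sigma h by rewrite subrK.
  move: (y) => y' ->.
  by rewrite symfDl 2!symfDr (symfC b (sigma h) y'); lra.
have ll : b l l = b y y - 2 * b y (vsval u).
  rewrite /l; move: (y) => y'.
  by rewrite symfBl 2!symfBr (formUU Uiso) (symfC b (vsval u)); ring.
have -> : b y (sigma f) = - (b l l / 2) + b e l.
  have -> : b e l = b y e - b e (vsval u) by rewrite /l symfBr symfC.
  by rewrite ll yy yu /e symfBr; field.
rewrite rpredD ?rpredN ?(even_latticeE L_even) //; exact: Le.
Qed.

End Stabilizer.

(** The defect of the element with eta = 0 is a bilinear form that is integral on the diagonal of
    I^*; changing eta subtracts an antisymmetric form from it, and [lattice_antisym] finds one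
    making it integral everywhere. *)
Lemma exists_eta M g (psi : 'Hom(W, sU)) : GLU M -> isometries bW g ->
  [set M u | u in I] = I -> [set g w | w in La] = La ->
  (forall x, x \in Up -> Ld x -> L (mkA p j k M g psi 0 x - x)) ->
  exists2 eta : 'Hom(dU, sU), antisym eta &
    forall v, Ld v -> L (mkA p j k M g psi eta v - v).
Proof.
move=> M_GL g_iso MI gLa AUp0; have [jU jj kU kj] := sp.
have as0 : antisym (0 : 'Hom(dU, sU)) by move=> f f'; rewrite !zero_lfunE !linear0.
set A0 := mkA p j k M g psi 0 in AUp0.
have P0 : PU b U A0 by exact: mkA_PU.
have [A0M A0g] : act_U U A0 = M /\ act_W p A0 = g.
  by have [-> ->] := act_mkA b_nondeg Uiso Wq sp psi M_GL g_iso as0.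
have A0I : [set act_U U A0 u | u in I] = I by rewrite A0M.
have A0La : [set act_W p A0 w | w in La] = La by rewrite A0g.
(* The twist by M^* compensates M^{-*} in front of eta. It also makes the diagonal value E f f the
   one of [stab_form_diag] at h = M^* f, as A0 carries the class of sigma h to f. *)
pose c : 'Hom(dU, V) := ((A0 \o sigma \o dual_map M) - (sigma \o dual_map M))%VF.
have cE f : c f = A0 (sigma (dual_map M f)) - sigma (dual_map M f).
  rewrite /c add_lfunE opp_lfunE (comp_lfunE _ (dual_map M)) (comp_lfunE A0).
  by rewrite (comp_lfunE sigma (dual_map M)).
pose E (f f' : dU) : rat := b (c f) (sigma f').
have MIs f : Istar f -> Istar (dual_map M f).
  by move=> If u Iu; rewrite dual_mapE; apply: If; rewrite -MI; exists u.
have cI f : Istar f -> Istar (contragredient M f).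
  by move=> If u; rewrite -{1}MI => -[u' Iu' <-]; rewrite contragredientE //; apply: If.
have cK f : dual_map M (contragredient M f) = f.
  by apply/lfunP => u; rewrite dual_mapE contragredientE.
have Kc f : contragredient M (dual_map M f) = f.
  apply/lfunP => u; have M0 : lker M == 0%VS by rewrite M_GL.
  by rewrite -[u](lker0_lfunVK M0) contragredientE // dual_mapE.
have [f'|f'|f If|eta eta_as etaE] := lattice_antisym (E := E) lat_I_lattice.
- by move=> a f1 f2; rewrite /E linearP symfDl symfZl.
- by move=> a f1 f2; rewrite /E linearP symfDr symfZr.
- rewrite /E cE; apply: (stab_form_diag P0 A0I A0La AUp0) => //; first exact: MIs.
  by rewrite (prD_mkA Uiso sp) pairing_section Kc.
exists eta => //.
have PA : PU b U (mkA p j k M g psi eta) by exact: mkA_PU.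
have [AM Ag] : act_U U (mkA p j k M g psi eta) = M /\ act_W p (mkA p j k M g psi eta) = g.
  by have [-> ->] := act_mkA b_nondeg Uiso Wq sp psi M_GL g_iso eta_as.
apply: stab_crit => //.
- by rewrite AM.
- by rewrite Ag.
- move=> x xU Lx; rewrite mkA_eta prD_Up // linear0 linear0 subr0; exact: AUp0.
move=> f h If Ih; rewrite mkA_eta pairing_section addrAC symfBl.
rewrite [b (vsval _) _]symfC sigU -{1 2}(cK f) -cE.
by apply: etaE => //; apply: cI.
Qed.

End WithSplitting.
End Arithmetic.

(** * Real points and identity components *)

Section Continuity.
Variable R : realType.

Lemma continuous_sum (T : topologicalType) (I : Type) (r : seq I) (P : pred I)
    (F : I -> T -> R) :
  (forall i, P i -> continuous (F i)) ->
  continuous (fun t => \sum_(i <- r | P i) F i t).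
Proof.
move=> cF; elim: r => [|i r IHr].
  have -> : (fun t => \sum_(i <- [::] | P i) F i t) = (fun=> 0 : R).
    by apply/funext => t; rewrite big_nil.
  by move=> t; exact: cst_continuous.
have [Pi|Pi] := boolP (P i); last first.
  have -> // : (fun t => \sum_(i <- i :: r | P i) F i t) =
    (fun t => \sum_(i <- r | P i) F i t).
  by apply/funext => t; rewrite big_cons (negPf Pi).
have -> : (fun t => \sum_(i <- i :: r | P i) F i t) =
  (F i \+ (fun t => \sum_(i <- r | P i) F i t)).
  by apply/funext => t; rewrite big_cons Pi.
by move=> t; apply: continuousD; [apply: cF | apply: IHr].
Qed.

Lemma continuous_prod (T : topologicalType) (I : Type) (r : seq I) (P : pred I)
    (F : I -> T -> R) :
  (forall i, P i -> continuous (F i)) ->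
  continuous (fun t => \prod_(i <- r | P i) F i t).
Proof.
move=> cF; elim: r => [|i r IHr].
  have -> : (fun t => \prod_(i <- [::] | P i) F i t) = (fun=> 1 : R).
    by apply/funext => t; rewrite big_nil.
  by move=> t; exact: cst_continuous.
have [Pi|Pi] := boolP (P i); last first.
  have -> // : (fun t => \prod_(i <- i :: r | P i) F i t) =
    (fun t => \prod_(i <- r | P i) F i t).
  by apply/funext => t; rewrite big_cons (negPf Pi).
have -> : (fun t => \prod_(i <- i :: r | P i) F i t) =
  (F i \* (fun t => \prod_(i <- r | P i) F i t)).
  by apply/funext => t; rewrite big_cons Pi.
by move=> t; apply: continuousM; [apply: cF | apply: IHr].
Qed.

Lemma continuous_mx (T : topologicalType) m n (F : T -> 'M[R]_(m, n)) :
  (forall i j, continuous (fun t => F t i j)) -> continuous F.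
Proof.
move=> cF t A [P FP sPA].
have : \forall s \near t, forall i j, P i j (F s i j).
  apply: filter_forall => i; apply: filter_forall => j.
  exact: (cF i j t _ (FP i j)).
by apply: filterS => s Fs; apply: sPA => i j; apply: Fs.
Qed.

Lemma continuous_coord (T : topologicalType) m n (F : T -> 'M[R]_(m, n)) i j :
  continuous F -> continuous (fun t => F t i j).
Proof.
move=> cF t; exact: (@continuous_comp _ _ _ F (fun M => M i j) t (cF t)
  (@coord_continuous R m n i j (F t))).
Qed.

Lemma continuous_mulr (T : topologicalType) (f g : T -> R) :
  continuous f -> continuous g -> continuous (fun t => f t * g t).
Proof. by move=> cf cg t; apply: continuousM; [apply: cf | apply: cg]. Qed.

Lemma continuous_mulmx (T : topologicalType) m n l
    (F : T -> 'M[R]_(m, n)) (H : T -> 'M[R]_(n, l)) :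
  continuous F -> continuous H -> continuous (fun t => F t *m H t).
Proof.
move=> cF cH; apply: continuous_mx => i j.
have -> : (fun t => (F t *m H t) i j) = (fun t => \sum_k F t i k * H t k j).
  by apply/funext => t; rewrite mxE.
by apply: continuous_sum => k _; apply: continuous_mulr; apply: continuous_coord.
Qed.

Lemma continuous_addmx (T : topologicalType) m n (F H : T -> 'M[R]_(m, n)) :
  continuous F -> continuous H -> continuous (fun t => F t + H t).
Proof. by move=> cF cH t; apply: continuousD; [apply: cF | apply: cH]. Qed.

Lemma continuous_scalemx (T : topologicalType) m n (a : T -> R) (M : 'M[R]_(m, n)) :
  continuous a -> continuous (fun t => a t *: M).
Proof.
move=> ca; apply: continuous_mx => i j.
have -> : (fun t => (a t *: M) i j) = (a \* (fun=> M i j)).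
  by apply/funext => t; rewrite mxE.
by move=> t; apply: continuousM; [apply: ca | apply: cst_continuous].
Qed.

Lemma continuous_det n : continuous (fun A : 'M[R]_n => \det A).
Proof.
apply: continuous_sum => s _; apply: continuous_mulr.
  by move=> A; exact: cst_continuous.
by apply: continuous_prod => i _; apply: coord_continuous.
Qed.

End Continuity.

Section ConnectedComponent.

Lemma component_image (S T : topologicalType) (A : set S) (B : set T)
    (f : S -> T) x y : continuous f -> (forall z, A z -> B (f z)) -> A x ->
  connected_component A x y -> connected_component B (f x) (f y).
Proof.
move=> cf fAB Ax Axy.
apply: (@connected_component_max _ _ (f @` connected_component A x)).
- by exists x => //; apply: connected_component_refl.
- by move=> _ [z /connected_component_sub Az <-]; apply: fAB.
- apply: connected_continuous_connected; first exact: component_connected.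
  exact: continuous_subspaceT.
- by exists y.
Qed.

Variables (R : realType) (n : nat) (G : set 'M[R]_n).
Hypothesis GM : forall A B, G A -> G B -> G (A *m B).
Hypothesis G1 : G 1%:M.

(** Right multiplication by B carries the component of 1 into that of B, which is again the
    component of 1. *)
Lemma component1M A B : connected_component G 1%:M A ->
  connected_component G 1%:M B -> connected_component G 1%:M (A *m B).
Proof.
move=> A1 B1; have GB := connected_component_sub B1.
apply: (connected_component_trans B1); rewrite -[X in connected_component _ X](mul1mx B).
apply: (@component_image _ _ G G (fun X => X *m B) 1%:M A) => // [|X GX]; last exact: GM.
apply: continuous_mulmx => // t; first exact: cvg_id.
exact: cst_continuous.
Qed.

Lemma component1V A B : connected_component G 1%:M A -> G B -> A *m B = 1%:M ->
  connected_component G 1%:M B.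
Proof.
move=> A1 GB AB; apply: connected_component_sym.
rewrite -AB -[X in connected_component _ X](mul1mx B).
apply: (@component_image _ _ G G (fun X => X *m B) 1%:M A) => // [|X GX]; last exact: GM.
apply: continuous_mulmx => // t; first exact: cvg_id.
exact: cst_continuous.
Qed.

Lemma component1_path (F : R -> 'M[R]_n) : continuous F -> F 0 = 1%:M ->
  (forall t, G (F t)) -> connected_component G 1%:M (F 1).
Proof.
move=> cF F0 GF; rewrite -F0.
apply: (@component_image _ _ [set: R]) => //.
have : connected [set: R] by apply/connected_intervalP => x y.
by move=> /(@connected_component_id _ [set: R] 0 I) ->.
Qed.

(** The determinants form a connected set of reals that contains 1 and avoids 0. *)
Lemma component1_det_gt0 m (f : 'M[R]_n -> 'M[R]_m) A : continuous f ->
  (forall X, G X -> \det (f X) != 0) -> f 1%:M = 1%:M ->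
  connected_component G 1%:M A -> 0 < \det (f A).
Proof.
move=> cf f0 f1 A1; set C := connected_component G 1%:M in A1.
have cd : connected ((fun X => \det (f X)) @` C).
  apply: connected_continuous_connected; first exact: component_connected.
  apply: continuous_subspaceT => X.
  by apply: continuous_comp; [apply: cf | apply: continuous_det].
rewrite ltNge; apply/negP => dA.
have [|||X /connected_component_sub/f0/eqP//] :=
    (iffLR (connected_intervalP _) cd) (\det (f A)) 1 _ _ 0.
- by exists A.
- by exists 1%:M; rewrite ?f1 ?det1 //; apply: connected_component_refl.
- by rewrite dA ler01.
Qed.

End ConnectedComponent.

(** * Matrices of rational maps and forms *)

Local Notation mx f := (mxof (vbasis {:_}) (vbasis {:_}) f).

Section RationalMatrices.

Lemma mx_comp (X Y Z : vectType rat) (f : 'Hom(X, Y)) (g : 'Hom(Y, Z)) :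
  mx (g \o f)%VF = mx f *m mx g.
Proof. by rewrite (mxof_comp _ _ (vbasisP _)). Qed.

Lemma mx1 (X : vectType rat) : mx (\1%VF : 'End(X)) = 1%:M.
Proof. by rewrite mxof1 // (basis_free (vbasisP _)). Qed.

Lemma mx_row (X Y : vectType rat) (f : 'Hom(X, Y)) (i : 'I_(\dim {:X})) :
  f (vbasis {:X})`_i = \sum_(l < \dim {:Y}) mx f i l *: (vbasis {:Y})`_l.
Proof.
rewrite [LHS](coord_vbasis (memvf _)); apply: eq_bigr => l _; congr (_ *: _).
by rewrite !mxE /= vecof_delta.
Qed.

Variables (V : vectType rat) (b : {symmetric V}).

Definition gram : 'M[rat]_(\dim {:V}) :=
  \matrix_(i, j) b (vbasis {:V})`_i (vbasis {:V})`_j.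

Lemma mx_gramE (X Y : vectType rat) (f : 'Hom(X, V)) (g : 'Hom(Y, V)) :
  mx f *m gram *m (mx g)^T =
    \matrix_(i, j) b (f (vbasis {:X})`_i) (g (vbasis {:Y})`_j).
Proof.
apply/matrixP => i j; rewrite [RHS]mxE (mx_row f) (mx_row g) symf_suml [LHS]mxE.
under [RHS]eq_bigr => l _ do rewrite symfZl symfC symf_suml mulr_sumr.
rewrite [RHS]exchange_big; apply: eq_bigr => l _; rewrite mxE mulr_suml.
apply: eq_bigr => l' _; rewrite [_^T _ _]mxE [gram _ _]mxE symfZl symfC.
by rewrite [RHS]mulrCA [RHS]mulrC.
Qed.

Lemma gram_sym : gram^T = gram.
Proof. by apply/matrixP => i j; rewrite !mxE symfC. Qed.

Lemma mx_form0 (X Y : vectType rat) (f : 'Hom(X, V)) (g : 'Hom(Y, V)) :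
  (forall x y, b (f x) (g y) = 0) -> mx f *m gram *m (mx g)^T = 0.
Proof. by move=> fg; rewrite mx_gramE; apply/matrixP => i j; rewrite !mxE fg. Qed.

Lemma mx_isometry A : isometries b A -> mx A *m gram *m (mx A)^T = gram.
Proof. by move=> isoA; rewrite mx_gramE; apply/matrixP => i j; rewrite !mxE isoA. Qed.

(** The Gram matrix is the matrix of the endomorphism v -> sum_l (v, e_l) e_l, which is injective by
    non-degeneracy. *)
Lemma gram_unit : nondegenerate b -> gram \in unitmx.
Proof.
move=> b_nondeg; pose h : 'End(V) := linfun (fun v => \sum_(l < \dim {:V}) b v (vbasis {:V})`_l *: (vbasis {:V})`_l).
have hE v : h v = \sum_(l < \dim {:V}) b v (vbasis {:V})`_l *: (vbasis {:V})`_l.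
  rewrite /h linfunE // => a x y; rewrite scaler_sumr -big_split.
  by apply: eq_bigr => l _; rewrite /= symfDl symfZl scalerDl scalerA.
have h0 : lker h == 0%VS.
  rewrite -subv0; apply/subvP => v; rewrite memv_ker memv0 => /eqP hv.
  apply/eqP/(nondeg_eq0 b_nondeg) => x; rewrite symfC (coord_vbasis (memvf x)).
  rewrite symf_suml big1 // => l _; rewrite symfZl symfC.
  have := coord_sum_free (fun l => b v (vbasis {:V})`_l) l (basis_free (vbasisP {:V})).
  by rewrite -hE hv linear0 => <-; rewrite mulr0.
have <- : mx h = gram.
  apply/matrixP => i j; rewrite !mxE /= vecof_delta hE.
  by rewrite coord_sum_free ?(basis_free (vbasisP _)).
have /mulmx1_unit[] // : mx h *m mx (h^-1)%VF = 1%:M.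
by rewrite -mx_comp lker0_compVf // mx1.
Qed.

End RationalMatrices.

(** * Real points of the orthogonal and parabolic groups *)

Section RealPoints.
Variable R : realType.
Local Notation toR M := (map_mx (ratr : rat -> R) M).

Section Orthogonal.
Variables (V : vectType rat) (b : {symmetric V}).

Lemma real_gramE : real_gram b R = toR (gram b).
Proof. by apply/matrixP => i j; rewrite !mxE. Qed.

Lemma real_mxE (A : 'End(V)) : real_mx R A = toR (mx A). Proof. by []. Qed.

Lemma real_mx_comp (A B : 'End(V)) : real_mx R (A \o B)%VF = real_mx R B *m real_mx R A.
Proof. by rewrite !real_mxE mx_comp map_mxM. Qed.

Lemma real_mx1 : real_mx R (\1%VF : 'End(V)) = 1%:M.
Proof. by rewrite real_mxE mx1 map_mx1. Qed.

Lemma OR_real A : isometries b A -> OR b (real_mx R A).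
Proof.
by move=> isoA; rewrite /OR /= real_gramE real_mxE map_trmx -!map_mxM mx_isometry.
Qed.

Lemma ORM (A B : 'M[R]_(\dim {:V})) : OR b A -> OR b B -> OR b (A *m B).
Proof.
rewrite /OR /= => AG BG.
by rewrite trmx_mul !mulmxA -(mulmxA A B) -(mulmxA A) BG AG.
Qed.

Lemma OR1 : OR b (1%:M : 'M[R]__).
Proof. by rewrite /OR /= mul1mx trmx1 mulmx1. Qed.

Lemma SOR_comp A B : SOR b (real_mx R A) -> SOR b (real_mx R B) ->
  SOR b (real_mx R (A \o B)%VF).
Proof. by move=> SA SB; rewrite real_mx_comp; exact: (component1M ORM OR1 SB SA). Qed.

Lemma SOR1 : SOR b (real_mx R \1%VF).
Proof. by rewrite real_mx1; apply: connected_component_refl OR1. Qed.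

Lemma SOR_inv A : nondegenerate b -> isometries b A -> SOR b (real_mx R A) ->
  SOR b (real_mx R (A^-1)%VF).
Proof.
move=> b_nondeg isoA SA; apply: (component1V ORM OR1 SA).
  exact/OR_real/isometryV.
by rewrite -real_mx_comp lker0_compVf ?real_mx1 // (isometry_lker0 b_nondeg).
Qed.

Variable U : {vspace V}.

Local Notation Ir := (toR (mx (Defs.incl U))).
Local Notation Rr := (toR (mx (retr U))).

Lemma IrRr : Ir *m Rr = 1%:M.
Proof.
rewrite -map_mxM -mx_comp (_ : (_ \o _)%VF = \1%VF) ?mx1 ?map_mx1 //.
by apply/lfunP => u; rewrite comp_lfunE retrE inclE vsvalK id_lfunE.
Qed.

Lemma incl_real_space : Ir *m real_space R U = Ir.
Proof.
rewrite /real_space -map_mxM -mx_comp; congr (map_mx _ (mxof _ _ _)).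
by apply/lfunP => u; rewrite comp_lfunE inclE projv_id ?subvsP.
Qed.

Lemma real_space_incl : exists S, real_space R U = S *m Ir.
Proof.
exists (toR (mx (retr U \o projv U)%VF)).
rewrite /real_space -map_mxM -mx_comp; congr (map_mx _ (mxof _ _ _)).
by apply/lfunP => u; rewrite 2!comp_lfunE inclE retrE vsprojK ?memv_proj.
Qed.

(** [real_space] is the matrix of a projector onto U, whose rows span U_R but are no basis; in terms
    of the basis Ir, stability exhibits the matrix E of the action on U_R. *)
Lemma stable_realP A :
  stablemx (real_space R U) A <-> exists E, Ir *m A = E *m Ir.
Proof.
have [S SE] := real_space_incl; split=> [/submxP[D DE]|[E IE]].
  exists (Ir *m D *m S).
  by rewrite -[in LHS]incl_real_space -mulmxA DE SE !mulmxA.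
apply/submxP; exists (S *m E *m Ir).
by rewrite -(mulmxA (S *m E)) incl_real_space [in LHS]SE -!mulmxA IE.
Qed.

Lemma PR_real A : PU b U A -> PR b U (real_mx R A).
Proof.
move=> [isoA AU]; split; first exact: OR_real.
apply/stable_realP; exists (toR (mx (act_U U A))).
rewrite -!map_mxM -!mx_comp; congr (map_mx _ (mxof _ _ _)).
apply/lfunP => u; rewrite (comp_lfunE A) (comp_lfunE _ (act_U U A)) !inclE.
by rewrite (act_UE _ (conj isoA AU)).
Qed.

Lemma PRM (A B : 'M[R]_(\dim {:V})) : PR b U A -> PR b U B -> PR b U (A *m B).
Proof. by move=> [OA SA] [OB SB]; split; [apply: ORM | apply: stablemxM]. Qed.

Lemma PR1 : PR b U (1%:M : 'M[R]__).
Proof. by split; [apply: OR1 | rewrite mulmx1]. Qed.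

Lemma PR0_comp A B : PR0 b U (real_mx R A) -> PR0 b U (real_mx R B) ->
  PR0 b U (real_mx R (A \o B)%VF).
Proof. by move=> SA SB; rewrite real_mx_comp; exact: (component1M PRM PR1 SB SA). Qed.

Lemma PR01 : PR0 b U (real_mx R \1%VF).
Proof. by rewrite real_mx1; apply: connected_component_refl PR1. Qed.

Lemma PR0_inv A : nondegenerate b -> PU b U A -> PR0 b U (real_mx R A) ->
  PR0 b U (real_mx R (A^-1)%VF).
Proof.
move=> b_nondeg PA SA; apply: (component1V PRM PR1 SA).
  exact/PR_real/PU_inv.
by rewrite -real_mx_comp lker0_compVf ?real_mx1 // (PU_lker0 b_nondeg PA).
Qed.

Lemma PR0_SOR (A : 'M[R]_(\dim {:V})) : PR0 b U A -> SOR b A.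
Proof.
apply: (@component_image _ _ (@PR V b R U) (@OR V b R) id).
- by move=> t; exact: cvg_id.
- by move=> X [].
- exact: PR1.
Qed.

Lemma OR_unit (A : 'M[R]_(\dim {:V})) : nondegenerate b -> OR b A -> A \in unitmx.
Proof.
move=> b_nondeg; rewrite /OR /= real_gramE => AG.
have : A *m toR (gram b) *m A^T \in unitmx by rewrite AG map_unitmx gram_unit.
by rewrite !unitmx_mul => /andP[/andP[]].
Qed.

Lemma stable_unit X E : nondegenerate b -> OR b X -> Ir *m X = E *m Ir ->
  E \in unitmx.
Proof.
move=> b_nondeg OX IE; have : row_free (Ir *m X).
  rewrite /row_free mxrankMfree ?row_free_unit ?(OR_unit b_nondeg) //.
  rewrite -/(row_free _); apply/row_freeP; exists Rr; exact: IrRr.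
rewrite IE => /row_freeP[Y EY].
by have /mulmx1_unit[] : E *m (Ir *m Y) = 1%:M by rewrite mulmxA.
Qed.

(** The block Ir X Rr of X in P_U(R) is its action on U_R. It is continuous in X and invertible, so
    its determinant keeps its sign along the component of 1. *)
Lemma PR0_det A : nondegenerate b -> PU b U A -> PR0 b U (real_mx R A) ->
  0 < det_lfun (act_U U A).
Proof.
move=> b_nondeg PA PA0; rewrite -(ltr0q R) -det_map_mx.
have -> : toR (mx (act_U U A)) = Ir *m real_mx R A *m Rr.
  by rewrite -!map_mxM -!mx_comp comp_lfunA.
apply: (@component1_det_gt0 R _ (PR b U) PR1 _ (fun X => Ir *m X *m Rr) (real_mx R A)) => //.
- apply: continuous_mulmx; last by move=> t; exact: cst_continuous.
  apply: continuous_mulmx; first by move=> t; exact: cst_continuous.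
  by move=> t; exact: cvg_id.
- move=> X [OX /stable_realP[E IE]]; rewrite IE -mulmxA IrRr mulmx1.
  by rewrite -unitfE -unitmxE (stable_unit b_nondeg OX IE).
- by rewrite mulmx1 IrRr.
Qed.

End Orthogonal.
End RealPoints.

(* SL_n over a field is generated by the 1 + N with N^2 = 0. *)
Lemma SL_unipotent_ind (F : fieldType) n (P : 'M[F]_n -> Prop) :
  (forall N : 'M_n, N *m N = 0 -> P (1%:M + N)) ->
  (forall A B, P A -> P B -> P (A *m B)) -> forall A, \det A = 1 -> P A.
Proof.
elim: n P => [|n IHn] P; last rewrite -[n.+1]/(1 + n)%N in P *.
  move=> P1 PM A dA; have -> : A = 1%:M + 0 by apply/matrixP => -[].
  by apply: P1; rewrite mul0mx.
move=> P1 PM A dA.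
have Pur (r : 'rV[F]_n) : P (block_mx 1%:M r 0 1%:M : 'M_(1 + n)).
  have -> : block_mx 1%:M r 0 1%:M = 1%:M + block_mx 0 r 0 0 :> 'M_(1 + n).
    by rewrite [in RHS]scalar_mx_block add_block_mx !addr0 add0r.
  by apply: (P1 (block_mx 0 r 0 0)); rewrite mulmx_block !(mul0mx, mulmx0, addr0) block_mx0.
have Pdl (c : 'cV[F]_n) : P (block_mx 1%:M 0 c 1%:M : 'M_(1 + n)).
  have -> : block_mx 1%:M 0 c 1%:M = 1%:M + block_mx 0 0 c 0 :> 'M_(1 + n).
    by rewrite [in RHS]scalar_mx_block add_block_mx !addr0 add0r.
  by apply: (P1 (block_mx 0 0 c 0)); rewrite mulmx_block !(mul0mx, mulmx0, addr0) block_mx0.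
have Pdr (S : 'M[F]_n) : \det S = 1 -> P (block_mx 1%:M 0 0 S : 'M_(1 + n)).
  apply: (IHn (fun S => P (block_mx 1%:M 0 0 S : 'M_(1 + n)))) => [N NN|B C PB PC].
    have -> : block_mx 1%:M 0 0 (1%:M + N) = 1%:M + block_mx 0 0 0 N :> 'M_(1 + n).
      by rewrite [in RHS]scalar_mx_block add_block_mx !addr0.
    by apply: (P1 (block_mx 0 0 0 N)); rewrite mulmx_block !(mul0mx, mulmx0, addr0, add0r) NN block_mx0.
  have := PM _ _ PB PC.
  by rewrite mulmx_block !(mul0mx, mulmx0, addr0, add0r, mul1mx).
(* With pivot 1, elimination leaves the Schur complement, of determinant 1, to which the induction
   applies. *)
have P_1 (r : 'rV[F]_n) (c : 'cV[F]_n) (S : 'M[F]_n) (B := block_mx 1%:M r c S : 'M_(1 + n)) :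
    \det B = 1 -> P B.
  have -> : B = block_mx 1%:M 0 c 1%:M *m block_mx 1%:M 0 0 (S - c *m r) *m block_mx 1%:M r 0 1%:M.
    rewrite /B !mulmx_block !(mul0mx, mulmx0, addr0, add0r, mul1mx, mulmx1).
    by rewrite addrC subrK.
  rewrite !det_mulmx !det_ublock !det_lblock !det1 !mul1r mulr1 => dS.
  by apply: (PM _ _ _ (Pur r)); apply: (PM _ _ (Pdl c)); apply: Pdr.
have P_c (a : 'M[F]_1) r (c : 'cV[F]_n) S (B := block_mx a r c S : 'M_(1 + n)) :
    \det B = 1 -> c != 0 -> P B.
  move=> dB /matrix0Pn[i [j ci]]; rewrite ord1 in ci.
  (* Adding this multiple of a lower row to the first row turns the pivot into 1. *)
  pose r0 : 'rV[F]_n := ((1 - a 0 0) / c i 0) *: delta_mx 0 i.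
  have r0c : a + r0 *m c = 1%:M.
    apply/matrixP => x y; rewrite !ord1 !mxE (bigD1 i) //= big1 => [|l li].
      by rewrite !mxE !eqxx mulr1 addr0 mulfVK // addrC subrK.
    by rewrite !mxE (negPf li) mulr0 mul0r.
  have -> : B = block_mx 1%:M (- r0) 0 1%:M *m (block_mx 1%:M r0 0 1%:M *m B).
    rewrite mulmxA mulmx_block !(mul0mx, mulmx0, addr0, add0r, mul1mx, mulmx1).
    by rewrite subrr -scalar_mx_block mul1mx.
  apply: (PM _ _ (Pur _)).
  rewrite /B mulmx_block !(mul0mx, mulmx0, addr0, add0r, mul1mx, mulmx1) r0c.
  apply: P_1; have : \det (block_mx 1%:M r0 0 1%:M *m B) = 1.
    by rewrite det_mulmx dB det_ublock !det1 !mulr1.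
  by rewrite /B mulmx_block !(mul0mx, mulmx0, addr0, add0r, mul1mx, mulmx1) r0c.
rewrite -[A](submxK (m1 := 1) (n1 := 1)) in dA *.
set a := ulsubmx _ in dA *; set r := ursubmx _ in dA *; set c := dlsubmx _ in dA *.
set S := drsubmx _ in dA *.
have [c0|] := eqVneq c 0; last exact: P_c.
have a0 : a 0 0 != 0.
  move: dA; rewrite c0 det_ublock det_mx11 => dA.
  by apply: contraTneq isT => a0; move: dA; rewrite a0 mul0r => /eqP; rewrite eq_sym oner_eq0.
have [n0|n_gt0] := posnP n.
  have : a = 1%:M.
    move: dA; rewrite c0 det_ublock det_mx11 => dA.
    have S1 : \det S = 1 by clear -n0; move: S; rewrite n0 => S; rewrite det_mx00.
    by rewrite [a]mx11_scalar; move: dA; rewrite S1 mulr1 => ->.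
  by move=> a1; rewrite a1 in dA *; apply: P_1.
(* Here c = 0 and a is nonzero: adding the first row to all the others makes the lower left block
   nonzero. *)
pose c' : 'cV[F]_n := const_mx 1.
have -> : block_mx a r c S = block_mx 1%:M 0 (- c') 1%:M *m (block_mx 1%:M 0 c' 1%:M *m block_mx a r c S).
  rewrite mulmxA mulmx_block !(mul0mx, mulmx0, addr0, add0r, mul1mx, mulmx1).
  by rewrite addNr -scalar_mx_block mul1mx.
apply: (PM _ _ (Pdl _)).
have dB : \det (block_mx 1%:M 0 c' 1%:M *m block_mx a r c S) = 1.
  by rewrite det_mulmx dA det_lblock !det1 !mulr1.
rewrite mulmx_block !(mul0mx, mulmx0, addr0, add0r, mul1mx, mulmx1) in dB *.
apply: P_c => //; rewrite c0 addr0; apply/matrix0Pn.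
exists (Ordinal n_gt0), 0; rewrite mxE big_ord1 mxE mul1r; exact: a0.
Qed.

Section UnipotentPath.
Variables (R : realType) (V : vectType rat) (b : {symmetric V}) (U : {vspace V}).
Local Notation toR M := (map_mx (ratr : rat -> R) M).

(* exp(t log A) is a path from 1 to A. *)
Lemma unipotent_PR0 A : PU b U A ->
  (forall v, A (A (A v - v) - (A v - v)) - (A (A v - v) - (A v - v)) = 0) ->
  PR0 b U (real_mx R A).
Proof.
move=> [isoA AU] A3; pose N : 'End(V) := A - \1%VF.
have NE v : N v = A v - v by rewrite /N add_lfunE opp_lfunE id_lfunE.
have N3 v : N (N (N v)) = 0 by rewrite !NE A3.
have r x y : b (N x) y + b x (N y) + b (N x) (N y) = 0.
  rewrite !NE; have := isoA x y; move: (A x) (A y) => Ax Ay.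
  by rewrite !symfE => ->; ring.
(* X is log(1 + N), cut off after the square because N^3 = 0. *)
pose X : 'End(V) := N - 2^-1 *: (N \o N)%VF.
have XE v : X v = N v - 2^-1 *: N (N v).
  by rewrite /X add_lfunE opp_lfunE scale_lfunE (comp_lfunE N N).
have NX v : N (X v) = N (N v) by rewrite XE linearB linearZ /= N3 scaler0 subr0.
have XX v : X (X v) = N (N v) by rewrite XE !NX N3 scaler0 subr0.
have X3 v : X (X (X v)) = 0 by rewrite XX NX N3.
(* The relation [r] says that 1 + N is an isometry. Its instances with x and y replaced by images
   under N, combined linearly, express that the logarithm is skew. *)
have skew x y : b (X x) y = - b x (X y).
  rewrite !XE; have := r x y; have := r (N x) y; have := r x (N y).
  have := r (N x) (N y); have := r (N x) (N (N y)); have := r (N (N x)) (N y).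
  rewrite !N3 symf0l symf0r symfBl symfBr symfZl symfZr; clearbody N; lra.
have AX : A = \1%VF + X + 2^-1 *: (X \o X)%VF.
  apply/lfunP => v; rewrite 2!add_lfunE id_lfunE scale_lfunE (comp_lfunE X X) XX XE.
  by rewrite addrA subrK NE addrC subrK.
pose x := toR (mx X); pose g := real_gram b R.
have xg : x *m g = - (g *m x^T).
  rewrite /x /g real_gramE map_trmx -!map_mxM -map_mxN; congr (map_mx _ _).
  apply/eqP; rewrite -addr_eq0; apply/eqP.
  have := mx_gramE b X \1%VF; have := mx_gramE b \1%VF X.
  rewrite mx1 trmx1 mul1mx mulmx1 => -> ->; apply/matrixP => i j.
  by rewrite !mxE !id_lfunE skew addNr.
have x3 : x *m x *m x = 0.
  rewrite /x -!map_mxM -!mx_comp (_ : (X \o (X \o X))%VF = 0) ?linear0 ?map_mx0 //.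
  by apply/lfunP => v; rewrite (comp_lfunE X) (comp_lfunE X) X3 lfunE.
have xU : stablemx (real_space R U) x.
  apply/stable_realP; exists (toR (mx (retr U \o X \o Defs.incl U)%VF)).
  rewrite /x -!map_mxM -!mx_comp; congr (map_mx _ (mxof _ _ _)).
  apply/lfunP => u; rewrite (comp_lfunE X) (comp_lfunE (Defs.incl U)) !inclE.
  rewrite (comp_lfunE _ (Defs.incl U)) (comp_lfunE (retr U)) retrE inclE vsprojK //.
  have NU v : v \in U -> N v \in U by move=> vU; rewrite NE rpredB ?mem_img.
  by rewrite XE rpredB ?rpredZ ?NU ?subvsP.
(* The exponential of t x, exact since x^3 = 0; its inverse is F (- t), and skewness of x makes it
   orthogonal. *)
pose F (t : R) : 'M[R]_(\dim {:V}) := 1%:M + t *: x + (t * t / 2) *: (x *m x).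
have -> : real_mx R A = F 1.
  have mE : mx A = mx \1%VF + mx X + 2^-1 *: mx (X \o X)%VF.
    apply/matrixP => i l; rewrite !mxE /= [in LHS]AX 2!add_lfunE scale_lfunE.
    by rewrite !linearD linearZ.
  rewrite /F real_mxE mE mx_comp mx1 !map_mxD map_mx1 map_mxZ.
  by rewrite map_mxM scale1r !mul1r fmorphV rmorph_nat.
have FV t : F t *m F (- t) = 1%:M.
  rewrite /F mulrNN; set s := t * t / 2; set y := x *m x.
  have yx : y *m x = 0 by [].
  have xy : x *m y = 0 by rewrite /y mulmxA.
  have yy : y *m y = 0 by rewrite {1}/y -mulmxA xy mulmx0.
  have xx : x *m x = y by [].
  rewrite 2!mulmxDl !mulmxDr !mul1mx !mulmx1 -!scalemxAl -!scalemxAr.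
  rewrite xx xy yx yy !scaler0 !addr0; clearbody y.
  by apply/matrixP => i l; rewrite !mxE /s; field.
have Fg t : F t *m g = g *m (F (- t))^T.
  rewrite /F mulrNN scaleNr; set s := t * t / 2.
  have -> : (1%:M - t *: x + s *: (x *m x))^T = 1%:M - t *: x^T + s *: (x^T *m x^T).
    by rewrite -trmx_mul -[in RHS]trmx1; apply/matrixP => i l; rewrite !mxE.
  rewrite 2!mulmxDl 2!mulmxDr mul1mx mulmx1 mulmxN.
  rewrite -!scalemxAl -!scalemxAr xg scalerN; congr (_ + _ *: _).
  by rewrite -mulmxA xg mulmxN mulmxA xg mulNmx opprK mulmxA.
apply: (component1_path (F := F)).
- apply: continuous_addmx; last first.
    apply: continuous_scalemx; apply: continuous_mulr; last first.
      by move=> t; exact: cst_continuous.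
    by apply: continuous_mulr => t; exact: cvg_id.
  apply: continuous_addmx; first by move=> t; exact: cst_continuous.
  by apply: continuous_scalemx => t; exact: cvg_id.
- by rewrite /F mul0r mul0r !scale0r !addr0.
move=> t; split.
  by rewrite /OR /= Fg -mulmxA -trmx_mul FV trmx1 mulmx1.
rewrite /F !stablemxD ?stablemxC // -?mul_scalar_mx.
- by rewrite stablemxM ?stablemxC.
- by rewrite !stablemxM ?stablemxC.
Qed.

End UnipotentPath.

(** * The identity component in terms of the actions on U and W *)

Section ParabolicComponent.
Variables (R : realType) (V : vectType rat) (b : {symmetric V}) (U : {vspace V}).
Variables (W : vectType rat) (p : 'Hom(subvs_of (orthov b U), W)).
Hypotheses (b_nondeg : nondegenerate b) (Uiso : (U <= orthov b U)%VS).
Hypothesis Wq : is_quotient p.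

Local Notation Up := (orthov b U).
Local Notation sU := (subvs_of U).
Local Notation dU := (vdual (subvs_of U)).
Local Notation bW := (induced_form p : {symmetric W}).
Local Notation prD := (pairing b U).
Local Notation toR M := (map_mx (ratr : rat -> R) M).

(** A - 1 takes V to U^perp, U^perp to U and U to 0, so its cube vanishes. *)
Lemma act1_PR0 A : PU b U A -> act p A = (\1%VF, \1%VF) -> PR0 b U (real_mx R A).
Proof.
move=> PA [AM Ag]; apply: unipotent_PR0 => // v.
have AU u : u \in U -> A u = u.
  by move=> uU; rewrite -(vsprojK uU) -(act_UE _ PA) AM id_lfunE.
have AUp x : x \in Up -> A x - x \in U.
  move=> xU; rewrite -(quo_eq0 Wq); last by rewrite rpredB ?(PU_Up PA).
  by rewrite linearB /= -(act_WE Wq PA xU) Ag id_lfunE subrr.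
have Av : A v - v \in Up.
  apply/mem_orthovP => u uU; rewrite symfBl -{1}(AU u uU) PA.1 subrr //.
by rewrite (AU (A (A v - v) - (A v - v))) ?subrr ?AUp.
Qed.

Variables (j : 'Hom(vdual (subvs_of U), V)) (k : 'Hom(W, V)).
Hypothesis sp : splitting p j k.
Local Notation mkA := (mkA p j k).

Let as0 : antisym (0 : 'Hom(dU, sU)).
Proof. by move=> f f'; rewrite !zero_lfunE !linear0. Qed.

Let GL1 : GLU (\1%VF : 'End(sU)).
Proof. by apply/eqP/lker0P => u v; rewrite !id_lfunE. Qed.

Let iso1 : isometries bW \1%VF.
Proof. by move=> x y; rewrite !id_lfunE. Qed.

Lemma contragredient1 f : contragredient (\1%VF : 'End(sU)) f = f.
Proof.
by apply/lfunP => u; rewrite -[u in LHS]id_lfunE contragredientE.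
Qed.

Lemma adjoint0 f : adjoint p (0 : 'Hom(W, sU)) f = 0.
Proof.
apply: (nondeg_inj (induced_form_nondeg b_nondeg Wq)) => w.
by rewrite (adjointE b_nondeg Wq) zero_lfunE linear0 symf0l.
Qed.

Lemma mkA00E M g v : mkA M g 0 0 v =
  vsval (M (prU b j v)) + k (g (prW p j v)) + j (contragredient M (prD v)).
Proof.
by rewrite mkAE adjoint0 !zero_lfunE addr0 scaler0 !subr0 addr0.
Qed.

(** Extending an isometry of W_R by the identity on U and on the image of j is a continuous map
    O(W_R) -> P_U(R) sending 1 to 1. In matrices it is X -> Q X K + C, where C is the projection
    onto the part that is fixed. *)
Lemma mkA_gamma_PR0 g : SOR bW (real_mx R g) -> isometries bW g ->
  PR0 b U (real_mx R (mkA \1%VF g 0 0)).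
Proof.
move=> Sg g_iso.
pose c : 'End(V) := ((Defs.incl U \o prU b j) + (j \o prD))%VF.
have cE v : c v = vsval (prU b j v) + j (prD v).
  by rewrite /c add_lfunE (comp_lfunE (Defs.incl U)) inclE (comp_lfunE j).
pose Q := toR (mx (prW p j)); pose K := toR (mx k); pose C := toR (mx c).
pose F (X : 'M[R]_(\dim {:W})) := Q *m X *m K + C.
have FE h : real_mx R (mkA \1%VF h 0 0) = F (real_mx R h).
  have hE : mkA \1%VF h 0 0 = (k \o (h \o prW p j) + c)%VF.
    apply/lfunP => v; rewrite mkA00E contragredient1 id_lfunE add_lfunE cE.
    by rewrite (comp_lfunE k) (comp_lfunE h) addrAC addrC addrA addrAC.
  have mE : mx (mkA \1%VF h 0 0) = mx (k \o (h \o prW p j))%VF + mx c.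
    by apply/matrixP => i l; rewrite !mxE /= [in LHS]hE add_lfunE linearD.
  by rewrite !real_mxE mE (mx_comp (h \o _)%VF) (mx_comp (prW p j)) map_mxD !map_mxM.
have F1 : F 1%:M = 1%:M.
  rewrite -real_mx1 -FE -[RHS]real_mx1; congr real_mx; apply/lfunP => v.
  rewrite mkA00E contragredient1 !id_lfunE -(decomp Wq sp) //.
have KK : K *m real_gram b R *m K^T = real_gram bW R.
  rewrite /K !real_gramE map_trmx -!map_mxM mx_gramE; congr (map_mx _ _).
  apply/matrixP => i l; rewrite !mxE; case: sp => _ _ kU _.
  by rewrite -(form_quo Wq) ?(kU _).1 // !(kU _).2.
have KC : K *m real_gram b R *m C^T = 0.
  rewrite /K /C real_gramE map_trmx -!map_mxM mx_form0 ?map_mx0 // => w v.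
  case: sp => _ _ kU kj; rewrite cE symfDr kj symfC (formUUp _ (kU _).1) addr0 //.
have CK : C *m real_gram b R *m K^T = 0.
  apply: trmx_inj; rewrite trmx0 !trmx_mul trmxK !real_gramE map_trmx gram_sym.
  by rewrite -real_gramE mulmxA.
have FG X : F X *m real_gram b R *m (F X)^T =
    Q *m (X *m real_gram bW R *m X^T) *m Q^T + C *m real_gram b R *m C^T.
  rewrite /F linearD /= !trmx_mul !mulmxDl !mulmxDr -!mulmxA.
  rewrite (mulmxA K) (mulmxA (K *m _)) KK.
  rewrite (mulmxA C (real_gram b R)) (mulmxA (C *m _) K^T) CK mul0mx add0r.
  by rewrite (mulmxA K (real_gram b R) C^T) KC !mulmx0 addr0.
have IF X : toR (mx (Defs.incl U)) *m F X = toR (mx (Defs.incl U)).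
  rewrite /F mulmxDr !mulmxA -!map_mxM -!mx_comp.
  rewrite (_ : (prW p j \o _)%VF = 0); last first.
    by apply/lfunP => u; rewrite comp_lfunE inclE (prW_U Uiso Wq j) lfunE.
  rewrite linear0 map_mx0 !mul0mx add0r; congr (map_mx _ (mxof _ _ _)).
  apply/lfunP => u; rewrite (comp_lfunE c) inclE cE (prU_U sp) (prD_U Uiso).
  by rewrite linear0 addr0.
have OF X : OR bW X -> PR b U (F X).
  move=> OX; split; last by apply/stable_realP; exists 1%:M; rewrite IF mul1mx.
  (* At X = 1, where F is 1, the formula decomposes the Gram matrix of V into the same two
     summands. *)
  have := FG 1%:M; rewrite F1 !(mul1mx, trmx1, mulmx1) => e1.
  by rewrite /OR /= FG OX -e1.
rewrite FE /PR0 -[X in connected_component _ X]F1.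
apply: (@component_image _ _ (@OR W bW R)) => //; last exact: OR1.
apply: continuous_addmx; last by move=> t; exact: cst_continuous.
apply: continuous_mulmx; last by move=> t; exact: cst_continuous.
apply: continuous_mulmx; first by move=> t; exact: cst_continuous.
by move=> t; exact: cvg_id.
Qed.

Lemma contragredient_comp (M M' : 'End(sU)) f : GLU M -> GLU M' ->
  contragredient (M \o M')%VF f = contragredient M (contragredient M' f).
Proof.
move=> M0 M'0; have MM0 : GLU (M \o M')%VF.
  apply/eqP/lker0P => u v; rewrite !comp_lfunE => /(lker0P _).
  by rewrite M0 => /(_ (eqxx _))/(lker0P _); rewrite M'0 => /(_ (eqxx _)).
apply/lfunP => u; have MM0' : lker (M \o M')%VF == 0%VS by rewrite MM0.
rewrite -[u](lker0_lfunVK MM0') contragredientE //.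
by rewrite (comp_lfunE M M') !contragredientE.
Qed.

(** For M = 1 + N with N^2 = 0, the element minus 1 is N on U, 0 on W and minus the dual of N on the
    image of j; its square is 0, so it is joined to 1 by its one-parameter group. Products give the
    rest of SL(U). *)
Lemma mkA_M_PR0 M : det_lfun M = 1 -> PR0 b U (real_mx R (mkA M \1%VF 0 0)).
Proof.
(* Invertibility is carried along because [contragredient_comp] asks for it. *)
pose P (m : 'M[rat]_(\dim {:sU})) :=
  let M := hommx (vbasis {:sU}) (vbasis {:sU}) m in
  GLU M /\ PR0 b U (real_mx R (mkA M \1%VF 0 0)).
move=> dM; suff [_] : P (mx M) by rewrite mxofK ?vbasisP.
apply: SL_unipotent_ind dM => [m mm|m m' [GLm Pm] [GLm' Pm']]; last first.
  rewrite /P /=; rewrite (hommx_mul (vbasisP _) (vbasisP _) (vbasisP _)).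
  set N := hommx _ _ m in GLm Pm *; set N' := hommx _ _ m' in GLm' Pm' *.
  have GLNN : GLU (N' \o N)%VF.
    apply/eqP/lker0P => u v; rewrite !comp_lfunE => /(lker0P _).
    by rewrite GLm' => /(_ (eqxx _))/(lker0P _); rewrite GLm => /(_ (eqxx _)).
  split=> //; have -> : mkA (N' \o N)%VF \1%VF 0 0 = (mkA N' \1%VF 0 0 \o mkA N \1%VF 0 0)%VF.
    apply/lfunP => v; rewrite (comp_lfunE (mkA N' _ _ _)) !mkA00E.
    rewrite (prU_coord sp) (prW_coord Uiso Wq sp) (prD_coord Uiso sp) (comp_lfunE N' N).
    by rewrite contragredient_comp // !id_lfunE.
  exact: PR0_comp.
set N := hommx (vbasis {:sU}) (vbasis {:sU}) m.
have NN u : N (N u) = 0.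
  rewrite -(comp_lfunE N N) -(hommx_mul (vbasisP _) (vbasisP _) (vbasisP _)) mm.
  by rewrite linear0 lfunE.
have -> : P (1%:M + m) = (GLU (\1 + N)%VF /\ PR0 b U (real_mx R (mkA (\1 + N)%VF \1%VF 0 0))).
  by rewrite /P /= linearD /= hommx1 ?vbasisP.
have GLN : GLU (\1 + N)%VF.
  apply/eqP/lker0P => u v; rewrite !add_lfunE !id_lfunE => e.
  have : N (u + N u) = N (v + N v) by rewrite e.
  by rewrite !linearD /= !NN !addr0 => Nuv; move: e; rewrite Nuv => /addIr.
split=> //; apply: unipotent_PR0; first exact: mkA_PU.
have cE f : contragredient (\1 + N)%VF f = f - dual_map N f.
  have GLN' : lker (\1 + N)%VF == 0%VS by rewrite GLN.
  apply/lfunP => u; rewrite -[u](lker0_lfunVK GLN') contragredientE //.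
  have dE w : (f - dual_map N f : dU) w = f w - f (N w).
    by rewrite add_lfunE opp_lfunE dual_mapE.
  set v := (_^-1)%VF u; rewrite dE add_lfunE id_lfunE.
  by rewrite !linearD /= NN linear0 addr0 addrK.
pose A := mkA (\1 + N)%VF \1%VF 0 0; rewrite -/A.
have AE v : A v - v = vsval (N (prU b j v)) + k 0 + j (- dual_map N (prD v)).
  rewrite /A mkA00E [X in _ - X](decomp Wq sp v) add_lfunE !id_lfunE cE linearB linear0 linearN.
  rewrite -[vsval (_ + _)]/(vsval _ + vsval _) addr0 2!opprD.
  by rewrite !addrA [LHS](ACl (1*6*3*7*4*8*2*5)) /= subrr add0r subrr add0r subrr add0r.
move=> v; rewrite AE AE (prU_coord sp) (prD_coord Uiso sp) NN AE.
have DD f : dual_map N (dual_map N f) = 0.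
  by apply/lfunP => u; rewrite !dual_mapE NN linear0 lfunE.
by rewrite (prD_coord Uiso sp) [dual_map N (- _)]linearN /= DD !oppr0 !linear0 !addr0.
Qed.

(** The action on W is the compression X -> K X Q, which is continuous. That it lands in O(W_R) must
    be shown for all real X in P_U(R), out of reach of the rational maps, hence by matrix
    identities. *)
Lemma PR0_act_W A : PU b U A -> PR0 b U (real_mx R A) ->
  SOR bW (real_mx R (act_W p A)).
Proof.
move=> PA PA0.
pose Q := toR (mx (prW p j)); pose K := toR (mx k).
pose Iu := toR (mx (Defs.incl U)); pose P := toR (mx (prU b j)).
pose G := real_gram b R.
have QK : K *m Q = 1%:M.
  rewrite -map_mxM -mx_comp (_ : (_ \o _)%VF = \1%VF) ?mx1 ?map_mx1 //.
  by apply/lfunP => w; rewrite comp_lfunE (prW_W sp) id_lfunE.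
have -> : real_mx R (act_W p A) = K *m real_mx R A *m Q.
  rewrite -!map_mxM -!mx_comp; congr (map_mx _ (mxof _ _ _)).
  apply: act_W_unique => // x xU; rewrite (comp_lfunE (prW p j)) (comp_lfunE A k).
  case: sp => _ _ kU _; rewrite (prW_Up p j) ?(PU_Up PA) ?(kU _).1 //.
  by rewrite -!(act_WE Wq PA) ?(kU _).1 // (kU _).2.
have KK : K *m G *m K^T = real_gram bW R.
  rewrite /K /G !real_gramE map_trmx -!map_mxM mx_gramE; congr (map_mx _ _).
  apply/matrixP => i l; rewrite !mxE; case: sp => _ _ kU _.
  by rewrite -(form_quo Wq) ?(kU _).1 // !(kU _).2.
have II : Iu *m G *m Iu^T = 0.
  rewrite /Iu /G real_gramE map_trmx -!map_mxM mx_form0 ?map_mx0 // => u u'.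
  by rewrite !inclE formUU.
have KI : K *m G *m Iu^T = 0.
  rewrite /K /Iu /G real_gramE map_trmx -!map_mxM mx_form0 ?map_mx0 // => w u.
  by case: sp => _ _ kU _; rewrite inclE symfC (formUUp _ (kU _).1).
have GT : G^T = G by rewrite /G real_gramE map_trmx gram_sym.
(* j o prD in coordinates: v |-> sum_l b(v, u_l) j(u_l dual). *)
have [T dec] : exists T, 1%:M = P *m Iu + Q *m K + G *m Iu^T *m T.
  pose jd : 'Hom(sU, V) := linfun (fun u : sU => \sum_(l < \dim {:sU})
    coord (vbasis {:sU}) l u *: j (linfun (coord (vbasis {:sU}) l : sU -> rat^o))).
  have jdE u : jd u = \sum_(l < \dim {:sU})
      coord (vbasis {:sU}) l u *: j (linfun (coord (vbasis {:sU}) l : sU -> rat^o)).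
    rewrite /jd linfunE // => a x y; rewrite scaler_sumr -big_split.
    by apply: eq_bigr => l _; rewrite linearP /= scalerDl scalerA.
  pose d : 'Hom(V, sU) := linfun (fun v => \sum_(l < \dim {:sU})
    b v (vsval (vbasis {:sU})`_l) *: (vbasis {:sU})`_l).
  have dE v : d v = \sum_(l < \dim {:sU})
      b v (vsval (vbasis {:sU})`_l) *: (vbasis {:sU})`_l.
    rewrite /d linfunE // => a x y; rewrite scaler_sumr -big_split.
    by apply: eq_bigr => l _; rewrite /= symfDl symfZl scalerDl scalerA.
  have md : mx d = gram b *m (mx (Defs.incl U))^T.
    rewrite -[gram b]mul1mx -mx1 mx_gramE; apply/matrixP => i l.
    rewrite !mxE /= vecof_delta dE coord_sum_free ?(basis_free (vbasisP _)) //.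
    by rewrite id_lfunE inclE.
  exists (toR (mx jd)); rewrite /P /Iu /Q /K /G real_gramE map_trmx -!map_mxM -md.
  rewrite -!mx_comp -!map_mxD -(map_mx1 (ratr : {rmorphism rat -> R})) -mx1.
  congr (map_mx _ _); apply/matrixP => i l; rewrite !mxE /= -!linearD /=.
  congr (coord _ _ _); set v := vecof _ _; rewrite id_lfunE (comp_lfunE (Defs.incl U)).
  rewrite inclE (comp_lfunE k) (comp_lfunE jd).
  rewrite {1}(decomp Wq sp v); congr (_ + _).
  rewrite dE jdE.
  have {1}-> : prD v = \sum_(l < \dim {:sU}) b v (vsval (vbasis {:sU})`_l) *:
      (linfun (coord (vbasis {:sU}) l : sU -> rat^o) : dU).
    apply/lfunP => u; rewrite pairingE sum_lfunE {1}(coord_vbasis (memvf u)) linear_sum.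
    rewrite symfC symf_suml; apply: eq_bigr => m _.
    by rewrite linearZ /= symfZl scale_lfunE lfunE symfC [RHS]mulrC.
  rewrite linear_sum; apply: eq_bigr => m _; rewrite linearZ /=.
  by rewrite coord_sum_free ?(basis_free (vbasisP _)).
have f1 : K *m 1%:M *m Q = 1%:M by rewrite mulmx1.
rewrite /SOR -[X in connected_component _ X]f1.
apply: (@component_image _ _ (@PR V b R U) (@OR W bW R) (fun X => K *m X *m Q)) => //.
- apply: continuous_mulmx; last by move=> t; exact: cst_continuous.
  apply: continuous_mulmx; first by move=> t; exact: cst_continuous.
  by move=> t; exact: cvg_id.
- move=> X [OX /stable_realP[E IE]]; rewrite -/Iu in IE.
  (* X keeps W_R orthogonal to U_R: the orthogonality holds after applying X to U_R as well, and the
     action E of X on U_R can be cancelled. *)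
  have XI : K *m X *m G *m Iu^T = 0.
    have E_unit := stable_unit b_nondeg OX IE.
    rewrite -unitmx_tr in E_unit; apply: (can_inj (mulmxK E_unit)).
    rewrite mul0mx -!mulmxA -trmx_mul -IE trmx_mul !mulmxA -(mulmxA K X) -(mulmxA K).
    by rewrite OX.
  (* By [XI], the image of W_R has no component along j. Its U-component is orthogonal to U and to
     this image, so dropping it does not change the form. *)
  have KX : K *m X = K *m X *m P *m Iu + K *m X *m Q *m K.
    rewrite -[LHS]mulmx1 dec !mulmxDr !mulmxA XI mul0mx addr0 //.
  set D := K *m X *m Q in KX *; set E' := K *m X *m P in KX.
  rewrite /OR /= -KK.
  have -> : D *m (K *m G *m K^T) *m D^T = (K *m X - E' *m Iu) *m G *m (K *m X - E' *m Iu)^T.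
    have -> : K *m X - E' *m Iu = D *m K by rewrite [in LHS]KX addrAC subrr add0r.
    by rewrite (trmx_mul D K) !mulmxA.
  have IX : Iu *m G *m (K *m X)^T = 0.
    by apply: trmx_inj; rewrite trmx0 (trmx_mul _ (_ ^T)) trmxK (trmx_mul Iu) GT mulmxA.
  have -> : (K *m X - E' *m Iu)^T = (K *m X)^T - Iu^T *m E'^T.
    by rewrite -trmx_mul; apply/matrixP => i l; rewrite !mxE.
  rewrite !mulmxBl mulmxBr !mulmxA XI mul0mx subr0.
  have -> : E' *m Iu *m G *m ((K *m X)^T - Iu^T *m E'^T) = 0.
    rewrite mulmxBr !mulmxA -(mulmxA E' Iu G) -(mulmxA E' (Iu *m G) (_ ^T)) IX.
    by rewrite -(mulmxA E' (Iu *m G) (Iu^T)) II !mulmx0 mul0mx subr0.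
  rewrite subr0 (trmx_mul K X) !mulmxA -(mulmxA K X) -(mulmxA K (X *m G)).
  by rewrite OX.
- exact: PR1.
Qed.

(** The block diagonal element B with the same actions on U and W lies in the component by the
    preceding lemmas, and A B^{-1} acts trivially on U and W, so it is unipotent. *)
Lemma mkA_PR0 A : PU b U A -> det_lfun (act_U U A) = 1 ->
  SOR bW (real_mx R (act_W p A)) -> PR0 b U (real_mx R A).
Proof.
move=> PA dA SA; set M := act_U U A in dA; set g := act_W p A in SA.
have M_GL : GLU M := act_U_GLU b_nondeg PA.
have g_iso : isometries bW g := act_W_isom Wq PA.
pose B := (mkA M \1%VF 0 0 \o mkA \1%VF g 0 0)%VF.
have PM := mkA_PU b_nondeg Uiso Wq sp 0 M_GL iso1 as0.
have Pg := mkA_PU b_nondeg Uiso Wq sp 0 GL1 g_iso as0.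
have PB : PU b U B := PU_comp PM Pg.
have B0 : PR0 b U (real_mx R B) by apply: PR0_comp; [apply: mkA_M_PR0 | apply: mkA_gamma_PR0].
have -> : A = ((A \o B^-1) \o B)%VF by rewrite lker0_compfVK // (PU_lker0 b_nondeg PB).
apply: PR0_comp => //; apply: act1_PR0; first exact/(PU_comp PA)/PU_inv.
have actB : act p B = (M, g).
  rewrite (act_comp Wq PM Pg).
  have [-> ->] := act_mkA b_nondeg Uiso Wq sp 0 M_GL iso1 as0.
  have [-> ->] := act_mkA b_nondeg Uiso Wq sp 0 GL1 g_iso as0.
  by rewrite comp_lfun1l comp_lfun1r.
have PC : PU b U (A \o B^-1)%VF := PU_comp PA (PU_inv b_nondeg PB).
have : act p ((A \o B^-1) \o B)%VF = act p B.
  rewrite lker0_compfVK ?(PU_lker0 b_nondeg PB) //.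
rewrite (act_comp Wq PC PB) => -[CM Cg]; move: actB => [BM Bg].
rewrite BM in CM; rewrite Bg in Cg; rewrite /act; congr (_, _).
  by rewrite -[LHS](lker0_compfK (f := M)) ?CM ?lker0_compfV // M_GL.
have g0 := isometry_lker0 (induced_form_nondeg b_nondeg Wq) g_iso.
by rewrite -[LHS](lker0_compfK (f := g)) ?Cg ?lker0_compfV.
Qed.

End ParabolicComponent.

(** * The arithmetic groups *)

Section Groups.

Lemma lfun_group_is_group (X : vectType rat) (S : set 'End(X)) :
  S \1%VF -> (forall f g, S f -> S g -> S (f \o g)%VF) ->
  (forall f, S f -> lker f == 0%VS /\ S (f^-1)%VF) -> is_group (lfun_group S).
Proof.
move=> S1 SM SV; split=> //=.
- by move=> f g h _ _ _; rewrite comp_lfunA.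
- by move=> f _; rewrite comp_lfun1l.
- move=> f Sf; have [f0 SfV] := SV f Sf; exists (f^-1)%VF; split=> //.
    exact: lker0_compVf.
  exact: lker0_compfV.
Qed.

Lemma prod_group_is_group S T (G : setGroup S) (H : setGroup T) :
  is_group G -> is_group H -> is_group (prod_group G H).
Proof.
move=> [G1 GM GA Gl GV] [H1 HM HA Hl HV]; split=> /=.
- by [].
- by move=> x y [Gx Hx] [Gy Hy]; split; [apply: GM | apply: HM].
- by move=> x y z [Gx Hx] [Gy Hy] [Gz Hz]; rewrite /= GA // HA.
- by move=> [x y] [Gx Hy]; rewrite /= Gl // Hl.
move=> [x y] [/= /GV[x' [Gx' xl xr]] /HV[y' [Hy' yl yr]]].
by exists (x', y'); split=> /=; rewrite ?xl ?xr ?yl ?yr.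
Qed.

Lemma SLlat_lker0 (X : vectType rat) (I : set X) M : SLlat I M -> lker M == 0%VS.
Proof. by move=> [_ dM]; apply: det_lfun_lker0; rewrite dM oner_eq0. Qed.

Lemma SLlat_inv_mem (X : vectType rat) (I : set X) M u :
  SLlat I M -> I u -> I ((M^-1)%VF u).
Proof.
move=> MI; have M0 := SLlat_lker0 MI; case: MI => {1}<- _ [v Iv <-].
by rewrite lker0_lfunK.
Qed.

Lemma SLlat_mem (X : vectType rat) (I : set X) M u : SLlat I M -> I u -> I (M u).
Proof. by move=> [MI _] Iu; rewrite -MI; exists u. Qed.

Lemma SLpair1 (X : vectType rat) (J I : set X) : I 0 -> SLpair J I \1%VF.
Proof.
move=> I0; split; last by move=> u _; rewrite id_lfunE subrr.
split; last exact: det_lfun1.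
by apply/seteqP; split=> [_ [u Iu <-]|u Iu]; [|exists u]; rewrite ?id_lfunE.
Qed.

Lemma SLpair_comp (X : vectType rat) (J I : set X) M N : zsubgroup I ->
  SLpair J I M -> SLpair J I N -> SLpair J I (M \o N)%VF.
Proof.
move=> sI [MI MJ] [NI NJ]; split.
  split; last by rewrite det_lfun_comp MI.2 NI.2 mulr1.
  apply/seteqP; split=> [_ [u Iu <-]|u Iu].
    by rewrite comp_lfunE; apply: (SLlat_mem MI); apply: (SLlat_mem NI).
  exists ((N^-1)%VF ((M^-1)%VF u)).
    by apply: (SLlat_inv_mem NI); apply: (SLlat_inv_mem MI).
  by rewrite comp_lfunE !lker0_lfunVK ?(SLlat_lker0 MI) ?(SLlat_lker0 NI).
move=> u Ju; have -> : u - (M \o N)%VF u = (u - M u) + M (u - N u).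
  by rewrite comp_lfunE linearB /= addrA subrK.
by apply: zsubgroupD; [|apply: MJ|apply: (SLlat_mem MI); apply: NJ].
Qed.

Lemma SLpair_inv (X : vectType rat) (J I : set X) M : zsubgroup I ->
  SLpair J I M -> SLpair J I (M^-1)%VF.
Proof.
move=> sI [MI MJ]; have M0 := SLlat_lker0 MI; split.
  split.
    apply/seteqP; split=> [_ [u Iu <-]|u Iu]; first exact: (SLlat_inv_mem MI).
    by exists (M u); [apply: (SLlat_mem MI) | rewrite lker0_lfunK].
  have := det_lfun_comp M (M^-1)%VF.
  by rewrite lker0_compfV // det_lfun1 MI.2 mul1r => <-.
move=> u Ju; have -> : u - (M^-1)%VF u = - (M^-1)%VF (u - M u).
  by rewrite linearB /= lker0_lfunK // opprB.
by apply: zsubgroupN => //; apply: (SLlat_inv_mem MI); apply: MJ.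
Qed.

Lemma SLpair_is_group (X : vectType rat) (J I : set X) : zsubgroup I ->
  is_group (lfun_group (SLpair J I)).
Proof.
move=> sI; apply: lfun_group_is_group.
- by apply: SLpair1; case: sI.
- by move=> M N; apply: SLpair_comp.
- by move=> M MI; split; [apply: SLlat_lker0 MI.1 | apply: SLpair_inv].
Qed.

Variables (R : realType) (V : vectType rat) (b : {symmetric V}).
Hypothesis b_nondeg : nondegenerate b.
Variable L : set V.
Hypothesis sL : zsubgroup L.

Lemma Gamma1 : Gamma b R L \1%VF.
Proof.
split; first by move=> x y; rewrite !id_lfunE.
- by apply/seteqP; split=> [_ [u Iu <-]|u Iu]; [|exists u]; rewrite ?id_lfunE.
- exact: SOR1.
- by move=> v _; rewrite id_lfunE subrr; case: sL.
Qed.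

Lemma Gamma_comp A B : Gamma b R L A -> Gamma b R L B -> Gamma b R L (A \o B)%VF.
Proof.
move=> [isoA AL SA Ad] [isoB BL SB Bd]; split.
- by move=> x y; rewrite !comp_lfunE isoA.
- apply/seteqP; split=> [_ [u Lu <-]|u].
    by rewrite comp_lfunE -AL; exists (B u); rewrite // -BL; exists u.
  rewrite -{1}AL => -[w Bw <-]; move: Bw; rewrite -{1}BL => -[v Lv <-].
  by exists v; rewrite ?comp_lfunE.
- exact: (SOR_comp SA SB).
move=> v Lv; have -> : (A \o B)%VF v - v = A (B v - v) + (A v - v).
  by rewrite comp_lfunE linearB /= addrA subrK.
by apply: zsubgroupD; [|rewrite -AL; exists (B v - v)|]; rewrite //; [apply: Bd | apply: Ad].
Qed.

Lemma Gamma_inv_mem A v : Gamma b R L A -> L v -> L ((A^-1)%VF v).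
Proof.
move=> [isoA AL _ _]; rewrite -{1}AL => -[x Lx <-].
by rewrite lker0_lfunK // (isometry_lker0 b_nondeg).
Qed.

Lemma Gamma_inv A : Gamma b R L A -> Gamma b R L (A^-1)%VF.
Proof.
move=> GA; have [isoA AL SA Ad] := GA; have A0 := isometry_lker0 b_nondeg isoA.
split; [exact: isometryV | | exact: SOR_inv |].
  apply/seteqP; split=> [_ [u Iu <-]|u Iu]; first exact: Gamma_inv_mem.
  by exists (A u); [rewrite -AL; exists u | rewrite lker0_lfunK].
move=> v Lv; have -> : (A^-1)%VF v - v = - (A^-1)%VF (A v - v).
  by rewrite linearB /= lker0_lfunK // opprB.
by apply: zsubgroupN => //; apply: Gamma_inv_mem => //; apply: Ad.
Qed.

Lemma Gamma_is_group : is_group (lfun_group (Gamma b R L)).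
Proof.
apply: lfun_group_is_group; [exact: Gamma1 | exact: Gamma_comp |].
move=> A GA; split; last exact: Gamma_inv.
by case: GA => isoA _ _ _; apply: (isometry_lker0 b_nondeg).
Qed.

End Groups.

(** * The image of the stabilizer in GL(U) x O(W) *)

Section ParabolicLattice.
Variables (R : realType) (V : vectType rat) (b : {symmetric V}) (U : {vspace V}).
Variables (W : vectType rat) (p : 'Hom(subvs_of (orthov b U), W)).
Hypotheses (b_nondeg : nondegenerate b) (Uiso : (U <= orthov b U)%VS).
Hypothesis Wq : is_quotient p.
Variable L : set V.
Hypothesis L_even : even_lattice b L.

Local Notation Up := (orthov b U).
Local Notation sU := (subvs_of U).
Local Notation dU := (vdual (subvs_of U)).
Local Notation bW := (induced_form p : {symmetric W}).
Local Notation quo := (quo p).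
Local Notation Ld := (dual_lattice b L).
Local Notation I := (lat_I L : set sU).
Local Notation La := (Lambda p L).
Local Notation Id := (lat_Idual b L : set sU).
Local Notation GLI := (GammaLI b U L R).
Local Notation GLa := (GammaLambda p L R).

Let latL : is_lattice L. Proof. exact: even_lattice_is_lattice L_even. Qed.
Let sL : zsubgroup L. Proof. by case: latL. Qed.
Let sI : zsubgroup I. Proof. by case: (lat_I_lattice U L_even). Qed.
Let bW_nondeg : nondegenerate bW. Proof. exact: induced_form_nondeg. Qed.
Let sLa : zsubgroup La. Proof. by case: (Lambda_lattice Wq L_even). Qed.

Lemma act_agree A B : PU b U A -> PU b U B -> (forall x, x \in Up -> A x = B x) ->
  act p A = act p B.
Proof.
move=> PA PB AB; rewrite /act; congr (_, _).
  by apply: (act_U_unique PA) => u; rewrite (act_UE _ PB) AB // memUp.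
by apply: (act_W_unique Wq PA) => x xU; rewrite (act_WE Wq PB) // AB.
Qed.

Lemma GammaLI_img A : GLI A -> [set act_U U A u | u in I] = I.
Proof.
move=> [PA _ GA]; have [_ AL _ _] := GA; have A0 := PU_lker0 b_nondeg PA.
apply/seteqP; split=> [_ [u Iu <-]|u Iu].
  by rewrite /lat_I /= (act_UE _ PA) -AL; exists (vsval u).
have PAV := PU_inv b_nondeg PA; exists (act_U U (A^-1)%VF u).
  by rewrite /lat_I /= (act_UE _ PAV); apply: Gamma_inv_mem GA _.
by apply: subvs_inj; rewrite (act_UE _ PA) (act_UE _ PAV) lker0_lfunVK.
Qed.

(** Preservation of I makes the determinant 1 or -1; the identity component excludes -1. *)
Lemma GammaLI_act_U A : GLI A -> SLpair Id I (act_U U A).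
Proof.
move=> GA; have AI := GammaLI_img GA; have [PA A0 [_ _ _ Ad]] := GA.
split; first split=> //.
  apply: (lattice_det1 (lat_I_lattice U L_even) AI).
  exact: PR0_det b_nondeg PA A0.
move=> u Ju; have : L (- (A (vsval u) - vsval u)) by apply/(zsubgroupN sL)/Ad.
by rewrite opprB -(act_UE _ PA).
Qed.

Lemma GammaLI_act_W_img A : GLI A -> [set act_W p A w | w in La] = La.
Proof.
move=> [PA _ GA]; have [_ AL _ _] := GA; have A0 := PU_lker0 b_nondeg PA.
apply/seteqP; split=> [_ [_ /LambdaP[x [xU Lx <-]] <-]|_ /LambdaP[x [xU Lx <-]]].
  rewrite (act_WE Wq PA xU); apply: mem_Lambda; first exact: PU_Up.
  by rewrite -AL; exists x.
have xU' : (A^-1)%VF x \in Up by apply: PU_Up (PU_inv b_nondeg PA) xU.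
exists (quo ((A^-1)%VF x)); first by apply: mem_Lambda => //; apply: Gamma_inv_mem GA _.
by rewrite (act_WE Wq PA) // lker0_lfunVK.
Qed.

Lemma exists_sigma_splitting :
  exists sigma j k, [/\ dual_section b L sigma, splitting p j k &
                        forall f, j f - sigma f \in U].
Proof.
have [sigma sig] := exists_dual_section U b_nondeg L_even.
have [j [k [sp jsig]]] := exists_splitting Uiso Wq sig.
by exists sigma, j, k.
Qed.

(** Triviality on Lambda^*/Lambda is tested on lifts to L^* and U^perp. *)
Lemma GammaLI_act_W A : GLI A -> GLa (act_W p A).
Proof.
move=> GA; have [PA A0 [_ _ _ Ad]] := GA; split.
- exact: act_W_isom.
- exact: GammaLI_act_W_img.
- have [sigma [j [k [_ sp _]]]] := exists_sigma_splitting.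
  exact: (PR0_act_W b_nondeg Uiso Wq sp PA A0).
move=> w /(Lambda_dual_lift b_nondeg Uiso Wq L_even)[x [xU Lx <-]].
rewrite (act_WE Wq PA xU) -linearB; apply: mem_Lambda; last exact: Ad.
by rewrite rpredB ?(PU_Up PA).
Qed.

Lemma GammaLI_intro A : PU b U A -> det_lfun (act_U U A) = 1 ->
  SOR bW (real_mx R (act_W p A)) -> (forall v, Ld v -> L (A v - v)) -> GLI A.
Proof.
move=> PA dA SA Ad; have [sigma [j [k [_ sp _]]]] := exists_sigma_splitting.
have A0 := mkA_PR0 b_nondeg Uiso Wq sp PA dA SA.
split=> //; split=> //; first by case: PA.
- by apply: isometry_lattice_img (even_lattice_dual L_even) _ Ad => //; case: PA.
- exact: PR0_SOR A0.
Qed.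

Lemma GammaLI1 : GLI \1%VF.
Proof. by split; [apply: PU1 | apply: PR01 | apply: Gamma1]. Qed.

Lemma GammaLI_comp A B : GLI A -> GLI B -> GLI (A \o B)%VF.
Proof.
by move=> [PA A0 GA] [PB B0 GB]; split; [apply: PU_comp|apply: PR0_comp|apply: Gamma_comp].
Qed.

Lemma GammaLI_inv A : GLI A -> GLI (A^-1)%VF.
Proof.
by move=> [PA A0 GA]; split; [apply: PU_inv|apply: PR0_inv|apply: Gamma_inv].
Qed.

Lemma act_inv A : PU b U A ->
  act p (A^-1)%VF = ((act_U U A)^-1%VF, (act_W p A)^-1%VF).
Proof.
move=> PA; have A0 := PU_lker0 b_nondeg PA; have PAV := PU_inv b_nondeg PA.
have := act_comp Wq PA PAV; rewrite lker0_compfV // act1 // => -[AU AW].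
have U0 : lker (act_U U A) == 0%VS by rewrite (act_U_GLU b_nondeg PA).
have W0 := isometry_lker0 bW_nondeg (act_W_isom Wq PA).
rewrite /act; congr (_, _).
  by rewrite -[LHS](lker0_compKf U0) -AU comp_lfun1r.
by rewrite -[LHS](lker0_compKf W0) -AW comp_lfun1r.
Qed.

Lemma SL_Gamma_is_group J : is_group (SL_Gamma p L J R).
Proof.
apply: prod_group_is_group; first exact: SLpair_is_group.
exact: Gamma_is_group.
Qed.

Section Existence.
Variables (sigma j : 'Hom(vdual (subvs_of U), V)) (k : 'Hom(W, V)).
Hypotheses (sig : dual_section b L sigma) (sp : splitting p j k).
Hypothesis jsig : forall f, j f - sigma f \in U.
Local Notation mkA := (mkA p j k).

Lemma mkA_Up M g (psi : 'Hom(W, sU)) eta x : x \in Up ->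
  mkA M g psi eta x = vsval (M (prU b j x) - psi (g (quo x))) + k (g (quo x)).
Proof.
move=> xU; rewrite {1}(Up_coord Wq sp xU) linearD /= (mkA_onU Uiso Wq sp).
by rewrite (mkA_onW sp) addrA addrAC.
Qed.

Lemma mkA_Up_L (M : 'End(sU)) g (psi : 'Hom(W, sU)) (eta : 'Hom(dU, sU)) x :
  GLa g -> x \in Up -> Ld x ->
  I (M (prU b j x) - prU b j x - psi (g (quo x))) ->
  L (mkA M g psi eta x - x).
Proof.
move=> [_ _ _ gd] xU Lx Ix; rewrite mkA_Up // [X in _ - X](Up_coord Wq sp xU).
have -> : vsval (M (prU b j x) - psi (g (quo x))) + k (g (quo x)) -
    (vsval (prU b j x) + k (quo x)) =
    vsval (M (prU b j x) - prU b j x - psi (g (quo x))) + k (g (quo x) - quo x).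
  rewrite (linearB k) opprD !addrA.
  have vB (u v : sU) : vsval (u - v) = vsval u - vsval v by [].
  by rewrite !vB [LHS](ACl (1*4*2*3*5)).
apply: zsubgroupD => //; apply: (k_Lambda Wq L_even sig sp jsig).
by apply: gd; apply: quo_Lambda_dual.
Qed.

(** Reduces the construction of elements with given action to the choice of psi, a condition on
    U^perp. Both surjectivity and the splitting are obtained this way. *)
Lemma exists_Gamma_psi M g (psi : 'Hom(W, sU)) : SLlat I M -> GLa g ->
  (forall x, x \in Up -> Ld x ->
     I (M (prU b j x) - prU b j x - psi (g (quo x)))) ->
  exists2 eta : 'Hom(dU, sU), antisym eta &
    GLI (mkA M g psi eta) /\ act p (mkA M g psi eta) = (M, g).
Proof.
move=> MI Gg psiI; have [g_iso gLa Sg _] := Gg.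
have M_GL : GLU M by apply/eqP/SLlat_lker0/MI.
have [|eta eta_as etaL] := exists_eta b_nondeg Uiso Wq L_even sig sp
    (psi := psi) M_GL g_iso MI.1 gLa.
  by move=> x xU Lx; apply: mkA_Up_L => //; apply: psiI.
exists eta => //; have PA := mkA_PU b_nondeg Uiso Wq sp psi M_GL g_iso eta_as.
have [AM Ag] := act_mkA b_nondeg Uiso Wq sp psi M_GL g_iso eta_as.
split; last by rewrite /act AM Ag.
by apply: GammaLI_intro => //; rewrite ?AM ?Ag //; case: MI.
Qed.

Lemma exists_psi M g : SLpair Id I M -> GLa g ->
  exists psi : 'Hom(W, sU), forall x, x \in Up -> Ld x ->
     I (M (prU b j x) - prU b j x - psi (g (quo x))).
Proof.
move=> [MI MJ] Gg; have g_iso : isometries bW g by case: Gg.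
have g0 := isometry_lker0 bW_nondeg g_iso.
pose N := Ld `&` [set x | x \in Up].
have sN : zsubgroup N.
  have sLd := dual_lattice_zsubgroup b L.
  split=> [|x y [Lx xU] [Ly yU]]; first by split; [case: sLd | apply: mem0v].
  by split; [exact: zsubgroupB sLd Lx Ly | apply: rpredB].
have bN : bounded_den N.
  by apply: bounded_den_sub (dual_lattice_bounded b_nondeg latL) => x [].
have [x [Lx xU] xU'|Phi PhiU PhiN] :=
    @lattice_extend V sU N I sN bN U ((\1 - M) \o retr U)%VF.
  rewrite comp_lfunE retrE add_lfunE opp_lfunE id_lfunE.
  by apply: MJ; rewrite /lat_Idual /= vsprojK.
(* Phi equals 1 - M on U, so on x = u + k w it is u - M u + Phi (k w); composing with g^{-1} turns
   psi (g w) into Phi (k w), and the required vector is - Phi x. *)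
exists (Phi \o k \o g^-1)%VF => x xU Lx.
rewrite (comp_lfunE _ (g^-1)%VF) lker0_lfunK // comp_lfunE.
have -> : M (prU b j x) - prU b j x - Phi (k (quo x)) = - Phi x.
  rewrite [in RHS](Up_coord Wq sp xU) linearD /= (PhiU _ (subvsP _)).
  rewrite comp_lfunE retrE vsvalK add_lfunE opp_lfunE id_lfunE.
  by rewrite opprD opprB.
by apply: zsubgroupN => //; apply: PhiN.
Qed.

End Existence.

Lemma act_GammaLI_surj M g : SLpair Id I M -> GLa g ->
  exists2 A, GLI A & act p A = (M, g).
Proof.
move=> MJ Gg; have [sigma [j [k [sig sp jsig]]]] := exists_sigma_splitting.
have [psi psiI] := exists_psi sp MJ Gg.
have [eta _ [GA actA]] := exists_Gamma_psi sig sp jsig MJ.1 Gg psiI.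
by exists (mkA p j k M g psi eta).
Qed.

End ParabolicLattice.

(** * Cosets and exact sequences *)

Section Cosets.
Variables (R : realType) (V : vectType rat) (b : {symmetric V}) (U : {vspace V}).
Variables (W : vectType rat) (p : 'Hom(subvs_of (orthov b U), W)).
Hypotheses (b_nondeg : nondegenerate b) (Uiso : (U <= orthov b U)%VS).
Hypothesis Wq : is_quotient p.
Variable L : set V.
Hypothesis L_even : even_lattice b L.

Local Notation Up := (orthov b U).
Local Notation sU := (subvs_of U).
Local Notation I := (lat_I L : set sU).
Local Notation La := (Lambda p L).
Local Notation Lad := (Lambda_dual p L).
Local Notation Id := (lat_Idual b L : set sU).
Local Notation GLI := (GammaLI b U L R).

Let latL : is_lattice L. Proof. exact: even_lattice_is_lattice L_even. Qed.
Let sL : zsubgroup L. Proof. by case: latL. Qed.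
Let sI : zsubgroup I. Proof. by case: (lat_I_lattice U L_even). Qed.
Let sLa : zsubgroup La. Proof. by case: (Lambda_lattice Wq L_even). Qed.

(** Central elements are exactly the elements of P_U that fix U^perp pointwise, so a coset is a
    restriction to U^perp, and identities between cosets can be checked on vectors there. *)
Lemma as_cosetP A : PU b U A ->
  as_coset b U A = [set B | PU b U B /\ forall x, x \in Up -> B x = A x].
Proof.
move=> PA; have A0 := PU_lker0 b_nondeg PA.
apply/seteqP; split=> [_ [eta eta_as <-]|B [PB AB]].
  split=> [|x xU]; first by apply: PU_comp => //; apply: central_PU.
  by rewrite comp_lfunE central_Up.
have [s [j [k [_ sp _]]]] := exists_sigma_splitting b_nondeg Uiso Wq L_even.
have PAB := PU_comp (PU_inv b_nondeg PA) PB.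
have [|eta eta_as ABE] := PU_id_on_Up b_nondeg Uiso sp PAB.
  by move=> x xU; rewrite comp_lfunE AB // lker0_lfunK.
exists eta => //; rewrite -ABE; apply/lfunP => x.
by rewrite !comp_lfunE lker0_lfunVK.
Qed.

Lemma as_coset_eq A B : PU b U A -> PU b U B ->
  as_coset b U A = as_coset b U B <-> (forall x, x \in Up -> A x = B x).
Proof.
move=> PA PB; rewrite (as_cosetP PA) (as_cosetP PB); split=> [/seteqP[AB _]|AB].
  by have [] := AB A.
apply/seteqP; split=> C [PC CE]; split=> // x xU; rewrite CE ?AB //.
Qed.

Lemma as_coset_comp A B : PU b U A -> PU b U B ->
  [set (A' \o B')%VF | A' in as_coset b U A & B' in as_coset b U B] =
  as_coset b U (A \o B)%VF.
Proof.
move=> PA PB; have PAB := PU_comp PA PB; have B0 := PU_lker0 b_nondeg PB.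
rewrite (as_cosetP PA) (as_cosetP PB) (as_cosetP PAB).
apply/seteqP; split=> [_ [A' [PA' AE] [B' [PB' BE] <-]]|C [PC CE]].
  split=> [|x xU]; first exact: PU_comp.
  by rewrite !comp_lfunE BE // AE // (PU_Up PB).
have PBV := PU_inv b_nondeg PB.
exists (C \o B^-1)%VF; last first.
  by exists B => //; rewrite -comp_lfunA lker0_compVf // comp_lfun1r.
split=> [|x xU]; first exact: PU_comp.
by rewrite comp_lfunE CE ?(PU_Up PBV) // comp_lfunE lker0_lfunVK.
Qed.

Lemma act_bar_coset A : PU b U A -> act_bar p (as_coset b U A) = act p A.
Proof.
move=> PA; have : as_coset b U A A by rewrite (as_cosetP PA); split.
move=> /xgetI-/(_ \1%VF); rewrite /act_bar.
move: (xget _ _) => C; rewrite (as_cosetP PA) => -[PC CE].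
exact: (act_agree Uiso Wq PC PA CE).
Qed.

Lemma hom_cosetP psi A : hom_coset p psi A -> hom_coset p psi = as_coset b U A.
Proof.
move=> [[PA actA] AE]; rewrite (as_cosetP PA).
apply/seteqP; split=> B [PB BE].
  split=> [|x xU]; first by case: PB.
  by rewrite -(vsprojK xU) AE BE.
split=> [|x]; last by rewrite BE ?subvsP // AE.
by split=> //; rewrite (act_agree Uiso Wq PB PA).
Qed.

Lemma hom_coset_GammaLI psi : latHom Lad I psi ->
  exists2 A, GLI A & hom_coset p psi A.
Proof.
move=> psiI.
have [s [j [k [sig sp jsig]]]] := exists_sigma_splitting b_nondeg Uiso Wq L_even.
have [| |x xU Lx|eta eta_as [GA actA]] :=
    @exists_Gamma_psi R _ _ _ _ _ b_nondeg Uiso Wq _ L_even _ _ _ sig sp jsig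
      \1%VF \1%VF psi.
- by case: (SLpair1 Id (sI.1)).
- exact: (Gamma1 _ _ sLa).
- rewrite !id_lfunE subrr sub0r; apply: zsubgroupN sI _; apply: psiI.
  exact: quo_Lambda_dual.
set A := mkA _ _ _ _ _ _ _ in GA actA; exists A => //.
split=> [|x]; first by split=> //; case: GA.
have xU := subvsP x.
rewrite /A (mkA_Up Uiso Wq sp) // !id_lfunE [in RHS](Up_coord Wq sp xU) quo_val.
by rewrite addrAC.
Qed.

Lemma WU_hom_coset A : WU p A -> exists psi, hom_coset p psi A.
Proof.
move=> WA; have [PA [AU AW]] := WA.
have [s [j [k [_ sp _]]]] := exists_sigma_splitting b_nondeg Uiso Wq L_even.
have [psi psiE] := PU_coords b_nondeg Wq sp PA.
exists psi; split=> // x; have xU := subvsP x.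
rewrite [in LHS](Up_coord Wq sp xU) linearD /= psiE AW id_lfunE.
rewrite -(act_UE _ PA) AU id_lfunE addrA -(Up_coord Wq sp xU).
by rewrite quo_val.
Qed.

(** psi w is x - A x for a lift x of w in L^* and U^perp, so it is in U and in L. *)
Lemma hom_coset_latHom psi A : GLI A -> hom_coset p psi A -> latHom Lad I psi.
Proof.
move=> GA [_ AE] w /(Lambda_dual_lift b_nondeg Uiso Wq L_even)[x [xU Lx <-]].
have [PA _ [_ _ _ Ad]] := GA; have /(zsubgroupN sL) := Ad x Lx.
by rewrite -{1}(vsprojK xU) AE vsprojK // opprB opprB addrC subrK.
Qed.

Lemma hom_group_is_group : is_group (hom_group p L).
Proof.
split=> /= [w _|f g fI gI w Lw|f g h _ _ _|f _|f fI].
- by rewrite lfunE; exact: sI.1.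
- by rewrite add_lfunE; apply: zsubgroupD => //; [apply: fI | apply: gI].
- by rewrite addrA.
- by rewrite add0r.
exists (- f); rewrite addNr subrr; split=> // w Lw.
by rewrite opp_lfunE; apply: zsubgroupN => //; apply: fI.
Qed.

Lemma coset_group_is_group (X : set 'End(V)) : X `<=` PU b U -> X \1%VF ->
  (forall A B, X A -> X B -> X (A \o B)%VF) ->
  (forall A, X A -> X (A^-1)%VF) ->
  is_group (coset_group b U (as_coset b U @` X)).
Proof.
move=> XP X1 XM XV; split=> /=.
- by exists \1%VF.
- move=> _ _ [A XA <-] [B XB <-]; rewrite as_coset_comp; [|exact: XP..].
  by exists (A \o B)%VF => //; exact: XM.
- move=> _ _ _ [A XA <-] [B XB <-] [C XC <-].
  have [PA PB PC] := And3 (XP _ XA) (XP _ XB) (XP _ XC).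
  by rewrite !as_coset_comp ?comp_lfunA //; exact: PU_comp.
- by move=> _ [A /XP PA <-]; rewrite as_coset_comp ?comp_lfun1l //; exact: PU1.
move=> _ [A XA <-]; have PA := XP _ XA; have A0 := PU_lker0 b_nondeg PA.
have PV := PU_inv b_nondeg PA.
exists (as_coset b U (A^-1)%VF); rewrite !as_coset_comp //.
rewrite lker0_compVf // lker0_compfV //; split=> //.
by exists (A^-1)%VF => //; exact: XV.
Qed.

Section OverJ.
Variable J : set sU.
Hypothesis IdJ : Id `<=` J.

(** J = I_{L^*} gives the whole group and J = I_iota the part that splits; one proof of exactness
    serves both. *)
Definition GammaLI_J : set 'End(V) := GLI `&` [set A | SLpair J I (act_U U A)].

Let GJ_PU : GammaLI_J `<=` PU b U. Proof. by move=> A [[]]. Qed.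

Let SLpairS M : SLpair J I M -> SLpair Id I M.
Proof. by move=> [MI MJ]; split=> // u Iu; apply/MJ/IdJ. Qed.

Lemma coset_GammaLI_J_is_group :
  is_group (coset_group b U (as_coset b U @` GammaLI_J)).
Proof.
apply: coset_group_is_group => // [|A B [GA JA] [GB JB]|A [GA JA]].
- split; first exact: GammaLI1.
  by have [AU _] := act1 Wq; rewrite /= AU; exact: SLpair1 sI.1.
- have [PA _ _] := GA; have [PB _ _] := GB.
  split; first exact: GammaLI_comp.
  by have [AU _] := act_comp Wq PA PB; rewrite /= AU; exact: SLpair_comp.
split; first exact: GammaLI_inv.
have [PA _ _] := GA; have [AU _] := act_inv b_nondeg Wq PA.
rewrite /= AU; exact: SLpair_inv.
Qed.

(** psi is read off from the action on U^perp, whence injectivity. Surjectivity comes from that of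
    the full group, as SL(J, I) is contained in SL(I_{L^*}, I) when J contains I_{L^*}. *)
Lemma coset_exact : short_exact (hom_group p L)
  (coset_group b U (as_coset b U @` GammaLI_J)) (SL_Gamma p L J R)
  (hom_coset p) (act_bar p).
Proof.
have hom_im psi : latHom Lad I psi ->
    exists A, [/\ GammaLI_J A, hom_coset p psi A &
                  hom_coset p psi = as_coset b U A].
  move=> psiI; have [A GA hA] := hom_coset_GammaLI psiI.
  exists A; split=> //; last exact: hom_cosetP.
  split=> //; have [[_ [AU _]] _] := hA.
  by rewrite /= AU; exact: SLpair1 sI.1.
split.
  split; first exact: hom_group_is_group.
    exact: coset_GammaLI_J_is_group.
  exact: SL_Gamma_is_group.
split.
- split=> [psi /hom_im[A [GA _ ->]]|psi phi psiI phiI]; first by exists A.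
  have [A [GA hA ->]] := hom_im _ psiI; have [B [GB hB ->]] := hom_im _ phiI.
  have [PA PB] := conj (GJ_PU GA) (GJ_PU GB).
  rewrite /= as_coset_comp //; apply: hom_cosetP.
  have [[_ actA] AE] := hA; have [[_ actB] BE] := hB.
  split=> [|x].
    split; first exact: PU_comp.
    rewrite act_comp //; move: actA actB => [-> ->] [-> ->].
    by rewrite !comp_lfun1l.
  have AU : forall u : sU, A (vsval u) = vsval u.
    by move=> u; rewrite -(act_UE _ PA); case: actA => -> _; rewrite id_lfunE.
  rewrite comp_lfunE BE linearB /= AE AU add_lfunE.
  by rewrite [vsval (_ + _)]raddfD opprD addrA.
- split=> [_ [A [GA JA] <-]|_ _ [A GA <-] [B GB <-]].
    have [PA _ _] := GA; rewrite act_bar_coset //.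
    by split=> //; exact: GammaLI_act_W.
  have [PA PB] := conj (GJ_PU GA) (GJ_PU GB).
  rewrite [LHS](_ : _ = act_bar p (as_coset b U (A \o B)%VF)); last by rewrite /= as_coset_comp.
  rewrite (act_bar_coset (PU_comp PA PB)) (act_comp Wq PA PB).
  by rewrite (act_bar_coset PA) (act_bar_coset PB).
- move=> psi phi; rewrite !inE => psiI phiI hE.
  have [A [_ hA _]] := hom_im _ psiI.
  have [_ AE] := hA; have [_ AE'] : hom_coset p phi A by rewrite -hE.
  apply/lfunP => w; have [x xU <-] := quo_surj Wq w.
  have := AE' (vsproj Up x); rewrite AE => /addrI/oppr_inj/subvs_inj.
  by rewrite -!quo_val vsprojK.
- apply/seteqP; split=> [_ [psi /hom_im[A [GA [[PA actA] AE] ->]] <-]|].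
    by split; [exists A | rewrite act_bar_coset].
  move=> _ [[A GA <-]]; have PA := GJ_PU GA; rewrite (act_bar_coset PA) => actA.
  have [|psi hA] := @WU_hom_coset A; first by split.
  exists psi; last exact: hom_cosetP.
  by apply: hom_coset_latHom hA; case: GA.
apply/seteqP; split=> [_ [_ [A [GA JA] <-] <-]|[M g] [/= MJ Gg]].
  have [PA _ _] := GA; rewrite act_bar_coset //.
  by split=> //; exact: GammaLI_act_W.
have [A GA actA] := act_GammaLI_surj b_nondeg Uiso Wq L_even (SLpairS MJ) Gg.
have [PA _ _] := GA; exists (as_coset b U A); last by rewrite act_bar_coset.
by exists A => //; split=> //=; case: actA => ->.
Qed.

End OverJ.

Lemma GammaLI_exact : short_exact (lfun_group (GLI `&` WU p))
  (lfun_group GLI) (SL_Gamma p L Id R) id (act p).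
Proof.
have GLI_PU A : GLI A -> PU b U A by case.
split.
  split; last exact: SL_Gamma_is_group.
    apply: lfun_group_is_group => [|A B [GA WA] [GB WB]|A [GA WA]].
    - by split; [apply: GammaLI1 | split; [apply: PU1 | apply: act1]].
    - split; first exact: GammaLI_comp.
      have [PA actA] := WA; have [PB actB] := WB.
      split; first exact: PU_comp.
      rewrite act_comp //; move: actA actB => [-> ->] [-> ->].
      by rewrite !comp_lfun1l.
    have PA := GLI_PU _ GA; split; first exact: PU_lker0 PA.
    split; first exact: GammaLI_inv.
    split; first exact: PU_inv.
    have [_ [AU AW]] := WA; rewrite act_inv // AU AW.
    have inv1 (X : vectType rat) : (\1^-1)%VF = \1%VF :> 'End(X).
      have l0 : lker (\1%VF : 'End(X)) == 0%VS by apply/lker0P => x y; rewrite !id_lfunE.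
      by rewrite -[LHS]comp_lfun1l lker0_compfV.
    by rewrite !inv1.
  apply: lfun_group_is_group => [|A B|A GA]; first exact: GammaLI1.
    exact: GammaLI_comp.
  by split; [exact: PU_lker0 (GLI_PU _ GA) | exact: GammaLI_inv].
split=> //.
- by split=> // A [].
- split=> [A GA|A B GA GB]; last by rewrite /= act_comp //; exact: GLI_PU.
  by split; [exact: (GammaLI_act_U b_nondeg L_even GA) |
             exact: (GammaLI_act_W b_nondeg Uiso Wq L_even GA)].
- apply/seteqP; split=> [_ [A [GA [PA actA]] <-]|A [GA actA]]; first by split.
  by exists A => //; split=> //; split=> //; exact: GLI_PU.
apply/seteqP; split=> [_ [A GA <-]|[M g] [/= MJ Gg]].
  by split; [exact: (GammaLI_act_U b_nondeg L_even GA) |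
             exact: (GammaLI_act_W b_nondeg Uiso Wq L_even GA)].
by have [A GA actA] := act_GammaLI_surj b_nondeg Uiso Wq L_even MJ Gg; exists A.
Qed.

End Cosets.

(** * Coordinates of the arithmetic groups *)

Section Transport.
Variables (S T : Type) (G : setGroup S) (H : setGroup T) (f : S -> T).

(** Group axioms transported back along a multiplicative bijection; for the semi-direct product this
    replaces computations with the twisted multiplication. *)
Lemma bij_is_group : is_group H -> set_bij (carrier G) (carrier H) f ->
  carrier G (gone G) -> f (gone G) = gone H ->
  (forall x y, carrier G x -> carrier G y -> carrier G (gmul G x y)) ->
  (forall x y, carrier G x -> carrier G y ->
     f (gmul G x y) = gmul H (f x) (f y)) -> is_group G.
Proof.
move=> [_ _ HA H1 HV] [fG finj fsurj] G1 f1 GM fM.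
have f_inj x y : carrier G x -> carrier G y -> f x = f y -> x = y.
  by move=> Gx Gy; apply: finj; rewrite inE.
split=> //.
- move=> x y z Gx Gy Gz; have [Gxy Gyz] := conj (GM x y Gx Gy) (GM y z Gy Gz).
  by apply: f_inj; do ?[exact: GM]; rewrite !fM // HA //; exact: fG.
- by move=> x Gx; apply: f_inj; do ?[exact: GM]; rewrite ?fM ?f1 ?H1 //; exact: fG.
move=> x Gx; have [y' [/fsurj[y Gy <-] yx xy]] := HV _ (fG x Gx).
by exists y; split=> //; apply: f_inj; do ?[exact: GM]; rewrite ?fM ?f1.
Qed.

End Transport.

Section Coordinates.
Variables (R : realType) (V : vectType rat) (b : {symmetric V}) (U : {vspace V}).
Variables (W : vectType rat) (p : 'Hom(subvs_of (orthov b U), W)).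
Hypotheses (b_nondeg : nondegenerate b) (Uiso : (U <= orthov b U)%VS).
Hypothesis Wq : is_quotient p.
Variable L : set V.
Hypothesis L_even : even_lattice b L.

Local Notation sU := (subvs_of U).
Local Notation dU := (vdual (subvs_of U)).
Local Notation bW := (induced_form p : {symmetric W}).
Local Notation quo := (quo p).
Local Notation I := (lat_I L : set sU).
Local Notation Istar := (lat_Istar L : set dU).
Local Notation La := (Lambda p L).
Local Notation Lad := (Lambda_dual p L).
Local Notation GLI := (GammaLI b U L R).

Variables (sigma j : 'Hom(vdual (subvs_of U), V)) (k : 'Hom(W, V)).
Hypotheses (sig : dual_section b L sigma) (sp : splitting p j k).
Hypothesis jsig : forall f, j f - sigma f \in U.
Local Notation mkA := (mkA p j k).

Let latL : is_lattice L. Proof. exact: even_lattice_is_lattice L_even. Qed.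
Let sL : zsubgroup L. Proof. by case: latL. Qed.
Let sI : zsubgroup I. Proof. by case: (lat_I_lattice U L_even). Qed.
Let sLa : zsubgroup La. Proof. by case: (Lambda_lattice Wq L_even). Qed.

Lemma antisym0 : antisym (0 : 'Hom(dU, sU)).
Proof. by move=> f g; rewrite !lfunE /= 2!linear0 oppr0. Qed.

Lemma GLU1 : GLU (\1%VF : 'End(sU)).
Proof. by apply/eqP/lker0P => x y; rewrite !id_lfunE. Qed.

Lemma isometry1 : isometries bW \1%VF.
Proof. by move=> x y; rewrite !id_lfunE. Qed.

Lemma k_sigma w f : b (k w) (sigma f) = 0.
Proof.
have [_ _ kU kj] := sp; have : b (k w) (j f - sigma f) = 0.
  by rewrite symfC -(vsprojK (jsig f)) (formUUp _ (kU _).1).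
by rewrite symfBr kj sub0r => /eqP; rewrite oppr_eq0 => /eqP.
Qed.

(** sigma f and j f differ by a vector of U, which is fixed as M = 1, so sigma may be replaced by j
    in the difference. *)
Lemma mkA1_sigma (psi : 'Hom(W, sU)) eta f :
  mkA \1%VF \1%VF psi eta (sigma f) - sigma f =
  k (adjoint p psi f) - vsval ((2^-1 *: (psi \o adjoint p psi)%VF + eta) f).
Proof.
have [u uE] : exists u : sU, sigma f = j f - vsval u.
  by exists (vsproj U (j f - sigma f)); rewrite vsprojK // subKr.
have zE : (2^-1 *: (psi \o adjoint p psi)%VF + eta) f =
    2^-1 *: psi (adjoint p psi f) + eta f.
  by rewrite add_lfunE scale_lfunE comp_lfunE.
rewrite {1}uE (linearB _ (j f)) /= (mkA_onU Uiso Wq sp) (mkA_onD sp).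
rewrite contragredient1 id_lfunE uE.
move: (_ f) zE => z <-; move: (k (adjoint p psi f)) => y.
by rewrite opprB addrA [LHS](ACl ((1*6)*(4*5)*2*3)) /= subrr addNr !add0r.
Qed.

Lemma mkA1_form (psi : 'Hom(W, sU)) eta f g :
  b (mkA \1%VF \1%VF psi eta (sigma f) - sigma f) (sigma g) =
  - g ((2^-1 *: (psi \o adjoint p psi)%VF + eta) f).
Proof.
by rewrite mkA1_sigma symfBl k_sigma sub0r (symfC b (vsval _)) sig.1.
Qed.

(** Dualizing Lambda^* -> I gives I^* -> Lambda, since Lambda is the dual of Lambda^*. *)
Lemma adjoint_latHom psi f : latHom Lad I psi -> Istar f -> La (adjoint p psi f).
Proof.
move=> psiI If; apply: (Lambda_dualK b_nondeg Wq L_even) => z Lz.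
by rewrite adjointE //; apply/If/psiI.
Qed.

Lemma GammaLI_WU_coords A : GLI A -> WU p A ->
  exists psi eta, [/\ antisym eta, A = mkA \1%VF \1%VF psi eta,
    latHom Lad I psi, latHom Istar (lat_Ihalf L) eta &
    latHom Istar I (2^-1 *: (psi \o adjoint p psi)%VF + eta)].
Proof.
move=> GA WA; have [PA [AU AW]] := WA.
have [psi hA] := WU_hom_coset b_nondeg Uiso Wq L_even WA; have [_ AE] := hA.
have psiI := hom_coset_latHom b_nondeg Uiso Wq L_even GA hA.
have [_ _ kU _] := sp.
have [u|w|eta eta_as AmkA] := coordsP b_nondeg Uiso Wq sp (psi := psi) PA GLU1 isometry1.
- by rewrite -(act_UE _ PA) AU.
- rewrite -{1}(vsprojK (kU w).1) AE vsprojK ?(kU w).1 //.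
  by rewrite -/(quo (k w)) (kU w).2 id_lfunE.
exists psi, eta.
have EI : latHom Istar I (2^-1 *: (psi \o adjoint p psi)%VF + eta).
  move=> f If; apply: (mem_I L_even) => g Ig.
  rewrite -[X in is_true (X \in _)]opprK -mkA1_form -AmkA rpredN.
  have [_ _ [_ _ _ Ad]] := GA.
  by rewrite symfC; apply: (sig.2 _ Ig); apply/Ad/(sig.2 _ If).
split=> // f If; rewrite /lat_Ihalf /=.
(* Half-integrality of eta follows from the integrality of psi psi^* / 2 + eta and of psi psi^*. *)
have -> : 2 *: eta f = 2 *: (2^-1 *: (psi \o adjoint p psi)%VF + eta) f -
                       psi (adjoint p psi f).
  rewrite [(_ + eta) f]lfunE /= scale_lfunE comp_lfunE scalerDr scalerA.
  by rewrite mulfV // scale1r addrAC subrr add0r.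
apply: zsubgroupB => //.
  by rewrite scaler_nat; apply: zsubgroupMn => //; exact: EI.
apply: (psiI); apply: (Lambda_sub_dual Wq L_even); exact: (adjoint_latHom psiI If).
Qed.

Lemma mkA1_GammaLI (psi : 'Hom(W, sU)) eta : antisym eta -> latHom Lad I psi ->
  latHom Istar I (2^-1 *: (psi \o adjoint p psi)%VF + eta) ->
  GLI (mkA \1%VF \1%VF psi eta) /\ WU p (mkA \1%VF \1%VF psi eta).
Proof.
move=> eta_as psiI EI.
have PA := mkA_PU b_nondeg Uiso Wq sp psi GLU1 isometry1 eta_as.
have actA := act_mkA b_nondeg Uiso Wq sp psi GLU1 isometry1 eta_as.
have [AU AW] := actA; split; last by split.
apply: (GammaLI_intro b_nondeg Uiso Wq L_even PA); rewrite ?AU ?AW.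
- exact: det_lfun1.
- by have [_ _ + _] := Gamma1 R bW sLa.
have imgid (X : vectType rat) (B : set X) : [set (\1%VF : 'End(X)) x | x in B] = B.
  by apply/seteqP; split=> [_ [x Bx <-]|x Bx]; [|exists x]; rewrite // id_lfunE.
apply: (stab_crit b_nondeg Wq L_even sig PA); rewrite ?AU ?AW ?imgid //.
  move=> x xU Lx; apply: (mkA_Up_L Uiso Wq L_even sig sp jsig (R := R)) => //.
    exact: (Gamma1 _ _ sLa).
  rewrite !id_lfunE subrr sub0r; apply: zsubgroupN => //.
  by apply: psiI; apply: quo_Lambda_dual.
by move=> f g If Ig; rewrite mkA1_form rpredN; apply: Ig; apply: EI.
Qed.

End Coordinates.

(** * The semi-direct product structure *)

Section SplitCoordinates.
Variables (R : realType) (V : vectType rat) (b : {symmetric V}) (U : {vspace V}).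
Variables (W : vectType rat) (p : 'Hom(subvs_of (orthov b U), W)).
Hypotheses (b_nondeg : nondegenerate b) (Uiso : (U <= orthov b U)%VS).
Hypothesis Wq : is_quotient p.
Variable L : set V.
Hypothesis L_even : even_lattice b L.

Local Notation Up := (orthov b U).
Local Notation sU := (subvs_of U).
Local Notation dU := (vdual (subvs_of U)).
Local Notation bW := (induced_form p : {symmetric W}).
Local Notation Ld := (dual_lattice b L).
Local Notation I := (lat_I L : set sU).
Local Notation La := (Lambda p L).
Local Notation Lad := (Lambda_dual p L).
Local Notation GLa := (GammaLambda p L R).

Variables (sigma j : 'Hom(vdual (subvs_of U), V)) (k : 'Hom(W, V)).
Hypotheses (sig : dual_section b L sigma) (sp : splitting p j k).
Hypothesis jsig : forall f, j f - sigma f \in U.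
Local Notation mkA := (mkA p j k).
Local Notation prU := (prU b j).

Let latL : is_lattice L. Proof. exact: even_lattice_is_lattice L_even. Qed.
Let sL : zsubgroup L. Proof. by case: latL. Qed.
Let sI : zsubgroup I. Proof. by case: (lat_I_lattice U L_even). Qed.
Let sLa : zsubgroup La. Proof. by case: (Lambda_lattice Wq L_even). Qed.
Let bW_nondeg : nondegenerate bW. Proof. exact: induced_form_nondeg. Qed.

Let vB (u v : sU) : vsval (u - v) = vsval u - vsval v. Proof. by []. Qed.
Variable J : set sU.
Hypothesis prUJ : forall x, x \in Up -> Ld x -> J (prU x).

Variable cc : 'End(sU) * 'End(W) * 'Hom(W, sU) -> set 'End(V).
Hypothesis ccE : forall M g psi, GLU M -> isometries bW g ->
  cc (M, g, psi) = as_coset b U (mkA M g psi 0).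

Local Notation GJ := (GammaLI_J R b L J).
Local Notation G := (coset_group b U (as_coset b U @` GJ)).
Local Notation S := (SL_Gamma p L J R).
Local Notation H := (hom_group p L).
Local Notation SH := (semidirect S H).

Let S_GL M : SLpair J I M -> GLU M.
Proof. by case=> /SLlat_lker0/eqP. Qed.

Let G_iso g : GLa g -> isometries bW g. Proof. by case. Qed.

Let g_dual g w : GLa g -> Lad w -> Lad (g w).
Proof.
move=> [_ _ _ gd] Lw; rewrite -[g w](subrK w).
apply: (zsubgroupD (dual_lattice_zsubgroup bW La) _ Lw).
by apply: (Lambda_sub_dual Wq L_even); exact: gd.
Qed.

Let gV_dual g w : GLa g -> Lad w -> Lad ((g^-1)%VF w).
Proof. by move=> Gg; apply: g_dual; apply: Gamma_inv. Qed.

Lemma mkA0_PU M g (psi : 'Hom(W, sU)) : GLU M -> isometries bW g ->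
  PU b U (mkA M g psi 0).
Proof. by move=> M_GL g_iso; apply: mkA_PU => //; exact: antisym0. Qed.

Lemma act_mkA0 M g (psi : 'Hom(W, sU)) : GLU M -> isometries bW g ->
  act p (mkA M g psi 0) = (M, g).
Proof. by move=> M_GL g_iso; apply: act_mkA => //; exact: antisym0. Qed.

(** The product of two elements with eta = 0 may have another eta, but on U^perp this is invisible,
    and there both sides agree. *)
Lemma mkA0_comp M g (psi : 'Hom(W, sU)) N h (phi : 'Hom(W, sU)) : GLU M ->
  isometries bW g -> GLU N -> isometries bW h ->
  as_coset b U (mkA M g psi 0 \o mkA N h phi 0)%VF =
  as_coset b U (mkA (M \o N)%VF (g \o h)%VF (psi + (M \o phi \o g^-1)%VF) 0).
Proof.
move=> M_GL g_iso N_GL h_iso.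
have g0 := isometry_lker0 bW_nondeg g_iso.
have gh_iso : isometries bW (g \o h)%VF.
  by move=> x y; rewrite !comp_lfunE g_iso h_iso.
have MN_GL : GLU (M \o N)%VF.
  apply/eqP/lker0P => x y; rewrite !comp_lfunE.
  by move/eqP/lker0P: M_GL => /[apply]; move/eqP/lker0P: N_GL; apply.
have PA := mkA0_PU psi M_GL g_iso; have PB := mkA0_PU phi N_GL h_iso.
apply/(as_coset_eq b_nondeg Uiso Wq L_even (PU_comp PA PB) (mkA0_PU _ MN_GL gh_iso)).
have AE u w : mkA M g psi 0 (vsval u + k w) = vsval (M u - psi (g w)) + k (g w).
  by rewrite linearD /= (mkA_onU Uiso Wq sp) (mkA_onW sp) ?vB addrA addrAC.
move=> x xU; rewrite (comp_lfunE (mkA M g psi 0)) [mkA N h phi 0 x](mkA_Up Uiso Wq sp) //.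
rewrite [RHS](mkA_Up Uiso Wq sp) //.
rewrite AE comp_lfunE; congr (vsval _ + _).
rewrite add_lfunE !comp_lfunE lker0_lfunK // linearB /= opprD addrA addrAC //.
by rewrite comp_lfunE.
Qed.

(** For M in SL(J, I), the terms M u - u and psi (g w) lie in I separately, since the U-components u
    of the vectors concerned are in J. So M puts no condition on psi. *)
Let ccG M g (psi : 'Hom(W, sU)) : SLpair J I M -> GLa g -> latHom Lad I psi ->
  (as_coset b U @` GJ) (as_coset b U (mkA M g psi 0)).
Proof.
move=> MJ Gg psiI; have [M_GL g_iso] := conj (S_GL MJ) (G_iso Gg).
have [x xU Lx|eta eta_as [GA actA]] :=
    exists_Gamma_psi b_nondeg Uiso Wq L_even sig sp jsig (psi := psi) MJ.1 Gg.
  have Lq := quo_Lambda_dual Wq xU Lx.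
  apply: zsubgroupB => //; last exact/psiI/g_dual.
  by rewrite -opprB; apply: zsubgroupN => //; apply: MJ.2; apply: prUJ.
exists (mkA M g psi eta).
  by split=> //=; case: actA => -> _.
have [PA _ _] := GA.
apply/(as_coset_eq b_nondeg Uiso Wq L_even PA (mkA0_PU psi M_GL g_iso)) => x xU.
by rewrite !(mkA_Up Uiso Wq sp).
Qed.

Lemma GammaLI_J_coords A : GJ A ->
  exists M g psi, [/\ SLpair J I M, GLa g, latHom Lad I psi &
    as_coset b U (mkA M g psi 0) = as_coset b U A].
Proof.
move=> [GA JA]; have [PA _ [_ _ _ Ad]] := GA.
have Gg := GammaLI_act_W b_nondeg Uiso Wq L_even GA.
have [psi psiE] := PU_coords b_nondeg Wq sp PA.
have g0 := isometry_lker0 bW_nondeg (G_iso Gg).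
have AE x : x \in Up -> A x = mkA (act_U U A) (act_W p A) psi 0 x.
  move=> xU; rewrite (mkA_Up Uiso Wq sp) // [in LHS](Up_coord Wq sp xU).
  by rewrite linearD /= psiE -(act_UE _ PA) ?vB addrA addrAC.
exists (act_U U A), (act_W p A), psi; split=> //; last first.
  apply/(as_coset_eq b_nondeg Uiso Wq L_even (mkA0_PU psi (S_GL JA) (G_iso Gg)) PA).
  by move=> x xU; rewrite AE.
move=> w Lw; have Lw' := gV_dual Gg Lw.
(* Lifting g^{-1} w makes w the argument of psi in A x - x. The other terms, M u - u and k (w -
   g^{-1} w), are in L. *)
have [x [xU Lx qx]] := Lambda_dual_lift b_nondeg Uiso Wq L_even Lw'.
have := Ad x Lx; rewrite AE // (mkA_Up Uiso Wq sp) // [X in _ - X](Up_coord Wq sp xU).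
rewrite qx lker0_lfunVK //; set u := prU x; set M := act_U U A.
have Iu : I (M u - u) by rewrite -opprB; apply/(zsubgroupN sI)/JA.2/prUJ.
have Lk : L (k (w - (act_W p A)^-1%VF w)).
  apply: (k_Lambda Wq L_even sig sp jsig); have [_ _ _ gd] := Gg.
  by rewrite -{1}[w](lker0_lfunVK g0); apply: gd.
move=> Lall; suff : I ((M u - u) - psi w).
  by move=> /(zsubgroupB sI Iu); rewrite opprB addrC subrK.
rewrite /lat_I /= -[X in L X](addrK (k (w - (act_W p A)^-1%VF w))).
apply: zsubgroupB => //; move: Lall; congr (L _).
rewrite (linearB k) !vB opprD !addrA.
by rewrite [LHS](ACl (1*4*2*3*5)).
Qed.

Lemma cc_splits :
  [/\ is_group SH, is_morphism SH G cc, set_bij (carrier SH) (carrier G) cc,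
      forall psi, carrier H psi -> cc (\1%VF, \1%VF, psi) = hom_coset p psi &
      forall t, carrier SH t -> act_bar p (cc t) = t.1].
Proof.
have ccS M g psi : SLpair J I M -> GLa g ->
    cc (M, g, psi) = as_coset b U (mkA M g psi 0).
  by move=> /S_GL M_GL /G_iso; apply: ccE.
have SHM x y : carrier SH x -> carrier SH y -> carrier SH (gmul SH x y).
  move: x y => [[M g] psi] [[N h] phi] [[/= MJ Gg] psiI] [[/= NJ Gh] phiI].
  split; first by split; [exact: SLpair_comp | exact: Gamma_comp].
  move=> w Lw; rewrite add_lfunE; apply: zsubgroupD => //; first exact: psiI.
  rewrite !comp_lfunE; apply: SLlat_mem (MJ.1) _; apply: phiI.
  exact: gV_dual.
have ccM x y : carrier SH x -> carrier SH y ->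
    cc (gmul SH x y) = gmul G (cc x) (cc y).
  move=> SHx SHy; have := SHM _ _ SHx SHy.
  move: x y SHx SHy => [[M g] psi] [[N h] phi] [[/= MJ Gg] psiI] [[/= NJ Gh] phiI].
  move=> [[/= MNJ Ggh] _]; rewrite !ccS // -mkA0_comp; [|by auto..].
  rewrite (as_coset_comp b_nondeg Uiso Wq L_even) //; apply: mkA0_PU; by auto.
have cc_bij : set_bij (carrier SH) (carrier G) cc.
  split=> [[[M g] psi] [[/= MJ Gg] psiI]|x y|_ [A GA <-]].
  - by rewrite ccS //; exact: ccG.
  - move: x y => [[M g] psi] [[N h] phi]; rewrite !inE.
    move=> [[/= MJ Gg] psiI] [[/= NJ Gh] phiI]; rewrite !ccS //.
    have PA := mkA0_PU psi (S_GL MJ) (G_iso Gg).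
    have PB := mkA0_PU phi (S_GL NJ) (G_iso Gh).
    move=> /(as_coset_eq b_nondeg Uiso Wq L_even PA PB) AB.
    have := act_agree Uiso Wq PA PB AB.
    rewrite (act_mkA0 psi (S_GL MJ) (G_iso Gg)) (act_mkA0 phi (S_GL NJ) (G_iso Gh)).
    move=> [MN gh]; congr (_, _, _) => //; apply/lfunP => w.
    have g0 := isometry_lker0 bW_nondeg (G_iso Gg); have [_ _ kU _] := sp.
    have := AB (k ((g^-1)%VF w)) (kU _).1; rewrite !(mkA_onW sp) -gh lker0_lfunVK //.
    by move=> /addrI/oppr_inj/subvs_inj.
  have [M [g [psi [MJ Gg psiI AE]]]] := GammaLI_J_coords GA.
  by exists (M, g, psi); [split | rewrite ccS].
have one_coset psi : latHom Lad I psi -> cc (\1%VF, \1%VF, psi) = hom_coset p psi.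
  move=> psiI; have L1 : GLa \1%VF by exact: (Gamma1 _ _ sLa).
  rewrite ccS //; last exact: SLpair1 sI.1.
  apply/esym/(hom_cosetP b_nondeg Uiso Wq L_even).
  split; first by split; [exact: mkA0_PU (GLU1 _) (isometry1 _) |
                          exact: act_mkA0 (GLU1 _) (isometry1 _)].
  move=> x; have xU := subvsP x.
  rewrite (mkA_Up Uiso Wq sp) // !id_lfunE [in RHS](Up_coord Wq sp xU) quo_val.
  by rewrite vB addrAC.
have SH1 : carrier SH (gone SH).
  split; first by split; [exact: SLpair1 sI.1 | exact: (Gamma1 _ _ sLa)].
  by move=> w _; rewrite lfunE; exact: sI.1.
have G_group : is_group G by exact: (coset_GammaLI_J_is_group R b_nondeg Uiso Wq L_even J).
split=> //; last first.
- move=> [[M g] psi] [[/= MJ Gg] psiI]; rewrite ccS //.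
  rewrite (act_bar_coset b_nondeg Uiso Wq L_even); last by apply: mkA0_PU; auto.
  by rewrite act_mkA0 //; auto.
- by split=> //; case: cc_bij.
apply: bij_is_group G_group cc_bij SH1 _ SHM ccM.
rewrite /= ccS; [|exact: SLpair1 sI.1|exact: (Gamma1 _ _ sLa)].
apply/(as_coset_eq b_nondeg Uiso Wq L_even (mkA0_PU 0 (GLU1 _) (isometry1 _)) (PU1 _ _)).
move=> x xU; rewrite (mkA_Up Uiso Wq sp) // !id_lfunE lfunE /= subr0.
by rewrite -(Up_coord Wq sp xU).
Qed.

End SplitCoordinates.

(** * Complements *)

Section Complement.
Variables (R : realType) (V : vectType rat) (b : {symmetric V}) (U : {vspace V}).
Variables (W : vectType rat) (p : 'Hom(subvs_of (orthov b U), W)).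
Hypotheses (b_nondeg : nondegenerate b) (Uiso : (U <= orthov b U)%VS).
Hypothesis Wq : is_quotient p.
Variable L : set V.
Hypothesis L_even : even_lattice b L.

Local Notation Up := (orthov b U).
Local Notation sU := (subvs_of U).
Local Notation dU := (vdual (subvs_of U)).
Local Notation bW := (induced_form p : {symmetric W}).
Local Notation quo := (quo p).
Local Notation Ld := (dual_lattice b L).
Local Notation I := (lat_I L : set sU).
Local Notation Istar := (lat_Istar L : set dU).
Local Notation La := (Lambda p L).
Local Notation Id := (lat_Idual b L : set sU).
Local Notation GLI := (GammaLI b U L R).

Let latL : is_lattice L. Proof. exact: even_lattice_is_lattice L_even. Qed.
Let sLd : zsubgroup Ld. Proof. exact: dual_lattice_zsubgroup. Qed.

Variables (Ut : {vspace V}) (It : set V) (alpha : 'Hom(subvs_of Ut, subvs_of U)).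
Hypotheses (ItP : unimodular_complement b U L Ut It) (alphaP : is_alpha b alpha).

Local Notation Wt := (orthov b (U + Ut)).
Local Notation toU := (toUdual b U Ut).
Local Notation toW := (toW p Ut).

Lemma toUdualE u : toU u = pairing b U (vsval u).
Proof. by rewrite comp_lfunE inclE. Qed.

Lemma It_sub m : It m -> m \in Ut.
Proof.
have [[s [<- ->]] _ _] := ItP; case=> a ->.
by apply: rpred_sum => i _; apply: rpredMz; rewrite memv_span // mem_nth.
Qed.

Lemma It_full m : m \in Ut -> exists2 D : nat, (0 < D)%N & It (m *+ D).
Proof.
have [[s [<- ->]] _ _] := ItP => /(@coord_span _ _ _ (in_tuple s)) mE.
have [D D0 cD] := rat_common_den (fun i => coord (in_tuple s) i m).
exists D => //; exists [ffun i => Num.floor (D%:R * coord (in_tuple s) i m)].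
rewrite {1}mE -sumrMnl; apply: eq_bigr => i _; rewrite ffunE.
by rewrite -scaler_int Num.Theory.floorK ?cD // -scaler_nat scalerA.
Qed.

Lemma pairing_It_inj m n : It m -> It n -> pairing b U m = pairing b U n -> m = n.
Proof. by have [_ _ [_ + _]] := ItP => inj Im In; apply: inj; rewrite inE. Qed.

Lemma It0 : It 0.
Proof.
have [[s [_ ->]] _ _] := ItP; exists [ffun=> 0].
by rewrite big1 // => i _; rewrite ffunE mulr0z.
Qed.

(** The pairing is injective on It, and every vector of Ut has a positive multiple there. *)
Lemma toUdual_lker0 : lker toU == 0%VS.
Proof.
apply/lker0P; apply: raddf_inj => w; rewrite [_ w]toUdualE => w0.
have [D D0 ID] := It_full (subvsP w).
have : vsval w *+ D = 0.
  by apply: pairing_It_inj => //; [exact: It0 | rewrite raddfMn /= w0 mul0rn linear0].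
rewrite -scaler_nat => /eqP; rewrite scaler_eq0 pnatr_eq0 eqn0Ngt D0 /= => /eqP wE.
by apply: (@subvs_inj _ _ Ut); rewrite wE.
Qed.

Lemma It_surj f : Istar f -> exists2 m, It m & pairing b U m = f.
Proof. by have [_ _ [_ _ /(_ f) surj]] := ItP. Qed.

Lemma toUdual_limg : limg toU = fullv.
Proof.
apply/eqP; rewrite eqEsubv subvf; apply/subvP => f _.
have [D D0 fD] : exists2 D : nat, (0 < D)%N & Istar (f *+ D).
  have [_ bI _] := lat_I_lattice U L_even; have [D D0 fD] := bI f.
  exists D => // x Ix; have := fD x Ix.
  by rewrite /Zset /= -scaler_nat scale_lfunE.
have [m Im mf] := It_surj fD.
have -> : f = (D%:R)^-1 *: toU (vsproj Ut m).
  rewrite toUdualE vsprojK ?It_sub // mf -scaler_nat scalerA mulVf ?scale1r //.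
  by rewrite pnatr_eq0 -lt0n.
by rewrite rpredZ ?memv_img ?memvf.
Qed.

Lemma toUdualVK f : toU ((toU^-1)%VF f) = f.
Proof. by rewrite limg_lfunVK ?toUdual_limg ?memvf. Qed.

(** The section sigma attached to the complement; subtracting alpha from it, as in [Uiso_sec], gives
    its isotropic companion j. *)
Definition Usec : 'Hom(dU, V) := (Defs.incl Ut \o toU^-1)%VF.
Definition Uiso_sec : 'Hom(dU, V) := (Usec - (Defs.incl U \o alpha \o toU^-1))%VF.

Lemma UsecE f : Usec f = vsval ((toU^-1)%VF f).
Proof. by rewrite comp_lfunE inclE. Qed.

Lemma Uiso_secE f : Uiso_sec f = Usec f - vsval (alpha ((toU^-1)%VF f)).
Proof.
by rewrite add_lfunE opp_lfunE (comp_lfunE (_ \o _)%VF) (comp_lfunE (Defs.incl U)) inclE.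
Qed.

Lemma Usec_sec f u : b (Usec f) (vsval u) = f u.
Proof. by rewrite UsecE -pairingE -toUdualE toUdualVK. Qed.

Lemma Usec_pairing m : m \in Ut -> Usec (pairing b U m) = m.
Proof.
move=> mU; rewrite UsecE -{1}(vsprojK mU) -toUdualE lker0_lfunK ?vsprojK //.
exact: toUdual_lker0.
Qed.

Lemma Usec_dual_section : dual_section b L Usec.
Proof.
split=> [|f /It_surj[m Im <-]]; first exact: Usec_sec.
by rewrite Usec_pairing ?It_sub //; have [_ + _] := ItP; apply.
Qed.

Lemma Uiso_sec_diff f : Uiso_sec f - Usec f \in U.
Proof. by rewrite Uiso_secE addrC addKr -[- _]/(vsval (- alpha _)) subvsP. Qed.

Lemma memWt x : (x \in Wt) = (x \in Up) && (x \in orthov b Ut).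
Proof.
apply/idP/andP => [/mem_orthovP xW|[/mem_orthovP xU /mem_orthovP xUt]].
  by split; apply/mem_orthovP => y yU; apply: xW;
    [exact: (subvP (addvSl _ _)) | exact: (subvP (addvSr _ _))].
apply/mem_orthovP => _ /memv_addP[y yU [z zU ->]].
by rewrite linearDr /= xU // xUt // addr0.
Qed.

Lemma toWE x : toW x = quo (vsval x).
Proof. by rewrite !comp_lfunE inclE retrE. Qed.

Lemma Wt_Usec x f : x \in Wt -> b x (Usec f) = 0.
Proof.
rewrite memWt => /andP[_ /mem_orthovP xU]; rewrite UsecE.
exact/xU/subvsP.
Qed.

Lemma toW_lker0 : lker toW == 0%VS.
Proof.
apply/lker0P; apply: raddf_inj => w; rewrite [_ w]toWE => /eqP w0; have wW := subvsP w.
have wU : vsval w \in Up by move: wW; rewrite memWt => /andP[].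
rewrite (quo_eq0 Wq) // in w0.
suff w'0 : vsproj U (vsval w) = 0 by apply: subvs_inj; rewrite -(vsprojK w0) w'0.
apply: vdual_sep => f; rewrite linear0 -Usec_sec vsprojK // symfC.
exact: Wt_Usec.
Qed.

(** A lift of w to U^perp becomes orthogonal to Ut after subtracting a vector of U, found by
    transposing the section. *)
Lemma toW_limg : limg toW = fullv.
Proof.
apply/eqP; rewrite eqEsubv subvf; apply/subvP => w _.
have [x xU <-] := quo_surj Wq w; pose u := transp b Usec x.
have yW : x - vsval u \in Wt.
  rewrite memWt rpredB ?memUp //=; apply/mem_orthovP => y yU.
  rewrite -(Usec_pairing yU) symfBl symfC [b (vsval u) _]symfC Usec_sec.
  by rewrite transpE subrr.
have -> : quo x = toW (vsproj Wt (x - vsval u)).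
  by rewrite toWE vsprojK // linearB /= (quoU Uiso Wq) subr0.
by rewrite memv_img ?memvf.
Qed.

Lemma toWVK w : toW ((toW^-1)%VF w) = w.
Proof. by rewrite limg_lfunVK ?toW_limg ?memvf. Qed.

Definition Wsec : 'Hom(W, V) := (Defs.incl Wt \o toW^-1)%VF.

Lemma WsecE w : Wsec w = vsval ((toW^-1)%VF w).
Proof. by rewrite comp_lfunE inclE. Qed.

Lemma complement_splitting : splitting p Uiso_sec Wsec.
Proof.
have W_Wt w : Wsec w \in Wt by rewrite WsecE subvsP.
have W_Up w : Wsec w \in Up by move: (W_Wt w); rewrite memWt => /andP[].
split=> [f u|f g|w|w f].
- by rewrite Uiso_secE symfBl Usec_sec (formUU Uiso) subr0.
- by rewrite !Uiso_secE !UsecE; exact: alphaP.2.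
- by split=> //; rewrite WsecE -toWE toWVK.
by rewrite Uiso_secE symfBr Wt_Usec // symfC (formUUp _ (W_Up w)) subr0.
Qed.

Let sp := complement_splitting.
Local Notation mkA := (mkA p Uiso_sec Wsec).

(** Passage between Ut and the isotropic complement: a vector of Ut is its isotropic companion plus
    its image under alpha. Applying A to the latter gives M alpha, and rewriting the result in Ut
    gives the opposite alpha term. *)
Lemma has_coordsP A M g psi eta : has_coords p alpha A M g psi eta <->
  [/\ GLU M, isometries bW g, antisym eta & A = mkA M g psi eta].
Proof.
have UtE u : vsval u = Uiso_sec (toU u) + vsval (alpha u).
  by rewrite Uiso_secE UsecE lker0_lfunK ?subrK //; exact: toUdual_lker0.
have WtE w : vsval w = Wsec (toW w).
  by rewrite WsecE lker0_lfunK //; exact: toW_lker0.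
have gE w : tilde_W p Ut g w = (toW^-1)%VF (g (toW w)).
  by rewrite /tilde_W 2!comp_lfunE.
have psiE z : tilde_psi p Ut psi z = psi (toW z) by rewrite /tilde_psi comp_lfunE.
have onD (u : subvs_of Ut) : GLU M ->
    let u' := tilde_Udual b Ut (contragredient M) u in
    let w' := tilde_psistar p Ut (adjoint p psi) u' in
    mkA M g psi eta (vsval u) = vsval u' + vsval w'
          + vsval (M (alpha u) - alpha u' - 2^-1 *: tilde_psi p Ut psi w'
                   - tilde_eta b Ut eta u').
  move=> _ u' w'; set f := contragredient M (toU u).
  have u'E : u' = (toU^-1)%VF f by rewrite /u' /tilde_Udual 2!comp_lfunE.
  have toUu' : toU u' = f by rewrite u'E toUdualVK.
  have w'E : w' = (toW^-1)%VF (adjoint p psi f) by rewrite /w' /tilde_psistar 2!comp_lfunE toUu'.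
  have AE : mkA M g psi eta (vsval u) =
      mkA M g psi eta (Uiso_sec (toU u)) + mkA M g psi eta (vsval (alpha u)).
    by rewrite {1}UtE linearD.
  have psiE' : tilde_psi p Ut psi w' = psi (adjoint p psi f).
    by rewrite psiE w'E toWVK.
  have etaE : tilde_eta b Ut eta u' = eta f by rewrite /tilde_eta comp_lfunE toUu'.
  have jE : Uiso_sec f = vsval u' - vsval (alpha u') by rewrite Uiso_secE UsecE -u'E.
  rewrite AE (mkA_onU Uiso Wq sp) (mkA_onD sp) -/f psiE' etaE jE WsecE -w'E.
  move: (M (alpha u)) (alpha u') (2^-1 *: psi _) (eta f) => x y z t.
  have E (a c d e : sU) : vsval (a - c - d - e) = vsval a - vsval c - (vsval (d + e)).
    by rewrite -addrA -opprD.
  by rewrite E [LHS](ACl (1*3*5*2*4)) /= !addrA.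
split=> [[[PA M_GL g_iso eta_as] AU AW AD]|[M_GL g_iso eta_as ->]]; last first.
  split=> //.
  - split=> //; exact: mkA_PU.
  - by move=> u; rewrite (mkA_onU Uiso Wq sp).
  - move=> w; rewrite {1}WtE (mkA_onW sp) WsecE.
    by rewrite gE psiE toWVK.
  by move=> u; apply: onD.
split=> //; apply/lfunP => v; rewrite [in LHS](decomp Wq sp v) [in RHS](decomp Wq sp v).
rewrite !linearD /=; congr (_ + _ + _).
- by rewrite AU (mkA_onU Uiso Wq sp).
- by rewrite WsecE AW -WsecE (mkA_onW sp) WsecE gE psiE !toWVK.
rewrite Uiso_secE UsecE !linearB /= AD onD // AU (mkA_onU Uiso Wq sp) //.
Qed.

Lemma coords_cosetE M g psi : GLU M -> isometries bW g ->
  coords_coset p alpha (M, g, psi) = as_coset b U (mkA M g psi 0).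
Proof.
move=> M_GL g_iso; have PA0 := mkA0_PU b_nondeg Uiso Wq sp psi M_GL g_iso.
rewrite (as_cosetP b_nondeg Uiso Wq L_even PA0).
apply/seteqP; split=> A [].
  move=> eta /has_coordsP[_ _ eta_as ->]; split; first exact: mkA_PU.
  by move=> x xU; rewrite !(mkA_Up Uiso Wq sp).
move=> PA AE; have [_ _ kU _] := sp.
have [u|w|eta eta_as AmkA] := coordsP b_nondeg Uiso Wq sp (psi := psi) PA M_GL g_iso.
- by rewrite AE ?memUp // (mkA_onU Uiso Wq sp).
- by rewrite AE ?(kU w).1 // (mkA_onW sp).
by exists eta; apply/has_coordsP.
Qed.

Lemma GammaLI_WU_eq_H : GLI `&` WU p = H_group p L alpha.
Proof.
have sig := Usec_dual_section; have jsig := Uiso_sec_diff.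
apply/seteqP; split=> A.
  move=> [GA WA]; have [psi [eta [eta_as -> psiI etaI EI]]] :=
    GammaLI_WU_coords b_nondeg Uiso Wq L_even sig sp jsig GA WA.
  exists psi, eta; split=> //; apply/has_coordsP; split=> //; first exact: GLU1.
  exact: isometry1.
move=> [psi [eta [/has_coordsP[_ _ eta_as ->] psiI _ EI]]].
exact: (mkA1_GammaLI R b_nondeg Uiso Wq L_even sig sp jsig eta_as psiI EI).
Qed.

Variable iota : V -> W.
Hypothesis iotaP : is_iota p L Ut It iota.

Local Notation J := (lat_Iiota p L It iota).

(** These are the lattice vectors on which [is_iota] prescribes iota. The vector n of the definition
    agrees with m against I, hence against U as I has full rank, so m is its component in Ut. *)
Lemma It_L_coords m : It_L b U L It m -> exists (u : sU) w, L (vsval u + Wsec w + m).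
Proof.
move=> [Im [n Ln mn]].
have fmn : pairing b U n = pairing b U m.
  apply/lfunP => u; have [_ _ fI] := lat_I_lattice U L_even.
  have [D D0 ID] := fI u; rewrite !pairingE.
  have := mn _ ID; rewrite (_ : vsval (u *+ D) = vsval u *+ D); last exact: raddfMn.
  rewrite -scaler_nat !symfZr => /esym/mulfI; apply.
  by rewrite pnatr_eq0 -lt0n.
have nE := decomp Wq sp n; rewrite fmn Uiso_secE Usec_pairing ?It_sub // in nE.
set a := alpha _ in nE; exists (prU b Uiso_sec n - a), (prW p Uiso_sec n).
suff <- : n = vsval (prU b Uiso_sec n - a) + Wsec (prW p Uiso_sec n) + m by [].
have vB (u v : sU) : vsval (u - v) = vsval u - vsval v by [].
by rewrite vB [LHS]nE addrA [LHS](ACl (1*4*2*3)).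
Qed.

(** The class of 0 in Lambda^*/Lambda: u in L^* pairs integrally with It_L, whose elements pair with
    U as vectors of L do. *)
Lemma lat_Idual_sub_Iiota : Id `<=` J.
Proof.
move=> u Iu; exists 0 => [|m [_ [n Ln mn]]].
  by move=> x _; rewrite symf0l.
rewrite symf0l subr0.
have [_ _ fI] := lat_I_lattice U L_even; have [D D0 ID] := fI u.
have := mn _ ID; rewrite (_ : vsval (u *+ D) = vsval u *+ D); last exact: raddfMn.
rewrite -scaler_nat !symfZr => /mulfI; rewrite pnatr_eq0 -lt0n D0 symfC => -> //.
by rewrite symfC; apply: Iu.
Qed.

(** Pairing x with a lattice vector u + w + m gives an integer, the sum of (prU x, m) and (quo x,
    w). As w is iota m modulo Lambda, the first term is minus (quo x, iota m) modulo Z, whence the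
    witness - quo x. *)
Lemma prU_Iiota x : x \in Up -> Ld x -> J (prU b Uiso_sec x).
Proof.
move=> xU Lx; exists (- quo x) => [|m Lm].
  exact: (zsubgroupN (dual_lattice_zsubgroup bW La) (quo_Lambda_dual Wq xU Lx)).
have [u [w Lumw]] := It_L_coords Lm; have [_ _ iota3] := iotaP.
have mU : m \in Ut by case: Lm => /It_sub.
have [|_ Lw La0] := iota3 u ((toW^-1)%VF w) (vsproj Ut m).
  by rewrite vsprojK // -WsecE.
rewrite toWVK vsprojK // in Lw La0.
have bxn : b x (vsval u + Wsec w + m) \is a Num.int by apply: Lx.
have xE := Up_coord Wq sp xU.
have W_Wt z : Wsec z \in Wt by rewrite WsecE subvsP.
have W_Up z : Wsec z \in Up by move: (W_Wt z); rewrite memWt => /andP[].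
have bxnE : b x (vsval u + Wsec w + m) = b (vsval (prU b Uiso_sec x)) m + bW (quo x) w.
  rewrite !symfDr (symfC b x (vsval u)) (formUUp _ xU) add0r.
  have -> : b x (Wsec w) = bW (quo x) w.
    have [_ _ kU _] := sp.
    by rewrite -{2}(kU w).2 (form_quo Wq) ?(kU w).1.
  rewrite addrC {1}xE symfDl; congr (_ + _).
  by rewrite -(Usec_pairing mU) (Wt_Usec _ (W_Wt _)) addr0.
have quoLa : bW (quo x) (w - iota m) \is a Num.int.
  by apply: (quo_Lambda_dual Wq xU Lx).
rewrite symfNl opprK.
have -> : b (vsval (prU b Uiso_sec x)) m + bW (quo x) (iota m) =
    b x (vsval u + Wsec w + m) - bW (quo x) (w - iota m).
  by rewrite bxnE symfBr opprB addrA [RHS](ACl (1*3*(2*4))) /= subrr addr0.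
exact: rpredB.
Qed.

Lemma coords_splits (S := SL_Gamma p L J R)
    (G := coset_group b U (as_coset b U @` GammaLI_J R b L J)) :
  splits_in_coords p alpha (hom_group p L) G S.
Proof.
exact: (cc_splits R b_nondeg Uiso Wq L_even Usec_dual_section sp Uiso_sec_diff
  prU_Iiota coords_cosetE).
Qed.

End Complement.

Lemma GammaLI_bar_preim (R : realType) (V : vectType rat) (b : {symmetric V})
    (U : {vspace V}) (W : vectType rat) (p : 'Hom(subvs_of (orthov b U), W))
    (L : set V) (J : set (subvs_of U)) :
  nondegenerate b -> (U <= orthov b U)%VS -> is_quotient p -> even_lattice b L ->
  GammaLI_bar b U L R `&` act_bar p @^-1` carrier (SL_Gamma p L J R) =
  as_coset b U @` GammaLI_J R b L J.
Proof.
move=> b_nondeg Uiso Wq L_even; apply/seteqP; split=> [_ [[A GA <-]]|_ [A [GA JA] <-]].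
  have [PA _ _] := GA; rewrite /preimage /mkset (act_bar_coset b_nondeg Uiso Wq L_even PA).
  by move=> [JA _]; exists A.
have [PA _ _] := GA; split; first by exists A.
rewrite /preimage /mkset (act_bar_coset b_nondeg Uiso Wq L_even PA).
by split=> //; exact: (GammaLI_act_W b_nondeg Uiso Wq L_even GA).
Qed.

Theorem theorem3p4 (R : realType) (V : vectType rat) (b : {symmetric V})
    (L : set V) (U : {vspace V})
    (W : vectType rat) (p : 'Hom(subvs_of (orthov b U), W))
    (b_nondeg : nondegenerate b) (L_even : even_lattice b L)
    (U_isotropic : (U <= orthov b U)%VS) (W_quotient : is_quotient p) :
  [/\ short_exact (lfun_group (GammaLI b U L R `&` WU p))
        (lfun_group (GammaLI b U L R))
        (SL_Gamma p L (lat_Idual b L) R)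
        id (act p),
      short_exact (hom_group p L)
        (coset_group b U (GammaLI_bar b U L R))
        (SL_Gamma p L (lat_Idual b L) R)
        (hom_coset p) (act_bar p) &
      forall (Ut : {vspace V}) (It : set V)
          (alpha : 'Hom(subvs_of Ut, subvs_of U)),
        unimodular_complement b U L Ut It -> is_alpha b alpha ->
        GammaLI b U L R `&` WU p = H_group p L alpha /\
        forall iota : V -> W, is_iota p L Ut It iota ->
          let S := SL_Gamma p L (lat_Iiota p L It iota) R in
          let G := coset_group b U
            (GammaLI_bar b U L R `&` act_bar p @^-1` carrier S) in
          short_exact (hom_group p L) G S (hom_coset p) (act_bar p) /\
          splits_in_coords p alpha (hom_group p L) G S].
Proof.
(* For J = I_{L^*} the condition on the action over U holds throughout, so the second sequence is an
   instance of [coset_exact]. *)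
have bar_Id : GammaLI_bar b U L R =
    as_coset b U @` GammaLI_J R b L (lat_Idual b L : set (subvs_of U)).
  rewrite -(GammaLI_bar_preim R (lat_Idual b L) b_nondeg U_isotropic W_quotient L_even).
  apply/esym/setIidPl => _ [A GA <-]; have [PA _ _] := GA; rewrite /preimage /mkset.
  rewrite (act_bar_coset b_nondeg U_isotropic W_quotient L_even PA).
  by split; [exact: (GammaLI_act_U b_nondeg L_even GA) |
             exact: (GammaLI_act_W b_nondeg U_isotropic W_quotient L_even GA)].
split.
- exact: GammaLI_exact.
- by rewrite bar_Id; exact: coset_exact.
move=> Ut It alpha ItP alphaP; split.
  exact: (GammaLI_WU_eq_H R b_nondeg U_isotropic W_quotient L_even ItP alphaP).
move=> iota iotaP S G.
rewrite /G /S (GammaLI_bar_preim R (lat_Iiota p L It iota) b_nondeg U_isotropic W_quotient L_even).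
split; last exact: coords_splits.
by apply: coset_exact => //; exact: lat_Idual_sub_Iiota.
Qed.
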